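(* Let $\Omega=(0,1)^d$, $T,\kappa,c>0$, and fix $v=Bf$ with $B(x)=\prod_{i=1}^dx_i(1-x_i)$ and $f\in\mathcal F_{L,w}$ a tanh neural network on $\mathbb R^{d+1}$. Let $\sigma\in\{\mathrm H_0,\mathrm H_1,\mathrm W\}$, $r\in\{0,1\}$, and suppose the initial data ($g$, and also $h$ if $\sigma=\mathrm W$) satisfy the regularity assumption (D) of the context for $(\sigma,r)$. Then there is a constant $K>0$ such that for all partitions $\mathcal P_\Omega$ of $\Omega$ and $\mathcal P$ of $\Omega_T=\Omega\times(0,T]$ of the form described in the context, with maximal cell radii $h_\Omega$ and $h_P$ respectively, $$0\le\widehat{\mathcal R}_\sigma^r(v;\mathcal P_\Omega,\mathcal P)-\mathcal R_\sigma(v)\le K\left(h_\Omega^{r+1}+h_P^2\right).$$ In particular $K$ is independent of the partitions. Consequently, along any sequence of such pairs of partitions for which $h_\Omega,h_P\to0$, $\widehat{\mathcal R}_\sigma^r(v;\mathcal P_\Omega,\mathcal P)\to\mathcal R_\sigma(v)$.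
   Context: **Networks and their derivative bounds.** Let $n=d+1$. $\mathcal F_{L,w}$ denotes the networks $f:\mathbb R^n\to\mathbb R$, with $\mu=\tanh$ componentwise, $z^1(x)=W^1x+b^1$, $a^k=\mu(z^k)$, $z^k=W^ka^{k-1}+b^k$ ($k=2,\dots,L$), $f=W^{L+1}a^L+b^{L+1}=:z^{L+1}$, where $W^1\in\mathbb R^{w\times n}$, $W^k\in\mathbb R^{w\times w}$ ($2\le k\le L$), $W^{L+1}\in\mathbb R^{1\times w}$. Write $p_\gamma^k=\partial^\gamma z^k$; $\odot$ is the Hadamard product (applied to every column if one factor is a matrix); absolute values, powers, max, exp are componentwise; $e_\ell$ are coordinate multi-indices. For each $m\ge1$ fix $N_m\in\mathbb N_0$. Given a centre $y\in\mathbb R^n$ and radius vector $\boldsymbol\varepsilon\in[0,\infty)^n$ let $$Q^{m,k}(\rho)=\sum_{j=1}^{N_m}\frac{\rho^j}{j!}\odot|\mu^{(m+j)}(z^k(y))|+\rho^{N_m+1}\odot\frac{(m+N_m+1)!}{(N_m+1)!}2^{m+N_m+2}\exp\{-2\max(0,|z^k(y)|-\rho)\}.$$ First order: set $p_0^1=W^1$, $P^1=0\in\mathbb R^{w\times n}$; for $k=1,\dots,L$: $\widehat p^k=|p_0^k|+P^k$, $Q^{m,k}=Q^{m,k}(\widehat p^k\boldsymbol\varepsilon)$ for $m=1,\dots,4$, $B^k=(|\mu'(z^k(y))|+Q^{1,k})\odot\widehat p^k-|\mu'(z^k(y))\odot p_0^k|$, $P^{k+1}=|W^{k+1}|B^k$,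 $p_0^{k+1}=W^{k+1}(\mu'(z^k(y))\odot p_0^k)$. $P_{e_\ell}^k$ is the $\ell$-th column of $P^k$ and $\mathrm{ALG}_1(e_\ell,f,y,\boldsymbol\varepsilon)=P_{e_\ell}^{L+1}$. Higher order, recursively for $\alpha=e_{\ell_1}+\dots+e_{\ell_s}$, $s\ge2$: with $\Pi_\alpha$ the set of partitions of $\{1,\dots,s\}$ into nonempty blocks, $\beta_I=\sum_{i\in I}e_{\ell_i}$, $|\pi|$ the number of blocks, set $P_\alpha^1=0$ and for $k=1,\dots,L$ $$B_\alpha^k=\sum_{\pi\in\Pi_\alpha}\Big((|\mu^{(|\pi|)}(z^k(y))|+Q^{|\pi|,k})\odot\bigodot_{I\in\pi}(|p_{\beta_I}^k(y)|+P_{\beta_I}^k)-\Big|\mu^{(|\pi|)}(z^k(y))\odot\bigodot_{I\in\pi}p_{\beta_I}^k(y)\Big|\Big),\quad P_\alpha^{k+1}=|W^{k+1}|B_\alpha^k,$$ and $\mathrm{ALG}_s(\alpha,f,y,\boldsymbol\varepsilon)=P_\alpha^{L+1}$. Put $\mathcal E_f^\alpha(y,\boldsymbol\varepsilon)=|\partial^\alpha f(y)|+\mathrm{ALG}_{|\alpha|}(\alpha,f,y,\boldsymbol\varepsilon)$ for $|\alpha|\ge1$ and $\mathcal E_f^0(y,\boldsymbol\varepsilon)=|f(y)|+\sum_{\ell=1}^n\varepsilon_\ell\mathcal E_f^{e_\ell}(y,\boldsymbol\varepsilon)$. **Partitions.** $\boldsymbol\varepsilon_x\in(0,\infty)^d$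 and $\varepsilon_t>0$ are such that there are centres $y_k\in\Omega$, $t_m\in(0,T)$ for which the boxes $C_k=\{x:|x_j-y_{k,j}|\le\varepsilon_{x,j}\ \forall j\}$ (finitely many) have disjoint interiors and union $\overline\Omega$, and the intervals $[t_m-\varepsilon_t,t_m+\varepsilon_t]$ (finitely many) have disjoint interiors and union $[0,T]$. $\mathcal P_\Omega=\{C_k\}_k$ and $\mathcal P=\{C_k\times[t_m-\varepsilon_t,t_m+\varepsilon_t]\}_{k,m}$. The maximal radii are $h_\Omega=\max_j\varepsilon_{x,j}$ and $h_P=\max(h_\Omega,\varepsilon_t)$. A cell is written $C=\zeta_C+\prod_{q=1}^s[-\varepsilon_{C,q},\varepsilon_{C,q}]$ with radius vector $\boldsymbol\varepsilon_C$ ($s=d$ or $d+1$). **Verified norm bounds.** For scalar $\phi$, a partition $\mathcal T$, and coefficients $b_{q,C}(\phi)$ (for $r=0$) or $h_{q\ell,C}(\phi)$ (for $r=1$), with $\rho_q=|\zeta_q-\zeta_{C,q}|$: $P_C^0=\phi(\zeta_C)$, $P_C^1(\zeta)=\phi(\zeta_C)+\nabla\phi(\zeta_C)\cdot(\zeta-\zeta_C)$, $D_C^0=\sum_qb_{q,C}(\phi)\rho_q$, $D_C^1=\frac12\sum_{q,\ell}h_{q\ell,C}(\phi)\rho_q\rho_\ell$, $A_C^0=|\phi(\zeta_C)|$, $A_C^1=|\phi(\zeta_C)|+\sum_q|\partial_q\phi(\zeta_C)|\rho_q$, and $$\mathcal U_{\mathcal T}^r(\phi)=\Big(\sum_{C\in\mathcal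 T}\Big[\int_C(P_C^r)^2\,d\zeta+2\int_CA_C^rD_C^r\,d\zeta+\int_C(D_C^r)^2\,d\zeta\Big]\Big)^{1/2}.$$ For vector-valued $\boldsymbol\phi=(\phi_1,\dots,\phi_p)$, $\mathcal U_{\mathcal T}^r(\boldsymbol\phi)=(\sum_\ell\mathcal U_{\mathcal T}^r(\phi_\ell)^2)^{1/2}$. **Residuals.** $v_0=v(\cdot,0)$, $\dot v_0=\partial_tv(\cdot,0)$, $e_0=g-v_0$, $e_{\mathrm v}=h-\dot v_0$, $R_{\mathrm H}(v)=\partial_tv-\kappa\Delta v$, $R_{\mathrm W}(v)=\partial_t^2v-c^2\Delta v$. With $\lambda_1=d\pi^2$ the smallest Dirichlet eigenvalue of $-\Delta$ on $\Omega$ and $C_\Omega=(1+\lambda_1^{-1}+\lambda_1^{-2})^{1/2}$, set $\alpha^{\mathrm H}=1+\kappa^{-1/2}+\kappa^{1/2}$, $\beta^{\mathrm H}=\lambda_1^{-1/2}(2+\kappa^{-1/2}+\kappa^{-1})$, $C_1=1+\kappa^{1/2}+C_\Omega\kappa^{-1/2}$, $C_2=2+\kappa^{-1/2}+C_\Omega\kappa^{-1}$, $\alpha^{\mathrm W}=1+c+c^2\sqrt T$, $\eta^{\mathrm W}=1+c^{-1}+c\sqrt T$, $\beta^{\mathrm W}=\lambda_1^{-1/2}+cT+\sqrt T(1+c^{-1})$, and $$\mathcal R_{\mathrm H_0}(v)=\alpha^{\mathrm H}\|e_0\|+\beta^{\mathrm H}\|R_{\mathrm H}(v)\|,\quad\mathcal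 R_{\mathrm H_1}(v)=C_1\|\nabla e_0\|+C_2\|R_{\mathrm H}(v)\|,\quad\mathcal R_{\mathrm W}(v)=\alpha^{\mathrm W}\|\nabla e_0\|+\eta^{\mathrm W}\|e_{\mathrm v}\|+\beta^{\mathrm W}\|R_{\mathrm W}(v)\|,$$ with $L^2(\Omega)$ norms for $e_0,\nabla e_0,e_{\mathrm v}$ and $L^2(\Omega_T)$ norms for $R_{\mathrm H}(v),R_{\mathrm W}(v)$. The computable bounds are $$\widehat{\mathcal R}_{\mathrm H_0}^r=\alpha^{\mathrm H}\mathcal U_{\mathcal P_\Omega}^r(e_0)+\beta^{\mathrm H}\mathcal U_{\mathcal P}^1(R_{\mathrm H}(v)),\quad\widehat{\mathcal R}_{\mathrm H_1}^r=C_1\mathcal U_{\mathcal P_\Omega}^r(\nabla e_0)+C_2\mathcal U_{\mathcal P}^1(R_{\mathrm H}(v)),$$ $$\widehat{\mathcal R}_{\mathrm W}^r=\alpha^{\mathrm W}\mathcal U_{\mathcal P_\Omega}^r(\nabla e_0)+\eta^{\mathrm W}\mathcal U_{\mathcal P_\Omega}^r(e_{\mathrm v})+\beta^{\mathrm W}\mathcal U_{\mathcal P}^1(R_{\mathrm W}(v)),$$ using the coefficients specified below. **Assumption (D) on the data.** Let $k_g=0$ if $\sigma=\mathrm H_0$, $k_g=1$ if $\sigma\in\{\mathrm H_1,\mathrm W\}$, and $k_h=0$ ($h$ only appears for $\sigma=\mathrm W$). For each datum $a\in\{g,h\}$ that appears, $a\in C^{k_a+r+1}(\overline\Omega)$ (with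 point values of $\partial^\beta a$ available for $|\beta|\le k_a+r$), and for every $|\beta|\le k_a+r+1$ a (computable) locally bounded function $\mathcal D_a^\beta:\overline\Omega\times[0,\infty)^d\to\mathbb R_+$ is given with $|\partial^\beta a(x)|\le\mathcal D_a^\beta(y,\boldsymbol\varepsilon)$ for all $x\in\overline\Omega$ with $|x_j-y_j|\le\varepsilon_j$ for all $j$. **Coefficients for the initial residuals.** With $b_0=\frac14,b_1=1,b_2=2,b_m=0$ $(m\ge3)$ let $\omega_B^\beta(\rho)=\rho\sum_{j=1}^d\prod_{i=1}^db_{\beta_i+\delta_{ij}}$. Let $\tau=e_{d+1}$ (time), and view spatial multi-indices as spacetime ones. For $C_k\in\mathcal P_\Omega$ put $\mathsf G_k^\beta=\mathcal D_g^\beta(y_k,\boldsymbol\varepsilon_x)$, $\mathsf H_k^\beta=\mathcal D_h^\beta(y_k,\boldsymbol\varepsilon_x)$, $\mathsf B_k^\beta=|\partial^\beta B(y_k)|+\omega_B^\beta(\|\boldsymbol\varepsilon_x\|_\infty)$, $\mathsf F_k^\gamma=\mathcal E_f^\gamma((y_k,0),(\boldsymbol\varepsilon_x,0))$, $\mathsf V_k^\alpha=\sum_{\beta\le\alpha}\binom\alpha\beta\mathsf B_k^\beta\mathsf F_k^{\alpha-\beta}$, $\mathsf V_{\mathrm v,k}^\alpha=\sum_{\beta\le\alpha}\binom\alpha\beta\mathsf B_k^\beta\mathsf F_k^{\alpha-\beta+\tau}$ (spatial $\alpha,\beta$). For $j,q,\ell\in\{1,\dots,d\}$: $b_{q,C_k}(e_0)=\mathsf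 G_k^{e_q}+\mathsf V_k^{e_q}$, $h_{q\ell,C_k}(e_0)=\mathsf G_k^{e_q+e_\ell}+\mathsf V_k^{e_q+e_\ell}$; $b_{q,C_k}(\partial_je_0)=h_{qj,C_k}(e_0)$, $h_{q\ell,C_k}(\partial_je_0)=\mathsf G_k^{e_j+e_q+e_\ell}+\mathsf V_k^{e_j+e_q+e_\ell}$; $b_{q,C_k}(e_{\mathrm v})=\mathsf H_k^{e_q}+\mathsf V_{\mathrm v,k}^{e_q}$, $h_{q\ell,C_k}(e_{\mathrm v})=\mathsf H_k^{e_q+e_\ell}+\mathsf V_{\mathrm v,k}^{e_q+e_\ell}$. **Coefficients for the PDE residuals.** Let $C\in\mathcal P$, $\lambda_{\mathrm H}=\kappa$, $\lambda_{\mathrm W}=c^2$, $s(x)=x(1-x)$. Set $\mathsf D^0=\sum_{j=1}^{d+1}\varepsilon_{C,j}\mathcal E_f^{e_j}(\zeta_C,\boldsymbol\varepsilon_C)$ and $\mathsf D^\alpha=\mathrm{ALG}_{|\alpha|}(\alpha,f,\zeta_C,\boldsymbol\varepsilon_C)$ for $|\alpha|\ge1$. For $j\le d$ let $[a_j,b_j]=[\zeta_{C,j}-\varepsilon_{C,j},\zeta_{C,j}+\varepsilon_{C,j}]\cap[0,1]$ and $b_{C,j}^{(0)}=s(\min\{b_j,\max\{a_j,\frac12\}\})$, $b_{C,j}^{(1)}=\max\{|1-2a_j|,|1-2b_j|\}$, $b_{C,j}^{(2)}=2$, $b_{C,j}^{(m)}=0$ for $m\ge3$. For $\beta\in\mathbb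 N_0^{d+1}$ let $\mathsf B_C^\beta=\prod_{j=1}^db_{C,j}^{(\beta_j)}$ if $\beta_{d+1}=0$ and $0$ otherwise; $\widehat{\mathsf B}_{i,C}^\beta=\prod_{j\ne i,\,j\le d}b_{C,j}^{(\beta_j)}$ if $\beta_{d+1}=\beta_i=0$ and $0$ otherwise. With $\mathcal A_{\mathrm H}^\gamma=\partial^{\gamma+\tau}f-\kappa\sum_{i=1}^d\partial^{\gamma+2e_i}f$ and $\mathcal A_{\mathrm W}^\gamma=\partial^{\gamma+2\tau}f-c^2\sum_{i=1}^d\partial^{\gamma+2e_i}f$, set $$\mathsf A_{\mathrm H}^\gamma=|\mathcal A_{\mathrm H}^\gamma(\zeta_C)|+\mathsf D^{\gamma+\tau}+\kappa\sum_{i=1}^d\mathsf D^{\gamma+2e_i},\qquad\mathsf A_{\mathrm W}^\gamma=|\mathcal A_{\mathrm W}^\gamma(\zeta_C)|+\mathsf D^{\gamma+2\tau}+c^2\sum_{i=1}^d\mathsf D^{\gamma+2e_i},$$ and with $H_i^\gamma=(1-2x_i)\partial^{\gamma+e_i}f-(2\gamma_i+1)\partial^\gamma f$, $$\mathsf H_i^\gamma=|H_i^\gamma(\zeta_C)|+(|1-2\zeta_{C,i}|+2\varepsilon_{C,i})\mathsf D^{\gamma+e_i}+2\varepsilon_{C,i}|\partial^{\gamma+e_i}f(\zeta_C)|+(2\gamma_i+1)\mathsf D^\gamma.$$ For $\mathfrak p\in\{\mathrm H,\mathrm W\}$ and $q,\ell\in\{1,\dots,d+1\}$ the coefficients used in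 $\mathcal U_{\mathcal P}^1(R_{\mathfrak p}(v))$ are $$h_{q\ell,C}^{\mathfrak p}=\mathsf B_C^{e_q+e_\ell}\mathsf A_{\mathfrak p}^0+\mathsf B_C^{e_q}\mathsf A_{\mathfrak p}^{e_\ell}+\mathsf B_C^{e_\ell}\mathsf A_{\mathfrak p}^{e_q}+\mathsf B_C^0\mathsf A_{\mathfrak p}^{e_q+e_\ell}+2\lambda_{\mathfrak p}\sum_{i=1}^d\left(\widehat{\mathsf B}_{i,C}^{e_q+e_\ell}\mathsf H_i^0+\widehat{\mathsf B}_{i,C}^{e_q}\mathsf H_i^{e_\ell}+\widehat{\mathsf B}_{i,C}^{e_\ell}\mathsf H_i^{e_q}+\widehat{\mathsf B}_{i,C}^0\mathsf H_i^{e_q+e_\ell}\right).$$ *)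

(* Defs.v *)
From HB Require Import structures.
From mathcomp Require Import all_boot all_order all_algebra.
From mathcomp Require Import all_classical all_reals all_analysis.

Set Implicit Arguments.
Unset Strict Implicit.
Unset Printing Implicit Defensive.

Import Order.TTheory GRing.Theory Num.Theory.
Import numFieldNormedType.Exports.

Local Open Scope classical_set_scope.
Local Open Scope ring_scope.

(** * Multi-indices and partial derivatives *)

(* Multi-indices are added with the pointwise [nmodType] structure of finite
   functions. *)
Notation mindex n := {ffun 'I_n -> nat}.

Definition unit_mi n (i : 'I_n) : mindex n := [ffun j => (j == i : nat)].

Definition mi_deg n (a : mindex n) : nat := (\sum_i a i)%N.

Definition mi_le n (b a : mindex n) : bool := [forall i, (b i <= a i)%N].

Definition mi_sub n (a b : mindex n) : mindex n := [ffun i => (a i - b i)%N].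

Definition mi_bin n (a b : mindex n) : nat := (\prod_i 'C(a i, b i))%N.

(* The list l_1, ..., l_s, with s = |a|, such that a = e_{l_1} + ... + e_{l_s}. *)
Definition mi_seq n (a : mindex n) : seq 'I_n :=
  flatten [seq nseq (a i) i | i <- enum 'I_n].

(* [F] summed over all b <= a; the entries of such a b are at most |a|. *)
Definition sum_mi_le (R : realType) n (a : mindex n) (F : mindex n -> R) : R :=
  \sum_(b : {ffun 'I_n -> 'I_(mi_deg a).+1} |
          mi_le [ffun i => nat_of_ord (b i)] a)
    F [ffun i => nat_of_ord (b i)].

Section PartialDerivatives.
Context {R : realType}.

Definition pder n (i : 'I_n) (f : 'rV[R]_n -> R) : 'rV[R]_n -> R :=
  fun x => 'D_(delta_mx 0 i) f x.

Definition mpder n (a : mindex n) (f : 'rV[R]_n -> R) : 'rV[R]_n -> R :=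
  foldr (@pder n) f (mi_seq a).

End PartialDerivatives.

(** * Lebesgue measure and integral on R^n *)

Section SigmaFiniteCopy.
Context {d} {T : measurableType d} {R : realType}.
Variables (m : {measure set T -> \bar R}) (H : sigma_finite setT m).

Definition sigma_finite_copy & sigma_finite setT m : set T -> \bar R := m.

HB.instance Definition _ := Measure.on (sigma_finite_copy H).
HB.instance Definition _ :=
  Measure_isSigmaFinite.Build _ _ _ (sigma_finite_copy H) H.

End SigmaFiniteCopy.

Section LebesgueTuple.
Context {R : realType}.
Local Open Scope ereal_scope.

Local Notation tupR n := (n.-tuple (measurableTypeR R)).

Definition tuple_cons n (p : measurableTypeR R * tupR n) : tupR n.+1 :=
  [the n.+1.-tuple (measurableTypeR R) of p.1 :: p.2].

(* Lebesgue measure on R^n, as the n-fold product measure. *)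
Fixpoint lebesgue_tuple (n : nat) : set (tupR n) -> \bar R :=
  match n return set (tupR n) -> \bar R with
  | 0%N => dirac [tuple]
  | n'.+1 => pushforward (lebesgue_measure \x @lebesgue_tuple n')
                         (@tuple_cons n')
  end.

Let tuple_uncons n (t : tupR n.+1) : measurableTypeR R * tupR n :=
  (tnth t ord0, [tuple of behead t]).

Let measurable_tuple_cons n : measurable_fun [set: _] (@tuple_cons n).
Proof. exact: measurable_cons. Qed.

Let measurable_tuple_uncons n : measurable_fun [set: _] (@tuple_uncons n).
Proof.
apply/measurable_fun_pair; first exact: measurable_tnth.
exact: measurable_behead.
Qed.

Let tuple_consK n : cancel (@tuple_cons n) (@tuple_uncons n).
Proof.
move=> [x t]; rewrite /tuple_uncons /tuple_cons /=; congr pair.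
by apply/val_inj.
Qed.

Let lebesgue_tuple_spec n : exists m : {sigma_finite_measure set (tupR n) -> \bar R},
  (m : set _ -> _) = @lebesgue_tuple n.
Proof.
elim: n => [|n [m IH]] /=; first by exists (dirac [tuple]).
pose pm : {measure set (measurableTypeR R * tupR n)%type -> \bar R} :=
  lebesgue_measure \x m.
pose nu0 : {measure set (tupR n.+1) -> \bar R} :=
  pushforward pm (@tuple_cons n).
pose nu := nu0 (@measurable_tuple_cons n).
have nuS : sigma_finite setT (nu : set _ -> \bar R).
  have [F UF mF] : sigma_finite setT pm.
    have /sigma_finiteP[F [TF ndF Foo]] :=
      sigma_finiteT (lebesgue_measure : {sigma_finite_measure set (measurableTypeR R) -> \bar R}).
    have /sigma_finiteP[G [TG ndG Goo]] := sigma_finiteT m.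
    exists (fun k => F k `*` G k).
      rewrite -setXTT TF TG predeqE => -[x y]; split.
        move=> [/= [i _ Fix] [j _ Gjy]]; exists (maxn i j) => //; split.
        - by move: x Fix; exact/subsetPset/ndF/leq_maxl.
        - by move: y Gjy; exact/subsetPset/ndG/leq_maxr.
      by move=> [i _ []/= ? ?]; split; exists i.
    move=> k; have [? ?] := Foo k; have [? ?] := Goo k.
    split; first exact: measurableX.
    by rewrite /pm /= product_measure1E// lte_mul_pinfty// ge0_fin_numE.
  exists (fun k => @tuple_uncons n @^-1` F k).
    by rewrite -preimage_bigcup -UF preimage_setT.
  move=> k; have [mFk Fk] := mF k; split.
    by rewrite -[X in measurable X]setTI; exact: measurable_tuple_uncons.
  rewrite /nu /nu0 /= /pushforward -comp_preimage.
  rewrite (_ : _ \o _ = id) ?preimage_id//.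
  by apply/funext => p; exact: tuple_consK.
by exists (sigma_finite_copy nuS); rewrite -IH.
Qed.

Let lebesgue_tuple0 n : @lebesgue_tuple n set0 = 0.
Proof. by have [m <-] := lebesgue_tuple_spec n; exact: measure0. Qed.

Let lebesgue_tuple_ge0 n A : 0 <= @lebesgue_tuple n A.
Proof. by have [m <-] := lebesgue_tuple_spec n; exact: measure_ge0. Qed.

Let lebesgue_tuple_sigma_additive n :
  semi_sigma_additive (@lebesgue_tuple n).
Proof.
by have [m <-] := lebesgue_tuple_spec n; exact: measure_semi_sigma_additive.
Qed.

HB.instance Definition _ n := isMeasure.Build _ _ _ (@lebesgue_tuple n)
  (lebesgue_tuple0 n) (@lebesgue_tuple_ge0 n) (@lebesgue_tuple_sigma_additive n).

Let lebesgue_tuple_sigma_finite n :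
  sigma_finite setT (@lebesgue_tuple n).
Proof. by have [m <-] := lebesgue_tuple_spec n; exact: sigma_finiteT. Qed.

HB.instance Definition _ n := Measure_isSigmaFinite.Build _ _ _
  (@lebesgue_tuple n) (@lebesgue_tuple_sigma_finite n).

End LebesgueTuple.
Arguments lebesgue_tuple {R} n _.

Section Lebesgue.
Context {R : realType}.

Definition row_of_tuple n (t : n.-tuple (measurableTypeR R)) : 'rV[R]_n :=
  \row_i tnth t i.

Definition integral_rV n (A : set 'rV[R]_n) (f : 'rV[R]_n -> R) : R :=
  \int[lebesgue_tuple n]_(t in @row_of_tuple n @^-1` A) f (row_of_tuple t).

(* The L^2(A) norm of the vector field (f_i)_{i < p}. *)
Definition normL2 n (A : set 'rV[R]_n) p (f : 'I_p -> 'rV[R]_n -> R) : R :=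
  Num.sqrt (integral_rV A (fun x => \sum_i f i x ^+ 2)).

Definition normL2s n (A : set 'rV[R]_n) (f : 'rV[R]_n -> R) : R :=
  Num.sqrt (integral_rV A (fun x => f x ^+ 2)).

End Lebesgue.

(** * tanh networks *)

Section Networks.
Context {R : realType}.

Definition tanh (x : R) : R :=
  (expR x - expR (- x)) / (expR x + expR (- x)).

Definition abs_mx m n (A : 'M[R]_(m, n)) : 'M[R]_(m, n) := map_mx Num.norm A.

Definition had_col w n (u : 'cV[R]_w) (A : 'M[R]_(w, n)) : 'M[R]_(w, n) :=
  \matrix_(i, j) (u i 0 * A i j).

(* [net_Wh k] and [net_bh k] are W^k and b^k for 2 <= k <= L; the other values
   of these two sequences are never used. *)
Record network (n w L : nat) := Network {
  net_W1 : 'M[R]_(w, n);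
  net_b1 : 'cV[R]_w;
  net_Wh : nat -> 'M[R]_w;
  net_bh : nat -> 'cV[R]_w;
  net_Wo : 'rV[R]_w;
  net_bo : R }.

Variables (n w L : nat) (f : network n w L).

(* z^k for 1 <= k <= L; the value at k = 0 is junk, here and in the other
   recursions on the layer below. *)
Fixpoint preact (k : nat) (x : 'rV[R]_n) : 'cV[R]_w :=
  if k is k'.+1 then
    if k' is _.+1 then
      net_Wh f k *m map_mx tanh (preact k' x) + net_bh f k
    else net_W1 f *m x^T + net_b1 f
  else 0.

Definition net_fun (x : 'rV[R]_n) : R :=
  (net_Wo f *m map_mx tanh (preact L x)) 0 0 + net_bo f.

(* The truncation orders N_m, the centre y and the radius vector epsilon. *)
Variables (N : nat -> nat) (y eps : 'rV[R]_n).

(* mu^(m)(z^k(y)) *)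
Definition dmu (m k : nat) : 'cV[R]_w := map_mx (derive1n m tanh) (preact k y).

Definition Qval (m k : nat) (rho : 'cV[R]_w) : 'cV[R]_w :=
  \col_i (\sum_(1 <= j < (N m).+1)
            rho i 0 ^+ j / j`!%:R * `|dmu (m + j) k i 0|
          + rho i 0 ^+ (N m).+1
            * ((m + N m + 1)`!%:R / (N m + 1)`!%:R * 2 ^+ (m + N m + 2))
            * expR (- 2 * Num.max 0 (`|preact k y i 0| - rho i 0))).

(* p_0^k, the Jacobian of z^k at y. *)
Fixpoint jac (k : nat) : 'M[R]_(w, n) :=
  if k is k'.+1 then
    if k' is _.+1 then net_Wh f k *m had_col (dmu 1 k') (jac k')
    else net_W1 f
  else 0.

(* Q^{m,k} and B^k, as functions of P^k. *)
Definition Qlayer (m k : nat) (Pk : 'M[R]_(w, n)) : 'cV[R]_w :=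
  Qval m k ((abs_mx (jac k) + Pk) *m eps^T).

Definition Blayer1 (k : nat) (Pk : 'M[R]_(w, n)) : 'M[R]_(w, n) :=
  had_col (abs_mx (dmu 1 k) + Qlayer 1 k Pk) (abs_mx (jac k) + Pk)
  - abs_mx (had_col (dmu 1 k) (jac k)).

(* The matrix P^k. *)
Fixpoint Player1 (k : nat) : 'M[R]_(w, n) :=
  if k is k'.+1 then
    if k' is _.+1 then abs_mx (net_Wh f k) *m Blayer1 k' (Player1 k')
    else 0
  else 0.

(* p_gamma^k(y) *)
Definition preact_der (k : nat) (a : mindex n) : 'cV[R]_w :=
  \col_i mpder a (fun x => preact k x i 0) y.

Definition block_mi (a : mindex n) (I : {set 'I_(size (mi_seq a))}) :
    mindex n :=
  \sum_(j in I) unit_mi (tnth (in_tuple (mi_seq a)) j).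

(* B_a^k, as a function of the family (P_b^k)_b. *)
Definition Blayer (k : nat) (Pk : mindex n -> 'cV[R]_w) (a : mindex n) :
    'cV[R]_w :=
  \sum_(pi : {set {set 'I_(size (mi_seq a))}}
           | finset.partition pi [set: 'I_(size (mi_seq a))])
    \col_i ((`|dmu #|pi| k i 0| + Qlayer #|pi| k (Player1 k) i 0)
            * \prod_(I in pi)
                (`|preact_der k (block_mi I) i 0| + Pk (block_mi I) i 0)
            - `|dmu #|pi| k i 0
                * \prod_(I in pi) preact_der k (block_mi I) i 0|).

(* P_a^k for |a| >= 1. *)
Fixpoint Player (k : nat) : mindex n -> 'cV[R]_w :=
  if k is k'.+1 then fun a =>
    if mi_seq a is [:: l] then col l (Player1 k) else
    if k' is _.+1 then abs_mx (net_Wh f k) *m Blayer k' (Player k') a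
    else 0
  else fun=> 0.

(* ALG_|a|(a, f, y, eps) for |a| >= 1. *)
Definition ALG (a : mindex n) : R :=
  if mi_seq a is [:: l] then (abs_mx (net_Wo f) *m Blayer1 L (Player1 L)) 0 l
  else (abs_mx (net_Wo f) *m Blayer L (Player L) a) 0 0.

Definition Ebound (a : mindex n) : R :=
  if a == 0 then
    `|net_fun y| + \sum_l eps 0 l
        * (`|mpder (unit_mi l) net_fun y| + ALG (unit_mi l))
  else `|mpder a net_fun y| + ALG a.

End Networks.
Arguments network : clear implicits.

(** * Domains, data and partitions *)

Section Domain.
Context {R : realType}.
Variable d : nat.

Definition Omega : set 'rV[R]_d := [set x | forall j, 0 < x 0 j < 1].

(* Space-time points are row vectors of size d + 1, time being the last
   coordinate [ord_max]; space index j embeds as [sidx j]. *)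
Definition sidx (j : 'I_d) : 'I_d.+1 := lift ord_max j.

Definition stpoint (x : 'rV[R]_d) (t : R) : 'rV[R]_d.+1 :=
  \row_i (if unlift ord_max i is Some j then x 0 j else t).

Definition space (z : 'rV[R]_d.+1) : 'rV[R]_d := \row_j z 0 (sidx j).

Definition time (z : 'rV[R]_d.+1) : R := z 0 ord_max.

Definition st_mi (b : mindex d) : mindex d.+1 :=
  [ffun i => if unlift ord_max i is Some j then b j else 0%N].

Definition tau : mindex d.+1 := unit_mi ord_max.

Definition OmegaT (T : R) : set 'rV[R]_d.+1 :=
  [set z | Omega (space z) /\ 0 < time z <= T].

(* C^m of the closed cube: all partial derivatives of order at most m exist in
   Omega and extend continuously to the closure.  Values of [a] outside Omega
   are not looked at. *)
Fixpoint Cm_closure (m : nat) (a : 'rV[R]_d -> R) : Prop :=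
  (forall x, closure Omega x -> cvg (a @ within Omega (nbhs x))) /\
  (if m is m'.+1 then
     forall i, (forall x, Omega x -> derivable a x (delta_mx 0 i)) /\
               Cm_closure m' (pder i a)
   else True).

(* The derivative of order b, extended by continuity to the closed cube. *)
Definition mpder_closure (b : mindex d) (a : 'rV[R]_d -> R) (x : 'rV[R]_d) : R :=
  lim (mpder b a @ within Omega (nbhs x)).

Definition nonneg_rV n (e : 'rV[R]_n) : Prop := forall j, 0 <= e 0 j.

Definition box n (c e : 'rV[R]_n) : set 'rV[R]_n :=
  [set x | forall j, `|x 0 j - c 0 j| <= e 0 j].

(* Regularity of order m and pointwise derivative bounds for one datum. *)
Definition data_assumption (m : nat) (a : 'rV[R]_d -> R)
    (D : mindex d -> 'rV[R]_d -> 'rV[R]_d -> R) : Prop :=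
  [/\ {within closure Omega, continuous a},
      Cm_closure m a &
      forall b, (mi_deg b <= m)%N ->
      [/\ forall y e, closure Omega y -> nonneg_rV e -> 0 <= D b y e,
          forall y e, closure Omega y -> nonneg_rV e ->
            exists M : R, \forall p \near (y, e),
              closure Omega p.1 -> nonneg_rV p.2 -> D b p.1 p.2 <= M &
          forall y e x, closure Omega y -> nonneg_rV e ->
            closure Omega x -> box y e x -> `|mpder_closure b a x| <= D b y e]].

Record mesh := Mesh {
  radx : 'rV[R]_d;
  radt : R;
  centers : seq 'rV[R]_d;
  times : seq R }.

Definition is_mesh (T : R) (P : mesh) : Prop :=
  [/\ (forall j, 0 < radx P 0 j) /\ 0 < radt P,
      [/\ uniq (centers P),
          {in centers P, forall y, Omega y},
          {in centers P &, forall y y', y != y' ->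
             interior (box y (radx P)) `&` interior (box y' (radx P)) = set0} &
          \bigcup_(y in [set` centers P]) box y (radx P) = closure Omega] &
      [/\ uniq (times P),
          {in times P, forall t, 0 < t < T},
          {in times P &, forall t t', t != t' ->
             interior `[t - radt P, t + radt P]
             `&` interior `[t' - radt P, t' + radt P] = set0} &
          \bigcup_(t in [set` times P]) `[t - radt P, t + radt P]%classic
          = `[0, T]%classic]].

Definition h_Omega (P : mesh) : R := \big[Num.max/0]_j radx P 0 j.

Definition h_P (P : mesh) : R := Num.max (h_Omega P) (radt P).

Definition st_centers (P : mesh) : seq 'rV[R]_d.+1 :=
  [seq stpoint y t | y <- centers P, t <- times P].

Definition st_rad (P : mesh) : 'rV[R]_d.+1 := stpoint (radx P) (radt P).

End Domain.
Arguments Omega {R} d.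
Arguments mesh : clear implicits.

(** * Verified norm bounds *)

Section NormBounds.
Context {R : realType}.
Variables (n : nat) (Z : seq 'rV[R]_n) (e : 'rV[R]_n).

(* The sum over the cells c + prod_q [-e_q, e_q], c in Z; [P], [A] and [D]
   are P_C, A_C and D_C for the cell C with centre c. *)
Definition cell_sum (P A D : 'rV[R]_n -> 'rV[R]_n -> R) : R :=
  \sum_(c <- Z)
    (integral_rV (box c e) (fun x => P c x ^+ 2)
     + 2 * integral_rV (box c e) (fun x => A c x * D c x)
     + integral_rV (box c e) (fun x => D c x ^+ 2)).

Definition U0 (phi : 'rV[R]_n -> R) (b : 'rV[R]_n -> 'I_n -> R) : R :=
  Num.sqrt (cell_sum
    (fun c _ => phi c)
    (fun c _ => `|phi c|)
    (fun c x => \sum_q b c q * `|x 0 q - c 0 q|)).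

Definition U1 (phi : 'rV[R]_n -> R) (h : 'rV[R]_n -> 'I_n -> 'I_n -> R) : R :=
  Num.sqrt (cell_sum
    (fun c x => phi c + \sum_q pder q phi c * (x 0 q - c 0 q))
    (fun c x => `|phi c| + \sum_q `|pder q phi c| * `|x 0 q - c 0 q|)
    (fun c x => 2^-1 * \sum_q \sum_l
                  h c q l * `|x 0 q - c 0 q| * `|x 0 l - c 0 l|)).

Definition Ubound (r : nat) (phi : 'rV[R]_n -> R)
    (b : 'rV[R]_n -> 'I_n -> R) (h : 'rV[R]_n -> 'I_n -> 'I_n -> R) : R :=
  if r is 0 then U0 phi b else U1 phi h.

Definition Ubound_vec (r : nat) p (phi : 'I_p -> 'rV[R]_n -> R)
    (b : 'I_p -> 'rV[R]_n -> 'I_n -> R)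
    (h : 'I_p -> 'rV[R]_n -> 'I_n -> 'I_n -> R) : R :=
  Num.sqrt (\sum_j Ubound r (phi j) (b j) (h j) ^+ 2).

End NormBounds.

(** * Residuals *)

Inductive problem := sH0 | sH1 | sW.
Inductive equation := Heat | Wave.

Definition k_g (s : problem) : nat := if s is sH0 then 0%N else 1%N.

Section Residuals.
Context {R : realType}.
Variables (d w L : nat) (T kappa c : R) (f : network R d.+1 w L).
Variables (g h : 'rV[R]_d -> R).

Definition Bcut (x : 'rV[R]_d) : R := \prod_i (x 0 i * (1 - x 0 i)).

Definition vfun (z : 'rV[R]_d.+1) : R := Bcut (space z) * net_fun f z.

Definition e0 (x : 'rV[R]_d) : R := g x - vfun (stpoint x 0).

Definition ev (x : 'rV[R]_d) : R := h x - pder ord_max vfun (stpoint x 0).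

(* Order of the time derivative and diffusion coefficient of the equation. *)
Definition torder (p : equation) : nat := if p is Heat then 1%N else 2%N.

Definition lam (p : equation) : R := if p is Heat then kappa else c ^+ 2.

Definition pde_residual (p : equation) (z : 'rV[R]_d.+1) : R :=
  iter (torder p) (pder ord_max) vfun z
  - lam p * \sum_(j < d) pder (sidx j) (pder (sidx j) vfun) z.

Definition lambda1 : R := d%:R * pi ^+ 2.

Definition C_Omega : R := Num.sqrt (1 + lambda1^-1 + lambda1 ^- 2).

Definition alphaH : R := 1 + (Num.sqrt kappa)^-1 + Num.sqrt kappa.
Definition betaH : R :=
  (Num.sqrt lambda1)^-1 * (2 + (Num.sqrt kappa)^-1 + kappa^-1).
Definition C1 : R := 1 + Num.sqrt kappa + C_Omega * (Num.sqrt kappa)^-1.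
Definition C2 : R := 2 + (Num.sqrt kappa)^-1 + C_Omega * kappa^-1.
Definition alphaW : R := 1 + c + c ^+ 2 * Num.sqrt T.
Definition etaW : R := 1 + c^-1 + c * Num.sqrt T.
Definition betaW : R :=
  (Num.sqrt lambda1)^-1 + c * T + Num.sqrt T * (1 + c^-1).

Definition residual (s : problem) : R :=
  match s with
  | sH0 => alphaH * normL2s (Omega d) e0
          + betaH * normL2s (OmegaT T) (pde_residual Heat)
  | sH1 => C1 * normL2 (Omega d) (fun j : 'I_d => pder j e0)
          + C2 * normL2s (OmegaT T) (pde_residual Heat)
  | sW => alphaW * normL2 (Omega d) (fun j : 'I_d => pder j e0)
          + etaW * normL2s (Omega d) ev
          + betaW * normL2s (OmegaT T) (pde_residual Wave)
  end.

(** * Computable bounds *)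

Variables (N : nat -> nat) (Dg Dh : mindex d -> 'rV[R]_d -> 'rV[R]_d -> R).
Variable P : mesh R d.

(** ** Initial residuals; [y] is the centre of a cell of the spatial mesh *)

Definition bsup (m : nat) : R :=
  match m with 0 => 4^-1 | 1 => 1 | 2 => 2 | _ => 0 end.

Definition omegaB (b : mindex d) (rho : R) : R :=
  rho * \sum_j \prod_i bsup (b i + (i == j))%N.

Definition Gk (y : 'rV[R]_d) (b : mindex d) : R := Dg b y (radx P).
Definition Hk (y : 'rV[R]_d) (b : mindex d) : R := Dh b y (radx P).

Definition Bk (y : 'rV[R]_d) (b : mindex d) : R :=
  `|mpder b Bcut y| + omegaB b (\big[Num.max/0]_j `|radx P 0 j|).

Definition Fk (y : 'rV[R]_d) (a : mindex d.+1) : R :=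
  Ebound f N (stpoint y 0) (stpoint (radx P) 0) a.

Definition Vk (y : 'rV[R]_d) (a : mindex d) : R :=
  sum_mi_le a (fun b =>
    (mi_bin a b)%:R * Bk y b * Fk y (st_mi (mi_sub a b))).

Definition Vvk (y : 'rV[R]_d) (a : mindex d) : R :=
  sum_mi_le a (fun b =>
    (mi_bin a b)%:R * Bk y b * Fk y (st_mi (mi_sub a b) + tau d)).

Definition b_e0 (y : 'rV[R]_d) (q : 'I_d) : R :=
  Gk y (unit_mi q) + Vk y (unit_mi q).

Definition h_e0 (y : 'rV[R]_d) (q l : 'I_d) : R :=
  Gk y (unit_mi q + unit_mi l) + Vk y (unit_mi q + unit_mi l).

Definition b_de0 (j : 'I_d) (y : 'rV[R]_d) (q : 'I_d) : R := h_e0 y q j.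

Definition h_de0 (j : 'I_d) (y : 'rV[R]_d) (q l : 'I_d) : R :=
  Gk y (unit_mi j + unit_mi q + unit_mi l)
  + Vk y (unit_mi j + unit_mi q + unit_mi l).

Definition b_ev (y : 'rV[R]_d) (q : 'I_d) : R :=
  Hk y (unit_mi q) + Vvk y (unit_mi q).

Definition h_ev (y : 'rV[R]_d) (q l : 'I_d) : R :=
  Hk y (unit_mi q + unit_mi l) + Vvk y (unit_mi q + unit_mi l).

(** ** PDE residuals; [z] is the centre of a cell of the space-time mesh *)

Definition Dz (z : 'rV[R]_d.+1) (a : mindex d.+1) : R :=
  if a == 0 then
    \sum_j st_rad P 0 j * Ebound f N z (st_rad P) (unit_mi j)
  else ALG f N z (st_rad P) a.

Definition s01 (x : R) : R := x * (1 - x).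

Definition lo (z : 'rV[R]_d.+1) (j : 'I_d) : R :=
  Num.max 0 (z 0 (sidx j) - st_rad P 0 (sidx j)).

Definition hi (z : 'rV[R]_d.+1) (j : 'I_d) : R :=
  Num.min 1 (z 0 (sidx j) + st_rad P 0 (sidx j)).

Definition bcell (z : 'rV[R]_d.+1) (j : 'I_d) (m : nat) : R :=
  match m with
  | 0 => s01 (Num.min (hi z j) (Num.max (lo z j) 2^-1))
  | 1 => Num.max `|1 - 2 * lo z j| `|1 - 2 * hi z j|
  | 2 => 2
  | _ => 0
  end.

Definition Bcell (z : 'rV[R]_d.+1) (b : mindex d.+1) : R :=
  if b ord_max == 0%N then \prod_j bcell z j (b (sidx j)) else 0.

Definition Bhat (i : 'I_d) (z : 'rV[R]_d.+1) (b : mindex d.+1) : R :=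
  if (b ord_max == 0%N) && (b (sidx i) == 0%N) then
    \prod_(j | j != i) bcell z j (b (sidx j))
  else 0.

Definition Aop (p : equation) (a : mindex d.+1) (z : 'rV[R]_d.+1) : R :=
  mpder (a + tau d *+ torder p) (net_fun f) z
  - lam p * \sum_(i < d) mpder (a + unit_mi (sidx i) *+ 2) (net_fun f) z.

Definition Abound (p : equation) (z : 'rV[R]_d.+1) (a : mindex d.+1) : R :=
  `|Aop p a z| + Dz z (a + tau d *+ torder p)
  + lam p * \sum_(i < d) Dz z (a + unit_mi (sidx i) *+ 2).

Definition Hop (i : 'I_d) (a : mindex d.+1) (z : 'rV[R]_d.+1) : R :=
  (1 - 2 * z 0 (sidx i)) * mpder (a + unit_mi (sidx i)) (net_fun f) z
  - (2 * a (sidx i) + 1)%:R * mpder a (net_fun f) z.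

Definition Hbound (i : 'I_d) (z : 'rV[R]_d.+1) (a : mindex d.+1) : R :=
  `|Hop i a z|
  + (`|1 - 2 * z 0 (sidx i)| + 2 * st_rad P 0 (sidx i))
    * Dz z (a + unit_mi (sidx i))
  + 2 * st_rad P 0 (sidx i) * `|mpder (a + unit_mi (sidx i)) (net_fun f) z|
  + (2 * a (sidx i) + 1)%:R * Dz z a.

Definition h_pde (p : equation) (z : 'rV[R]_d.+1) (q l : 'I_d.+1) : R :=
  let eq := unit_mi q in let el := unit_mi l in
  Bcell z (eq + el) * Abound p z 0 + Bcell z eq * Abound p z el
  + Bcell z el * Abound p z eq + Bcell z 0 * Abound p z (eq + el)
  + 2 * lam p * \sum_(i < d)
      (Bhat i z (eq + el) * Hbound i z 0 + Bhat i z eq * Hbound i z el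
       + Bhat i z el * Hbound i z eq + Bhat i z 0 * Hbound i z (eq + el)).

Definition U_pde (p : equation) : R :=
  U1 (st_centers P) (st_rad P) (pde_residual p) (h_pde p).

Definition U_e0 (r : nat) : R :=
  Ubound (centers P) (radx P) r e0 b_e0 h_e0.

Definition U_grad_e0 (r : nat) : R :=
  Ubound_vec (centers P) (radx P) r (fun j : 'I_d => pder j e0) b_de0 h_de0.

Definition U_ev (r : nat) : R :=
  Ubound (centers P) (radx P) r ev b_ev h_ev.

Definition residual_bound (s : problem) (r : nat) : R :=
  match s with
  | sH0 => alphaH * U_e0 r + betaH * U_pde Heat
  | sH1 => C1 * U_grad_e0 r + C2 * U_pde Heat
  | sW => alphaW * U_grad_e0 r + etaW * U_ev r + betaW * U_pde Wave
  end.

End Residuals.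

(* Main.v *)
Require Import Defs.
From mathcomp Require Import all_boot all_order all_algebra.
From mathcomp Require Import all_classical all_reals all_analysis.
From mathcomp Require Import measurable_realfun ring lra zify.
Import Order.TTheory GRing.Theory Num.Theory.
Import numFieldNormedType.Exports.
Local Open Scope classical_set_scope.
Local Open Scope ring_scope.
Set Implicit Arguments.
Unset Strict Implicit.
Unset Printing Implicit Defensive.

(** Every term of the computable bound has the form U(phi), where phi is a
residual, or a component of its gradient, and U(phi) is assembled from cellwise
Taylor polynomials P, majorants A of |P| and majorants D of the Taylor
remainders.  The theorem thus splits into two independent questions.

Given that D really dominates the remainder, why is U(phi) at least the norm of
phi and at most O(h^(r+1)) above it?  Pointwise on a cell,
  phi^2 <= P^2 + 2 A D + D^2 <= phi^2 + O(D),
and D = O(h^(r+1)).  The cells cover the domain and their interiors are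
disjoint, so these inequalities can be integrated ([cell_sum_bounds]).  An error
of order D in the square of the norm is an error of order D in the norm as long
as the norm is positive, because the square root is Lipschitz away from 0.  If
the norm is 0 then phi vanishes identically, so do P and A, and what is left of
U(phi) is the square root of the integral of D^2, again of order D
([norm_sandwich], [U0_sandwich], [U1_sandwich]).  The constant may depend on
phi but not on the cells.

Why do the computed coefficients dominate the derivatives of the residuals on a
cell, and why are they bounded independently of the mesh?
 - For the network, Faa di Bruno's formula writes a derivative of a layer as a
   polynomial in derivatives of tanh and of the layer below.  Perturbing each
   factor and using Taylor's inequality for the derivatives of tanh gives the
   recursion defining ALG ([ALG_sound], [Ebound_sound]).  Its constants come
   from |tanh^(m)(x)| <= m! 2^(m+1) exp(-2|x|) for m >= 1, obtained by writing the
   derivatives as polynomials in the logistic functions ([tanh_deriv_bound]).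
   As all derivatives of tanh are bounded on the line, the recursion is bounded
   for all centres and all bounded radii ([bnd_ALG]).
 - For the data, the hypothesis provides the majorants, and local boundedness
   on a compact set makes them uniform ([data_bounded]).
 - For the initial residuals, the Leibniz rule combines the network bounds with
   the variation of B over a cell ([cut_slice_sound]).
 - For the PDE residual, B = x_i (1 - x_i) B_i gives
     R = B A - 2 lambda sum_i B_i H_i,
   with A and H_i differential expressions in f whose own derivatives stay in
   the same families; the product rule then yields the stated coefficients
   ([pde_residualE], [pde_hessian_sound]).

The sandwich for each term, multiplied by nonnegative constants and summed,
gives the estimate; the gradient of e_0 needs Minkowski's inequality in
addition ([sqrt_sum_sandwich]).  Convergence follows by squeezing. *)

(** * One-variable estimates and their extension to boxes *)

Section OneDim.
Context {R : realType}.
Implicit Types (G H dG dH : R -> R) (t : R).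

Lemma is_derive_cc_continuous G dG (a b : R) :
  (forall t, a <= t <= b -> is_derive t 1 G (dG t)) ->
  {within `[a, b], continuous G}.
Proof.
move=> h; apply: derivable_within_continuous => t.
by rewrite in_itv => /h [].
Qed.

Lemma mvt_le G dG (a b : R) : a <= b ->
  (forall t, a <= t <= b -> is_derive t 1 G (dG t)) ->
  (forall t, a <= t <= b -> 0 <= dG t) -> G a <= G b.
Proof.
move=> ab hG h0.
have [//|c cab /eqP] := @MVT_segment R G dG a b ab _ (is_derive_cc_continuous hG).
  by move=> x; rewrite in_itv => /andP[xa xb]; apply: hG; rewrite !ltW.
rewrite subr_eq => /eqP ->.
by move: cab; rewrite in_itv /= => /h0 c0; rewrite lerDr mulr_ge0// subr_ge0.
Qed.

(** Both [H - G] and [H + G] are nondecreasing.  Integrating a bound on a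
derivative is done through this principle, without integrals. *)
Lemma derive_dominated G H dG dH (a b : R) : a <= b ->
  (forall t, a <= t <= b -> is_derive t 1 G (dG t)) ->
  (forall t, a <= t <= b -> is_derive t 1 H (dH t)) ->
  (forall t, a <= t <= b -> `|dG t| <= dH t) ->
  `|G b - G a| <= H b - H a.
Proof.
move=> ab hG hH le; rewrite ler_norml; apply/andP; split.
  suff : (G + H) a <= (G + H) b by rewrite !fctE; lra.
  apply: (@mvt_le _ (dG + dH)) => //.
    by move=> t tab; have ? := hG t tab; have ? := hH t tab; exact: is_deriveD.
  by move=> t /le; rewrite ler_norml !fctE => /andP[+ _]; lra.
suff : (H - G) a <= (H - G) b by rewrite !fctE; lra.
apply: (@mvt_le _ (dH - dG)) => //.
  by move=> t tab; have ? := hG t tab; have ? := hH t tab; exact: is_deriveB.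
by move=> t /le; rewrite ler_norml !fctE => /andP[_ +]; lra.
Qed.

Lemma is_derive_monomial (j : nat) (c t : R) :
  is_derive t 1 (fun s => s ^+ j.+1 / j.+1`!%:R * c) (t ^+ j / j`!%:R * c).
Proof.
have h : is_derive t 1 (fun s : R => s ^+ j.+1) (j.+1%:R * t ^+ j).
  have -> : (fun s : R => s ^+ j.+1) = id ^+ j.+1 :> (R -> R).
    by apply/funext => s; rewrite exprfctE.
  apply: is_derive_eq; by rewrite /GRing.scale/= mulr1.
have -> : (fun s : R => s ^+ j.+1 / j.+1`!%:R * c) =
          (c / j.+1`!%:R) \*: (fun s : R => s ^+ j.+1).
  by apply/funext => s /=; rewrite /GRing.scale/=; ring.
apply: is_derive_eq.
rewrite /GRing.scale /= factS natrM; field.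
by rewrite nat1r !pnatr_eq0 -lt0n fact_gt0.
Qed.

(** Induction on [N]: the inequality for [F 1], whose right-hand side is the
derivative of the claimed bound, is integrated with [derive_dominated].  Absolute
values are taken term by term, as in the definition of [Qval]. *)
Lemma taylor_ineq (F : nat -> R -> R) (N : nat) (S d : R) : 0 <= d ->
  (forall j t, 0 <= t <= d -> is_derive t 1 (F j) (F j.+1 t)) ->
  (forall t, 0 <= t <= d -> `|F N.+1 t| <= S) ->
  `|F 0%N d - F 0%N 0| <=
    \sum_(1 <= j < N.+1) d ^+ j / j`!%:R * `|F j 0| + d ^+ N.+1 / N.+1`!%:R * S.
Proof.
move=> d0 hF hS.
elim: N F d d0 hF hS => [|N IH] F d d0 hF hS.
  rewrite big_geq// add0r expr1 divr1.
  have := @derive_dominated (F 0%N) (fun t => t ^+ 1 / 1`!%:R * S) (F 1%N)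
    (fun t => t ^+ 0 / 0`!%:R * S) 0 d d0.
  rewrite !expr1 !divr1 mul0r subr0; apply => [t _|t /hS].
  - exact: is_derive_monomial.
  - by rewrite divr1 expr0 mul1r.
pose H t := \sum_(0 <= j < N.+1) t ^+ j.+1 / j.+1`!%:R * `|F j.+1 0|
   + t ^+ N.+2 / N.+2`!%:R * S.
pose dH t := \sum_(0 <= j < N.+1) t ^+ j / j`!%:R * `|F j.+1 0|
   + t ^+ N.+1 / N.+1`!%:R * S.
have hH t : is_derive t 1 H (dH t).
  rewrite /H /dH.
  have -> : (fun t : R => \sum_(0 <= j < N.+1) t ^+ j.+1 / j.+1`!%:R * `|F j.+1 0|
   + t ^+ N.+2 / N.+2`!%:R * S) = (\sum_(j < N.+1) (fun t => t ^+ j.+1 / j.+1`!%:R * `|F j.+1 0|))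
   + (fun t => t ^+ N.+2 / N.+2`!%:R * S).
    by apply/funext => s; rewrite !fctE fct_sumE big_mkord.
  rewrite big_mkord.
  apply: is_deriveD; last exact: is_derive_monomial.
  by apply: is_derive_sum => i; exact: is_derive_monomial.
have := @derive_dominated (F 0%N) H (F 1%N) dH 0 d d0.
have -> : H 0 = 0.
  rewrite /H expr0n /= !mul0r addr0 big1// => j _.
  by rewrite expr0n /= !mul0r.
rewrite subr0 [H d]/H big_add1 /=; apply => // t /andP[t0 td].
have : `|F 1%N t - F 1%N 0| <= \sum_(1 <= j < N.+1) t ^+ j / j`!%:R * `|F j.+1 0|
    + t ^+ N.+1 / N.+1`!%:R * S.
  apply: (IH (fun j => F j.+1) t t0).
- by move=> j s /andP[s0 st]; apply: hF; rewrite s0 (le_trans st).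
- by move=> s /andP[s0 st]; apply: hS; rewrite s0 (le_trans st).
rewrite big_add1 /= => h.
rewrite /dH big_nat_recl//= expr0 divr1 mul1r -addrA.
by rewrite -lerBlDl (le_trans _ h)// lerB_dist.
Qed.

(** The bound on [G2] is integrated twice, first for [G1] and then for the
remainder [G - G1 0 * t]. *)
Lemma taylor2_ineq G G1 G2 (M d : R) : 0 <= d ->
  (forall t, 0 <= t <= d -> is_derive t 1 G (G1 t)) ->
  (forall t, 0 <= t <= d -> is_derive t 1 G1 (G2 t)) ->
  (forall t, 0 <= t <= d -> `|G2 t| <= M) ->
  `|G d - G 0 - G1 0 * d| <= 2^-1 * M * d ^+ 2.
Proof.
move=> d0 hG hG1 hM.
pose K t := G t - G1 0 * t; pose dK t := G1 t - G1 0.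
suff : `|K d - K 0| <= d ^+ 2 / 2`!%:R * M - 0 ^+ 2 / 2`!%:R * M.
  have -> : 2`! = 2%N by [].
  rewrite /K mulr0 subr0 expr0n /= !mul0r subr0.
  rewrite [X in `|X|](_ : _ = G d - G 0 - G1 0 * d); last by ring.
  by move=> /le_trans; apply; lra.
apply: (@derive_dominated K (fun t => t ^+ 2 / 2`!%:R * M) dK
    (fun t => t ^+ 1 / 1`!%:R * M) 0 d d0).
- move=> t /hG ht.
  have -> : K = G - (G1 0 \*: id) by apply/funext.
  by apply: is_derive_eq; rewrite /GRing.scale/= mulr1.
- by move=> t _; exact: is_derive_monomial.
- move=> t /andP[t0 td].
  have := @derive_dominated G1 (fun t => t ^+ 1 / 1`!%:R * M) G2
    (fun t => t ^+ 0 / 0`!%:R * M) 0 t t0.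
  rewrite !expr1 !divr1 mul0r subr0; apply => // [s /andP[s0 st]|s _|s /andP[s0 st]].
  + by apply: hG1; rewrite s0 (le_trans st).
  + exact: is_derive_monomial.
  + by rewrite expr0 divr1 mul1r; apply: hM; rewrite s0 (le_trans st).
Qed.

End OneDim.

Section Interval.
Context {R : realType}.
Variables (J : set R) (iJ : is_interval J).
Implicit Types (s t : R).

Lemma is_derive_affine (g : R -> R) (g1 s e u : R) :
  is_derive (s + e * u) 1 g g1 ->
  is_derive u 1 (fun v => g (s + e * v)) (e * g1).
Proof.
move=> hg; have -> : (fun v => g (s + e * v)) = g \o (cst s + e \*: id).
  by apply/funext.
have h : is_derive u 1 (cst s + e \*: id) (0 + e *: 1) by apply: is_deriveD.
have := @is_derive1_comp R g (cst s + e \*: id) u g1 (0 + e *: 1) hg h.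
by rewrite add0r /GRing.scale/= mulr1 mulrC.
Qed.

Lemma segmentP (s t u : R) : J s -> J t -> 0 <= u <= `|t - s| ->
  J (s + Num.sg (t - s) * u).
Proof.
move=> Js Jt /andP[u0 ut].
have [ts|ts|ts] := ltrgt0P (t - s).
- apply: (iJ Js Jt); move: ut; rewrite (gtr0_norm ts) (gtr0_sg ts); lra.
- apply: (iJ Jt Js); move: ut; rewrite (ltr0_norm ts) (ltr0_sg ts); lra.
- by rewrite ts sgr0 mul0r addr0.
Qed.

(** The substitution u -> s + sg (t - s) u reduces a segment of either
orientation to [0, |t - s|]. *)
Lemma interval_lipschitz (g g1 : R -> R) (b s t : R) :
  (forall u, J u -> is_derive u 1 g (g1 u)) ->
  (forall u, J u -> `|g1 u| <= b) -> J s -> J t ->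
  `|g t - g s| <= b * `|t - s|.
Proof.
move=> hg hb Js Jt; set e := Num.sg (t - s).
have := @derive_dominated R (fun u => g (s + e * u)) (fun u => b * u)
  (fun u => e * g1 (s + e * u)) (fun u => b) 0 `|t - s| (normr_ge0 _).
rewrite !mulr0 addr0 subr0 /e -numEsg [s + _]addrC subrK; apply.
- by move=> u /(segmentP Js Jt)/hg; exact: is_derive_affine.
- move=> u _; have -> : (fun u => b * u) = b \*: id :> (R -> R) by apply/funext.
  by apply: is_derive_eq; rewrite /GRing.scale/= mulr1.
- move=> u /(segmentP Js Jt)/hb h; rewrite normrM (le_trans _ h)//.
  by rewrite ler_piMl// normr_sg lern1; case: eqP.
Qed.

Lemma interval_taylor2 (g g1 g2 : R -> R) (b s t : R) :
  (forall u, J u -> is_derive u 1 g (g1 u)) ->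
  (forall u, J u -> is_derive u 1 g1 (g2 u)) ->
  (forall u, J u -> `|g2 u| <= b) -> J s -> J t ->
  `|g t - g s - g1 s * (t - s)| <= 2^-1 * b * `|t - s| ^+ 2.
Proof.
move=> hg hg1 hb Js Jt; set e := Num.sg (t - s).
have := @taylor2_ineq R (fun u => g (s + e * u)) (fun u => e * g1 (s + e * u))
  (fun u => e * (e * g2 (s + e * u))) b `|t - s| (normr_ge0 _).
rewrite !mulr0 addr0 [e * g1 s * _]mulrAC /e -!numEsg [s + _]addrC subrK.
rewrite [_ * g1 s]mulrC; apply.
- by move=> u /(segmentP Js Jt)/hg; exact: is_derive_affine.
- move=> u /(segmentP Js Jt)/hg1 /is_derive_affine h.
  have -> : (fun v => e * g1 (s + e * v)) = e \*: (fun v => g1 (s + e * v)).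
    by apply/funext.
  exact: is_deriveZ.
- move=> u /(segmentP Js Jt)/hb h; rewrite !normrM (le_trans _ h)//.
  rewrite mulrA ler_piMl// -expr2 exprn_ile1//.
  by rewrite normr_sg lern1; case: eqP.
Qed.

End Interval.

Section Coordinate.
Context {R : realType} {n : nat}.
Implicit Types (phi : 'rV[R]_n -> R) (x c a : 'rV[R]_n) (q l : 'I_n).

Definition rect (J : 'I_n -> set R) : set 'rV[R]_n :=
  [set x | forall j, J j (x 0 j)].

Definition upd x q (t : R) : 'rV[R]_n := \row_j (if j == q then t else x 0 j).

Lemma updD x q t s : upd x q (s + t) = s *: delta_mx 0 q + upd x q t.
Proof.
apply/rowP => j; rewrite !mxE eqxx /=.
by case: eqP => _; rewrite ?mulr1 ?mulr0 ?add0r.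
Qed.

Lemma upd_id x q : upd x q (x 0 q) = x.
Proof. by apply/rowP => j; rewrite !mxE; case: eqP => [->|]. Qed.

Lemma line_quotient phi x q t :
  (fun h : R => h^-1 *: (phi (h *: delta_mx 0 q + upd x q t) - phi (upd x q t))) =
  (fun h : R => h^-1 *: (phi (upd x q (h *: 1 + t)) - phi (upd x q t))).
Proof. by apply/funext => h; rewrite updD /GRing.scale/= mulr1. Qed.

Lemma is_derive_upd phi x q t : derivable phi (upd x q t) (delta_mx 0 q) ->
  is_derive t 1 (fun s => phi (upd x q s)) (pder q phi (upd x q t)).
Proof.
have E := line_quotient phi x q t.
move=> h; apply: DeriveDef; first by move: h; rewrite /derivable E.
by rewrite /pder /derive E.
Qed.

Lemma derivable_upd phi x q t :
  derivable (fun s => phi (upd x q s)) t 1 -> derivable phi (upd x q t) (delta_mx 0 q).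
Proof. by rewrite /derivable line_quotient. Qed.

Variables (J : 'I_n -> set R) (iJ : forall j, is_interval (J j)).

Lemma rect_upd x q t : rect J x -> J q t -> rect J (upd x q t).
Proof. by move=> Jx Jt j; rewrite mxE; case: eqP => [->|]. Qed.

(** Walking from [c] to [x] one coordinate at a time reduces estimates on a
product of intervals to one-variable ones. *)
Definition hybrid c x (k : nat) : 'rV[R]_n :=
  \row_j (if (j < k)%N then x 0 j else c 0 j).

Lemma hybrid0 c x : hybrid c x 0 = c.
Proof. by apply/rowP => j; rewrite mxE. Qed.

Lemma hybrid_all c x : hybrid c x n = x.
Proof. by apply/rowP => j; rewrite mxE ltn_ord. Qed.

Lemma hybridS c x q : hybrid c x q.+1 = upd (hybrid c x q) q (x 0 q).
Proof.
apply/rowP => j; rewrite !mxE ltnS leq_eqVlt val_eqE.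
by case: (j =P q) => [->|].
Qed.

Lemma hybrid_diag c x q : hybrid c x q 0 q = c 0 q.
Proof. by rewrite mxE ltnn. Qed.

Lemma rect_hybrid c x k : rect J c -> rect J x -> rect J (hybrid c x k).
Proof. by move=> Jc Jx j; rewrite mxE; case: ifP. Qed.

Lemma hybrid_ind (P : nat -> Prop) :
  P 0%N -> (forall q : 'I_n, P q -> P q.+1) -> P n.
Proof.
move=> P0 PS; suff: forall k, (k <= n)%N -> P k by apply.
elim=> [//|k IH kn]; exact: (PS (Ordinal kn) (IH (ltnW kn))).
Qed.

Lemma sum_lt_recr (F : 'I_n -> R) q :
  \sum_(j < n | (j < q.+1)%N) F j = \sum_(j < n | (j < q)%N) F j + F q.
Proof.
rewrite (bigD1 q) ?ltnSn//= addrC; congr (_ + _); apply: eq_bigl => j.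
by rewrite ltnS [in RHS]ltn_neqAle val_eqE andbC.
Qed.

(** The increments of [phi] along the hybrid points add up. *)
Lemma rect_lipschitz phi (b : 'I_n -> R) c x :
  (forall z q, rect J z -> derivable phi z (delta_mx 0 q)) ->
  (forall z q, rect J z -> `|pder q phi z| <= b q) ->
  rect J c -> rect J x ->
  `|phi x - phi c| <= \sum_q b q * `|x 0 q - c 0 q|.
Proof.
move=> dphi hb Jc Jx.
pose P k := `|phi (hybrid c x k) - phi c| <=
   \sum_(q < n | (q < k)%N) b q * `|x 0 q - c 0 q|.
suff : P n.
  rewrite /P hybrid_all => /le_trans; apply; rewrite le_eqVlt; apply/orP; left.
  by apply/eqP; apply: eq_bigl => q; rewrite ltn_ord.
apply: (@hybrid_ind P); rewrite /P.
  by rewrite hybrid0 subrr normr0 big1// => q; rewrite ltn0.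
move=> q IH; rewrite sum_lt_recr [leRHS]addrC.
rewrite -(subrK (phi (hybrid c x q)) (phi (hybrid c x q.+1))) -addrA.
rewrite (le_trans (ler_normD _ _))// lerD//.
rewrite hybridS -{2}(upd_id (hybrid c x q) q) hybrid_diag.
have Jh := rect_hybrid q Jc Jx.
apply: (@interval_lipschitz _ (J q) (@iJ q) (fun t => phi (upd (hybrid c x q) q t))
   (fun t => pder q phi (upd (hybrid c x q) q t)) (b q) (c 0 q) (x 0 q)) => // u Ju.
- by apply: is_derive_upd; apply: dphi; exact: rect_upd.
- by apply: hb; exact: rect_upd.
Qed.

(** Moving coordinate [q] from c_q to x_q at a hybrid point costs a
one-variable Taylor remainder, which is the diagonal term h_qq, and the variation
of the q-th partial derivative between [c] and the hybrid point, which gives the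
terms h_ql with l < q.  By symmetry of [h] the latter are half of the
off-diagonal part. *)
Lemma rect_taylor2 phi (h : 'I_n -> 'I_n -> R) c x :
  (forall q l, h q l = h l q) ->
  (forall z q, rect J z -> derivable phi z (delta_mx 0 q)) ->
  (forall z q l, rect J z -> derivable (pder q phi) z (delta_mx 0 l)) ->
  (forall z q l, rect J z -> `|pder l (pder q phi) z| <= h q l) ->
  rect J c -> rect J x ->
  `|phi x - (phi c + \sum_q pder q phi c * (x 0 q - c 0 q))| <=
    2^-1 * \sum_q \sum_l h q l * `|x 0 q - c 0 q| * `|x 0 l - c 0 l|.
Proof.
move=> hC dphi d2phi hh Jc Jx.
pose P k := `|phi (hybrid c x k) - (phi c +
    \sum_(q < n | (q < k)%N) pder q phi c * (x 0 q - c 0 q))| <=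
  2^-1 * \sum_(q < n | (q < k)%N) \sum_(l < n | (l < k)%N)
     h q l * `|x 0 q - c 0 q| * `|x 0 l - c 0 l|.
suff : P n.
  rewrite /P hybrid_all => /le_trans; move=> H.
  have E (F : 'I_n -> R) : \sum_(q < n | (q < n)%N) F q = \sum_q F q.
    by apply: eq_bigl => q; rewrite ltn_ord.
  move: H; rewrite !E; under [X in _ * X]eq_bigr do rewrite E.
  by apply.
apply: (@hybrid_ind P); rewrite /P.
  by rewrite hybrid0 big1 ?addr0 ?subrr ?normr0 ?big1 ?mulr0// => q; rewrite ltn0.
move=> q IH; set r := fun q => `|x 0 q - c 0 q|.
rewrite sum_lt_recr (sum_lt_recr (fun q' => \sum_(l < n | (l < q.+1)%N) _)).
under [X in 2^-1 * (X + _)]eq_bigr do rewrite sum_lt_recr.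
rewrite big_split /= sum_lt_recr.
have Jh := rect_hybrid q Jc Jx.
set S := \sum_(i < n | _) \sum_(l < n | _) _ in IH *.
have -> : \sum_(i < n | (i < q)%N) h i q * `|x 0 i - c 0 i| * `|x 0 q - c 0 q| =
   \sum_(i < n | (i < q)%N) h q i * `|x 0 i - c 0 i| * `|x 0 q - c 0 q|.
  by apply: eq_bigr => i _; rewrite hC.
have -> : \sum_(i < n | (i < q)%N) h q i * `|x 0 q - c 0 q| * `|x 0 i - c 0 i| =
   \sum_(i < n | (i < q)%N) h q i * `|x 0 i - c 0 i| * `|x 0 q - c 0 q|.
  by apply: eq_bigr => i _; ring.
set V := \sum_(i < n | (i < q)%N) h q i * _ * _.
set W := h q q * _ * _.
have -> : 2^-1 * (S + V + (V + W)) = 2^-1 * S + (V + 2^-1 * W) by field.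
set s := \sum_(i < n | _) _ in IH *.
have -> : phi (hybrid c x q.+1) - (phi c + (s + pder q phi c * (x 0 q - c 0 q))) =
  (phi (hybrid c x q) - (phi c + s)) +
  ((pder q phi (hybrid c x q) - pder q phi c) * (x 0 q - c 0 q) +
  (phi (hybrid c x q.+1) - phi (hybrid c x q)
     - pder q phi (hybrid c x q) * (x 0 q - c 0 q))) by ring.
rewrite (le_trans (ler_normD _ _))// lerD//.
rewrite (le_trans (ler_normD _ _))// lerD//.
  rewrite normrM /V -mulr_suml ler_wpM2r//.
  have := @rect_lipschitz (pder q phi) (h q) c (hybrid c x q).
  move=> /(_ _ _ _ _)/le_trans -> //.
  - by move=> z l; exact: d2phi.
  - by move=> z l; exact: hh.
  rewrite [leRHS]big_mkcond /= ler_sum// => i _; rewrite mxE.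
  by case: ifP => // _; rewrite subrr normr0 mulr0.
have -> : 2^-1 * W = 2^-1 * h q q * `|x 0 q - c 0 q| ^+ 2 by rewrite /W; ring.
rewrite hybridS -{2 3}(upd_id (hybrid c x q) q) hybrid_diag.
have T := (@interval_taylor2 _ (J q) (@iJ q) (fun t => phi (upd (hybrid c x q) q t))
   (fun t => pder q phi (upd (hybrid c x q) q t))
   (fun t => pder q (pder q phi) (upd (hybrid c x q) q t))
   (h q q) (c 0 q) (x 0 q)).
cbv beta in T.
have {}T := T (fun u Ju => is_derive_upd (dphi _ _ (rect_upd Jh Ju))).
have {}T := T (fun u Ju => is_derive_upd (d2phi _ _ _ (rect_upd Jh Ju))).
have {}T := T (fun u Ju => hh _ _ _ (rect_upd Jh Ju)) (Jc q) (Jx q).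
exact: T.
Qed.

End Coordinate.

(** * Symmetry of mixed derivatives and functions of class C^m *)

Section Neighbourhoods.
Context {R : realType} {n : nat}.
Implicit Types (x z : 'rV[R]_n).

Lemma nbhs_rVP x (A : set 'rV[R]_n) :
  nbhs x A <-> exists2 e : R, 0 < e & forall z, (forall j, `|z 0 j - x 0 j| < e) -> A z.
Proof.
split=> [/nbhs_ballP[e /= e0 eA]|[e e0 eA]].
  exists e => // z h; apply: eA; split=> // i j.
  by rewrite ord1 /ball /= distrC; exact: h.
apply/nbhs_ballP; exists e => //= z h; apply: eA => j.
by have [_ /(_ 0 j)] := h; rewrite /ball /= distrC.
Qed.

End Neighbourhoods.

Section Schwarz.
Context {R : realType} {n : nat}.
Implicit Types (phi : 'rV[R]_n -> R) (x z : 'rV[R]_n) (i j : 'I_n).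

Let interval_cc (a b : R) : is_interval [set t | a <= t <= b].
Proof. by move=> s t /andP[as_ _] /andP[_ tb] u /andP[su ut]; rewrite /= (le_trans as_ su) (le_trans ut tb). Qed.

Lemma upd_upd x i j s t : i != j -> upd (upd x i s) j t = upd (upd x j t) i s.
Proof.
move=> ij; apply/rowP => k; rewrite !mxE.
case: (k =P j) => [->|_]; case: (_ =P i) => // ji.
by rewrite -ji eqxx in ij.
Qed.

(** The second difference of [phi] over a square of side [h] is h^2 times a
mixed derivative, up to the oscillation of the latter: two nested applications of
[interval_lipschitz], first along the i-th axis and then along the j-th. *)
Lemma mixed_difference phi x i j (h M e : R) : i != j -> 0 <= h ->
  (forall z, (forall k, `|z 0 k - x 0 k| <= h) ->
    [/\ derivable phi z (delta_mx 0 i), derivable (pder i phi) z (delta_mx 0 j)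
      & `|pder j (pder i phi) z - M| <= e]) ->
  `|phi (upd (upd x i (x 0 i + h)) j (x 0 j + h))
    - phi (upd (upd x i (x 0 i + h)) j (x 0 j + 0))
    - (phi (upd (upd x i (x 0 i + 0)) j (x 0 j + h))
       - phi (upd (upd x i (x 0 i + 0)) j (x 0 j + 0))) - M * h ^+ 2|
  <= e * h ^+ 2.
Proof.
move=> ij h0 H; pose F s t := phi (upd (upd x i (x 0 i + s)) j (x 0 j + t)).
rewrite -/(F h h) -/(F h 0) -/(F 0 h) -/(F 0 0).
have near s t : 0 <= s <= h -> 0 <= t <= h ->
    forall k, `|upd (upd x i (x 0 i + s)) j (x 0 j + t) 0 k - x 0 k| <= h.
  move=> /andP[s0 sh] /andP[t0 th] k; rewrite !mxE.
  case: eqP => [->|_]; first by rewrite addrC addKr ger0_norm.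
  case: eqP => [->|_]; first by rewrite addrC addKr ger0_norm.
  by rewrite subrr normr0.
pose p s t := pder i phi (upd (upd x i (x 0 i + s)) j (x 0 j + t)).
have dF s t : 0 <= s <= h -> 0 <= t <= h -> is_derive s 1 (F ^~ t) (p s t).
  move=> hs ht; rewrite /F /p upd_upd//.
  have -> : (fun s => phi (upd (upd x i (x 0 i + s)) j (x 0 j + t))) =
     (fun s => phi (upd (upd x j (x 0 j + t)) i (x 0 i + 1 * s))).
    by apply/funext => s'; rewrite upd_upd// mul1r.
  rewrite -[pder _ _ _]mul1r.
  apply: (@is_derive_affine _ (fun s => phi (upd (upd x j (x 0 j + t)) i s))).
  rewrite mul1r; apply: is_derive_upd.
  by rewrite -upd_upd//; have [] := H _ (near _ _ hs ht).
have dp s t : 0 <= s <= h -> 0 <= t <= h ->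
    is_derive t 1 (p s) (pder j (pder i phi) (upd (upd x i (x 0 i + s)) j (x 0 j + t))).
  move=> hs ht; rewrite /p -[X in is_derive _ _ _ X]mul1r.
  have -> : (fun t => pder i phi (upd (upd x i (x 0 i + s)) j (x 0 j + t))) =
     (fun t => pder i phi (upd (upd x i (x 0 i + s)) j (x 0 j + 1 * t))).
    by apply/funext => t'; rewrite mul1r.
  apply: (@is_derive_affine _ (fun t => pder i phi (upd (upd x i (x 0 i + s)) j t))).
  rewrite mul1r; apply: is_derive_upd.
  by have [] := H _ (near _ _ hs ht).
have hh : [set u | 0 <= u <= h] h by rewrite /= h0 lexx.
have h00 : [set u | 0 <= u <= h] 0 by rewrite /= h0 lexx.
have sub_lin (g : R -> R) dg (c u : R) : is_derive u 1 g dg ->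
    is_derive u 1 (fun v => g v - c * v) (dg - c).
  move=> dg1; have -> : (fun v => g v - c * v) = g - (c \*: id) by apply/funext.
  by apply: is_derive_eq; rewrite /GRing.scale/= mulr1.
have := @interval_lipschitz R _ (@interval_cc 0 h)
   (fun s => (F s h - F s 0) - (M * h) * s)
   (fun s => (p s h - p s 0) - M * h) (e * h) 0 h.
rewrite !mulr0 !subr0 (ger0_norm h0) -!mulrA -expr2.
rewrite [X in `|X|](_ : _ = F h h - F h 0 - (F 0 h - F 0 0) - M * h ^+ 2); last by ring.
apply => // s hs.
  apply: sub_lin.
  have -> : (fun v => F v h - F v 0) = (F^~ h) - (F ^~ 0) by apply/funext.
  by have ? := dF s h hs hh; have ? := dF s 0 hs h00; apply: is_deriveB.
have := @interval_lipschitz R _ (@interval_cc 0 h)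
   (fun t => p s t - M * t)
   (fun t => pder j (pder i phi) (upd (upd x i (x 0 i + s)) j (x 0 j + t)) - M) e 0 h.
rewrite !mulr0 !subr0 (ger0_norm h0).
rewrite [X in `|X|](_ : _ = p s h - p s 0 - M * h); last by ring.
apply => // t ht; last by have [] := H _ (near _ _ hs ht).
by apply: sub_lin; exact: dp.
Qed.

(** The second difference is symmetric in [i] and [j], so after division by h^2
it approximates both mixed derivatives. *)
Lemma schwarz phi x i j : 
  (\forall z \near x, [/\ derivable phi z (delta_mx 0 i), derivable phi z (delta_mx 0 j),
     derivable (pder i phi) z (delta_mx 0 j) & derivable (pder j phi) z (delta_mx 0 i)]) ->
  {for x, continuous (pder j (pder i phi))} ->
  {for x, continuous (pder i (pder j phi))} ->
  pder j (pder i phi) x = pder i (pder j phi) x.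
Proof.
have [->//|ij] := eqVneq i j.
move=> hd c1 c2; apply/eqP; rewrite -subr_eq0 -normr_le0.
apply/ler_addgt0Pl => e e0; rewrite addr0.
set M1 := pder j (pder i phi) x; set M2 := pder i (pder j phi) x.
have e2 : 0 < e / 2 by rewrite divr_gt0.
have n1 : \forall z \near x, `|pder j (pder i phi) z - M1| <= e / 2.
  near=> z; rewrite distrC; near: z.
  by move/cvgrPdist_le : c1 => /(_ _ e2).
have n2 : \forall z \near x, `|pder i (pder j phi) z - M2| <= e / 2.
  near=> z; rewrite distrC; near: z.
  by move/cvgrPdist_le : c2 => /(_ _ e2).
have [d d0 Hd] := (nbhs_rVP _ _).1 (filterI (filterI n1 n2) hd).
(* half the radius, so that the closed square of side h lies in the open box *)
pose h := d / 2; have h0 : 0 < h by rewrite divr_gt0.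
have hlt z : (forall k, `|z 0 k - x 0 k| <= h) -> forall k, `|z 0 k - x 0 k| < d.
  by move=> zx k; rewrite (le_lt_trans (zx k))// /h; lra.
have /= H1 := @mixed_difference phi x i j h M1 (e / 2) ij (ltW h0).
have ji : j != i by rewrite eq_sym.
have /= H2 := @mixed_difference phi x j i h M2 (e / 2) ji (ltW h0).
have {}H1 := H1 (fun z zx => let: conj (conj a b) c := Hd z (hlt z zx) in
   let: And4 c1 c2 c3 c4 := c in And3 c1 c3 a).
have {}H2 := H2 (fun z zx => let: conj (conj a b) c := Hd z (hlt z zx) in
   let: And4 c1 c2 c3 c4 := c in And3 c2 c4 b).
rewrite !(upd_upd _ _ _ ji) in H2.
have hh0 : 0 < h ^+ 2 by rewrite exprn_gt0.
rewrite -(ler_pM2r hh0) -[h ^+ 2 in leLHS](gtr0_norm hh0) -normrM.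
set A := phi (upd (upd x i (x 0 i + h)) j (x 0 j + h)) in H1 H2.
set B := phi (upd (upd x i (x 0 i + h)) j (x 0 j + 0)) in H1 H2.
set C := phi (upd (upd x i (x 0 i + 0)) j (x 0 j + h)) in H1 H2.
set D := phi (upd (upd x i (x 0 i + 0)) j (x 0 j + 0)) in H1 H2.
have -> : (M1 - M2) * h ^+ 2 = (A - C - (B - D) - M2 * h ^+ 2) -
   (A - B - (C - D) - M1 * h ^+ 2) by ring.
rewrite (le_trans (ler_normB _ _))//.
by rewrite [e in leRHS]splitr mulrDl; apply: lerD; [exact: H2|exact: H1].
Unshelve. all: by end_near. Qed.

End Schwarz.

Section Cm.
Context {R : realType} {n : nat}.
Implicit Types (phi psi : 'rV[R]_n -> R) (x z : 'rV[R]_n) (i j : 'I_n) (O : set 'rV[R]_n).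

(** Same recursion as [Cm_closure], with continuity at the points of [O] in
place of limits within Omega; unlike the latter it is stable under the rules of
calculus with no reference to the boundary. *)
Fixpoint Cm_on O (m : nat) phi : Prop :=
  (forall x, O x -> {for x, continuous phi}) /\
  (if m is m'.+1 then
     forall i, (forall x, O x -> derivable phi x (delta_mx 0 i)) /\ Cm_on O m' (pder i phi)
   else True).

(** Iterated derivatives along a list of directions.  [mpder] is the case of
a sorted list, and lists can be cut and permuted where multi-indices cannot. *)
Definition ders (s : seq 'I_n) phi := foldr (@pder R n) phi s.

Lemma Cm_on_continuous O m phi : Cm_on O m phi -> forall x, O x -> {for x, continuous phi}.
Proof. by case: m => [|m] []. Qed.
Arguments Cm_on_continuous {O m phi} _ {x} _.

Lemma Cm_on_derivable O m phi i : Cm_on O m.+1 phi ->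
  forall x, O x -> derivable phi x (delta_mx 0 i).
Proof. by move=> [_ /(_ i)[]]. Qed.
Arguments Cm_on_derivable {O m phi} i _ {x} _.

Lemma Cm_on_pder O m phi i : Cm_on O m.+1 phi -> Cm_on O m (pder i phi).
Proof. by move=> [_ /(_ i)[]]. Qed.

Lemma Cm_onW O m phi : Cm_on O m.+1 phi -> Cm_on O m phi.
Proof.
elim: m phi => [phi []//|m IH phi h]; split; first by move=> x Ox; exact: (Cm_on_continuous h Ox).
by move=> i; split; [move=> x Ox; exact: (Cm_on_derivable i h Ox)|apply: IH; exact: Cm_on_pder].
Qed.

Lemma Cm_on_le O m m' phi : (m' <= m)%N -> Cm_on O m phi -> Cm_on O m' phi.
Proof. by move=> /subnK <-; elim: (m - m')%N => // k IH /Cm_onW. Qed.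

Lemma Cm_on_ders O m phi s : (size s <= m)%N -> Cm_on O m phi ->
  Cm_on O (m - size s) (ders s phi).
Proof.
elim: s => [|i s IH] /=; first by rewrite subn0.
move=> sm h; have := IH (ltnW sm) h; rewrite -(subnSK sm).
exact: Cm_on_pder.
Qed.

Lemma pder_eq_on O phi psi i x : open O -> (forall z, O z -> phi z = psi z) ->
  O x -> pder i phi x = pder i psi x.
Proof.
move=> oO h Ox; apply: near_eq_derive.
by near=> z; apply: h; near: z; exact: open_nbhs_nbhs.
Unshelve. all: by end_near. Qed.

Lemma ders_cons i s phi : ders (i :: s) phi = pder i (ders s phi).
Proof. by []. Qed.

Lemma ders_cat s t phi : ders (s ++ t) phi = ders s (ders t phi).
Proof. by rewrite /ders foldr_cat. Qed.

Lemma ders_eq_on O s phi psi : open O -> (forall z, O z -> phi z = psi z) ->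
  forall x, O x -> ders s phi x = ders s psi x.
Proof.
move=> oO h; elim: s => [//|i s IH] x Ox /=.
exact: (pder_eq_on _ oO IH).
Qed.

Lemma Cm_on_schwarz O m phi i j x : open O -> (1 < m)%N -> Cm_on O m phi -> O x ->
  pder i (pder j phi) x = pder j (pder i phi) x.
Proof.
move=> oO m1 h Ox.
have {m m1}h : Cm_on O 2 phi by exact: Cm_on_le h.
apply: schwarz; last 2 first.
- exact: (Cm_on_continuous (Cm_on_pder _ (Cm_on_pder _ h)) Ox).
- exact: (Cm_on_continuous (Cm_on_pder _ (Cm_on_pder _ h)) Ox).
have nO : nbhs x O by apply: open_nbhs_nbhs.
apply: filterS nO => z Oz; split.
- exact: (Cm_on_derivable _ h Oz).
- exact: (Cm_on_derivable _ h Oz).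
- exact: (Cm_on_derivable _ (Cm_on_pder _ h) Oz).
- exact: (Cm_on_derivable _ (Cm_on_pder _ h) Oz).
Qed.

(** Induction on the list, [schwarz] moving one direction at a time to the
front. *)
Lemma ders_perm O m phi s t : open O -> (size s <= m)%N -> Cm_on O m phi ->
  perm_eq s t -> forall x, O x -> ders s phi x = ders t phi x.
Proof.
move=> oO; elim: s t => [|i s IH] t sm h.
  by move=> /perm_size/esym/size0nil ->.
move=> st; have it : i \in t by rewrite -(perm_mem st) mem_head.
have [t1 [t2 def_t]] : exists t1 t2, t = t1 ++ i :: t2.
  exists (take (index i t) t), (drop (index i t).+1 t).
  by rewrite -{1}(cat_take_drop (index i t) t) (drop_nth i) ?index_mem// nth_index.
have {}st : perm_eq s (t1 ++ t2).
  by rewrite -(perm_cons i) (permPl st) def_t -[i :: t2]cat1s perm_catCA perm_refl.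
move=> x Ox; rewrite ders_cons (pder_eq_on i oO (IH _ (ltnW sm) h st) Ox) {}def_t.
move: (perm_size st) sm; rewrite /= => -> {s IH st}.
elim: t1 x Ox => [//|k t1 IHt] x Ox sm.
rewrite /= -(pder_eq_on k oO (fun z Oz => IHt z Oz (ltnW sm)) Ox).
apply: (@Cm_on_schwarz O 2 _ i k x oO) => //.
have := Cm_on_ders (ltnW (ltnW sm) : (size (t1 ++ t2) <= m)%N) h.
by apply: Cm_on_le; rewrite ltn_subRL addn1.
Qed.

Lemma Cm_on_eq O m phi psi : open O -> (forall z, O z -> phi z = psi z) ->
  Cm_on O m phi -> Cm_on O m psi.
Proof.
move=> oO; have ct (f1 f2 : 'rV[R]_n -> R) x : (forall z, O z -> f1 z = f2 z) -> O x ->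
    {for x, continuous f1} -> {for x, continuous f2}.
  move=> h Ox c; rewrite /prop_for /continuous_at -(h _ Ox).
  have nO : nbhs x O by apply: open_nbhs_nbhs.
  apply: cvg_trans c; apply: (@near_eq_cvg _ _ (nbhs x)).
  by apply: filterS nO => z Oz; exact: h.
elim: m phi psi => [|m IH] phi psi h hphi.
  by split=> // x Ox; apply: (ct _ _ _ h Ox); exact: (Cm_on_continuous hphi Ox).
split=> [x Ox|i]; first by apply: (ct _ _ _ h Ox); exact: (Cm_on_continuous hphi Ox).
split=> [x Ox|].
  apply: near_eq_derivable (Cm_on_derivable i hphi Ox).
  by near=> z; apply: h; near: z; exact: open_nbhs_nbhs.
apply: IH (Cm_on_pder i hphi) => z Oz; exact: pder_eq_on Oz.
Unshelve. all: by end_near. Qed.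

End Cm.
Arguments Cm_on_continuous {R n O m phi} _ {x} _.
Arguments Cm_on_derivable {R n O m phi} i _ {x} _.

(** * Derivatives of tanh *)

Section Tanh.
Context {R : realType}.
Implicit Types (x : R) (m a b : nat).

(** With p and q the two logistic functions below, p + q = 1, tanh = p - q and
p' = - q' = 2 p q, so the derivatives of tanh are polynomials in p and q that are
divisible by p q; and p q <= exp (- 2 |x|). *)
Definition half_plus x : R := expR x / (expR x + expR (- x)).
Definition half_minus x : R := expR (- x) / (expR x + expR (- x)).

Let den_gt0 x : 0 < expR x + expR (- x).
Proof. by rewrite addr_gt0 ?expR_gt0. Qed.

Let den_neq0 x : expR x + expR (- x) != 0.
Proof. by rewrite gt_eqF. Qed.

Lemma tanhE x : tanh x = half_plus x - half_minus x.
Proof. by rewrite /tanh /half_plus /half_minus mulrBl. Qed.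

Lemma half_plusD x : half_plus x + half_minus x = 1.
Proof. by rewrite /half_plus /half_minus -mulrDl divff. Qed.

Lemma half_plus_ge0 x : 0 <= half_plus x.
Proof. by rewrite divr_ge0 ?expR_ge0 ?ltW. Qed.

Lemma half_minus_ge0 x : 0 <= half_minus x.
Proof. by rewrite divr_ge0 ?expR_ge0 ?ltW. Qed.

Lemma half_plus_le1 x : half_plus x <= 1.
Proof. by rewrite -(half_plusD x) lerDl half_minus_ge0. Qed.

Lemma half_minus_le1 x : half_minus x <= 1.
Proof. by rewrite -(half_plusD x) lerDr half_plus_ge0. Qed.

Lemma tanh_le1 x : `|tanh x| <= 1.
Proof.
rewrite tanhE ler_norml; have := half_plusD x.
have := half_plus_ge0 x; have := half_minus_ge0 x; lra.
Qed.

Lemma half_minus_expR x : half_minus x <= expR (- 2 * x).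
Proof.
rewrite /half_minus ler_pdivrMr// mulrDr -!expRD.
have -> : - 2 * x + x = - x by ring.
by rewrite lerDl expR_ge0.
Qed.

Lemma half_plusN x : half_plus (- x) = half_minus x.
Proof. by rewrite /half_plus /half_minus opprK addrC. Qed.

Lemma half_minusN x : half_minus (- x) = half_plus x.
Proof. by rewrite -half_plusN opprK. Qed.

Lemma half_product_le x : half_plus x * half_minus x <= expR (- 2 * `|x|).
Proof.
have h y : 0 <= y -> half_plus y * half_minus y <= expR (- 2 * `|y|).
  move=> y0; rewrite ger0_norm//; apply: le_trans (half_minus_expR y).
  by rewrite ler_piMl ?half_minus_ge0 ?half_plus_le1.
have [/h//|x0] := leP 0 x.
have := h (- x); rewrite normrN half_plusN half_minusN mulrC; apply.
by rewrite oppr_ge0 ltW.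
Qed.

Lemma is_derive_half_plus x :
  is_derive x 1 half_plus (2 * (half_plus x * half_minus x)).
Proof.
have d0 : (fun y : R => expR y + expR (- y)) x != 0 by exact: den_neq0.
have hd : is_derive x 1 (fun y : R => expR y + expR (- y)) (expR x - expR (- x)).
  have h : is_derive x 1 (expR \o -%R) (expR (- x) * -1) by apply: is_derive1_comp.
  have -> : (fun y : R => expR y + expR (- y)) = expR + (expR \o -%R) by apply/funext.
  by apply: is_derive_eq; rewrite mulrN1.
have hV := @is_deriveV R (fun y : R => expR y + expR (- y)) x _ 1 d0 hd.
have -> : half_plus = expR * (fun y => (expR y + expR (- y))^-1) by apply/funext.
apply: is_derive_eq.
rewrite !fctE /GRing.scale/= /half_minus; field.
exact: den_neq0.
Qed.

Lemma is_derive_half_minus x :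
  is_derive x 1 half_minus (- (2 * (half_plus x * half_minus x))).
Proof.
have E : half_minus = cst 1 - half_plus.
  by apply/funext => y; rewrite !fctE -(half_plusD y) addrC addKr.
have ? := is_derive_half_plus x.
by rewrite [X in is_derive _ _ X]E; apply: is_derive_eq; rewrite sub0r.
Qed.

(** [logistic_sum m C f] says that [f] is a homogeneous polynomial of degree
m + 1 in p and q that is divisible by p q, written with coefficients whose
absolute values add up to [C]. *)
Inductive logistic_sum : nat -> R -> (R -> R) -> Prop :=
| logistic_monomial a b (c : R) : logistic_sum (a + b).+1 `|c|
    (fun x => c * (half_plus x ^+ a.+1 * half_minus x ^+ b.+1))
| logistic_add m C C' f g : logistic_sum m C f -> logistic_sum m C' g ->
    logistic_sum m (C + C') (fun x => f x + g x).

Lemma logistic_sum_bound m C f x : logistic_sum m C f ->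
  `|f x| <= C * expR (- 2 * `|x|).
Proof.
elim=> [a b c|{}m C0 C' f0 g _ hf _ hg].
  rewrite normrM ler_wpM2l// ger0_norm; last first.
    by rewrite mulr_ge0// exprn_ge0 ?half_plus_ge0 ?half_minus_ge0.
  apply: le_trans (half_product_le x); rewrite !exprS mulrACA ler_piMr//.
    by rewrite mulr_ge0 ?half_plus_ge0 ?half_minus_ge0.
  by rewrite mulr_ile1 ?exprn_ge0 ?exprn_ile1 ?half_plus_ge0 ?half_minus_ge0 ?half_plus_le1 ?half_minus_le1.
by rewrite mulrDl (le_trans (ler_normD _ _))// lerD.
Qed.

(** The derivative of p^a q^b is 2 a p^a q^(b+1) - 2 b p^(a+1) q^b: the degree
increases by one and the sum of the coefficients is multiplied by twice the
degree. *)
Lemma logistic_sum_deriv m C f : logistic_sum m C f ->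
  exists2 f', logistic_sum m.+1 ((2 * m.+1)%:R * C) f' &
    forall x, is_derive x 1 f (f' x).
Proof.
elim=> [a b c|{}m C0 C' f0 g _ [f' hf df] _ [g' hg dg]].
  exists (fun x => (2 * a.+1%:R * c) * (half_plus x ^+ a.+1 * half_minus x ^+ b.+2)
     + (- (2 * b.+1%:R * c)) * (half_plus x ^+ a.+2 * half_minus x ^+ b.+1)).
    have -> : (2 * (a + b).+2)%:R * `|c| =
       `|2 * a.+1%:R * c| + `|- (2 * b.+1%:R * c)| :> R.
      have -> : (2 * (a + b).+2)%:R = 2 * a.+1%:R + 2 * b.+1%:R :> R.
        by rewrite -addnS -addSn natrM natrD mulrDr.
      by rewrite normrN !normrM !normr_nat mulrDl.
    apply: logistic_add.
      have := logistic_monomial a b.+1 (2 * a.+1%:R * c).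
      by rewrite addnS.
    by have := logistic_monomial a.+1 b (- (2 * b.+1%:R * c)).
  move=> x.
  have -> : (fun x => c * (half_plus x ^+ a.+1 * half_minus x ^+ b.+1)) =
     c \*: (half_plus ^+ a.+1 * half_minus ^+ b.+1).
    by apply/funext => y; rewrite !fctE.
  have ? := is_derive_half_plus x; have ? := is_derive_half_minus x.
  apply: is_derive_eq.
  rewrite /GRing.scale/= !exprfctE !exprS; ring.
exists (fun x => f' x + g' x); first by rewrite mulrDr; exact: logistic_add.
move=> x; have ? := df x; have ? := dg x; exact: is_deriveD.
Qed.

Lemma is_derive_tanh x : is_derive x 1 tanh (4 * (half_plus x * half_minus x)).
Proof.
have -> : (@tanh R) = half_plus - half_minus by apply/funext => y; exact: tanhE.
have ? := is_derive_half_plus x; have ? := is_derive_half_minus x.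
by apply: is_derive_eq; ring.
Qed.

Local Notation mu m := (derive1n m (@tanh R)).

(** The factors of [logistic_sum_deriv] accumulate to a factorial and a power
of 2, starting from tanh' = 4 p q. *)
Lemma tanh_deriv_logistic m : logistic_sum m.+1 (m.+1`!%:R * 2 ^+ m.+2) (mu m.+1).
Proof.
elim: m => [|m IH].
  rewrite derive1n1.
  have -> : derive1 (@tanh R) = fun x => 4 * (half_plus x ^+ 1 * half_minus x ^+ 1).
    by apply/funext => x; rewrite derive1E !expr1; have ? := is_derive_tanh x; exact: derive_val.
  have := logistic_monomial 0 0 4.
  by rewrite ger0_norm// (_ : 1`!%:R * 2 ^+ 2 = 4 :> R)// mul1r -natrX.
have [f' hf df] := logistic_sum_deriv IH.
have -> : mu m.+2 = f'.
  by apply/funext => x; rewrite derive1nS derive1E; have ? := df x; exact: derive_val.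
have -> // : m.+2`!%:R * 2 ^+ m.+3 = (2 * m.+2)%:R * (m.+1`!%:R * 2 ^+ m.+2) :> R.
by rewrite (factS m.+1) !natrM exprS; ring.
Qed.

Lemma is_derive_tanh_deriv m x : is_derive x 1 (mu m) (mu m.+1 x).
Proof.
have h : derivable (mu m) x 1.
  case: m => [|m]; first by have [] := is_derive_tanh x.
  by have [f' _ df] := logistic_sum_deriv (tanh_deriv_logistic m); have [] := df x.
by rewrite derive1nS derive1E; exact: derivableP.
Qed.

Lemma tanh_deriv_bound m x :
  `|mu m.+1 x| <= m.+1`!%:R * 2 ^+ m.+2 * expR (- 2 * `|x|).
Proof. exact: logistic_sum_bound (tanh_deriv_logistic m). Qed.

Lemma continuous_tanh_deriv m : continuous (mu m).
Proof.
move=> x; have [h _] := is_derive_tanh_deriv m x.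
by apply: differentiable_continuous; apply/derivable1_diffP.
Qed.

Lemma tanh_deriv_bounded m : exists C : R, forall x, `|mu m x| <= C.
Proof.
case: m => [|m]; first by exists 1 => x; exact: tanh_le1.
exists (m.+1`!%:R * 2 ^+ m.+2) => x; rewrite (le_trans (tanh_deriv_bound m x))//.
rewrite ler_piMr// -?natrX -?natrM// -expR0 ler_expR mulNr oppr_le0 mulr_ge0//.
Qed.

(** Taylor's inequality on the segment from [z] to [z'].  Every point of the
segment has absolute value at least |z| - rho, whence the exponential.  The
right-hand side is an entry of [Qval]. *)
Lemma tanh_deriv_taylor (m N : nat) (z z' rho : R) : `|z' - z| <= rho ->
  `|mu m z' - mu m z| <=
    \sum_(1 <= j < N.+1) rho ^+ j / j`!%:R * `|mu (m + j) z|
    + rho ^+ N.+1 * ((m + N + 1)`!%:R / (N + 1)`!%:R * 2 ^+ (m + N + 2))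
      * expR (- 2 * Num.max 0 (`|z| - rho)).
Proof.
move=> zrho; set d := `|z' - z|; set e := Num.sg (z' - z).
have e1 : `|e| <= 1 by rewrite /e normr_sg lern1; case: eqP.
have ed : z + e * d = z' by rewrite /e /d -numEsg addrC subrK.
set S := (m + N + 1)`!%:R * 2 ^+ (m + N + 2) * expR (- 2 * Num.max 0 (`|z| - rho)).
have := @taylor_ineq R (fun j t => e ^+ j * mu (m + j) (z + e * t)) N S d (normr_ge0 _).
rewrite !expr0 !mul1r !mulr0 !addr0 addn0 ed => h.
apply: le_trans (h _ _) _.
- move=> j t _.
  have -> : e ^+ j.+1 * mu (m + j.+1) (z + e * t) = e ^+ j * (e * mu (m + j).+1 (z + e * t)).
    by rewrite exprSr addnS mulrA.
  have dd := is_derive_affine (is_derive_tanh_deriv (m + j) (z + e * t)).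
  have -> : (fun t => e ^+ j * mu (m + j) (z + e * t)) =
     (e ^+ j) \*: (fun t => mu (m + j) (z + e * t)) by apply/funext.
  exact: is_deriveZ.
- move=> t /andP[t0 td]; rewrite normrM normrX addnS.
  rewrite (@le_trans _ _ `|mu (m + N).+1 (z + e * t)|)//.
    by rewrite ler_piMl// exprn_ile1.
  rewrite (le_trans (tanh_deriv_bound _ _))// /S addn1 addn2 ler_wpM2l//.
  rewrite ler_expR !mulNr lerN2 ler_wpM2l// ge_max normr_ge0 /=.
  have : `|e * t| <= rho.
    rewrite normrM (ger0_norm t0) (le_trans _ zrho)// (le_trans _ td)//.
    by rewrite ler_piMl.
  have := ler_normB (z + e * t) (e * t); rewrite addrK; lra.
have d0 : 0 <= d by exact: normr_ge0.
have rho0 : 0 <= rho by exact: le_trans zrho.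
apply: lerD.
  apply: ler_sum => j _; apply: ler_pM.
  - by rewrite mulr_ge0 ?exprn_ge0 ?invr_ge0.
  - exact: normr_ge0.
  - by rewrite ler_wpM2r ?invr_ge0// lerXn2r ?nnegrE.
  - by rewrite normrM ler_piMl// normrX exprn_ile1.
rewrite /S -!addnA addn1.
set K := expR _.
have -> : rho ^+ N.+1 * ((m + N.+1)`!%:R / N.+1`!%:R * 2 ^+ (m + (N + 2))) * K =
  rho ^+ N.+1 / N.+1`!%:R * ((m + N.+1)`!%:R * 2 ^+ (m + (N + 2)) * K) by ring.
rewrite ler_wpM2r//.
  by rewrite !mulr_ge0 ?exprn_ge0 ?expR_ge0.
by rewrite ler_wpM2r ?invr_ge0// lerXn2r ?nnegrE.
Qed.

End Tanh.

(** * Calculus of partial derivatives *)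

Section Algebra.
Context {R : realType} {n : nat}.
Implicit Types (f g phi psi : 'rV[R]_n -> R) (x z : 'rV[R]_n) (i j : 'I_n).
Local Notation mu m := (derive1n m (@tanh R)).

Lemma is_derive_pder phi x i : derivable phi x (delta_mx 0 i) ->
  is_derive x (delta_mx 0 i) phi (pder i phi x).
Proof. exact: derivableP. Qed.

Lemma is_derive_pderE phi x i d : is_derive x (delta_mx 0 i) phi d -> pder i phi x = d.
Proof. by move=> h; rewrite /pder derive_val. Qed.

Lemma is_derive_add f g x i df dg :
  is_derive x (delta_mx 0 i) f df -> is_derive x (delta_mx 0 i) g dg ->
  is_derive x (delta_mx 0 i) (fun z => f z + g z) (df + dg).
Proof. by move=> hf hg; exact: is_deriveD. Qed.

Lemma is_derive_mul f g x i df dg :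
  is_derive x (delta_mx 0 i) f df -> is_derive x (delta_mx 0 i) g dg ->
  is_derive x (delta_mx 0 i) (fun z => f z * g z) (df * g x + f x * dg).
Proof.
move=> hf hg; rewrite addrC [df * _]mulrC; exact: is_deriveM.
Qed.

Lemma is_derive_coord x i j :
  is_derive x (delta_mx 0 i) (fun z => z 0 j) (j == i)%:R.
Proof.
rewrite -{1}(upd_id x i).
have h : is_derive (x 0 i) 1 (fun s => upd x i s 0 j) (j == i)%:R.
  have [ji|ji] := eqVneq j i.
    have -> : (fun s => upd x i s 0 j) = id by apply/funext => s; rewrite mxE ji eqxx.
    exact: is_derive_id.
  have -> : (fun s => upd x i s 0 j) = cst (x 0 j).
    by apply/funext => s; rewrite mxE (negbTE ji).
  exact: is_derive_cst.
have hd : derivable (fun z : 'rV[R]_n => z 0 j) (upd x i (x 0 i)) (delta_mx 0 i).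
  by apply: (@derivable_upd _ _ (fun z : 'rV[R]_n => z 0 j)); case: h.
apply: DeriveDef; first exact: hd.
have := @is_derive_upd _ _ (fun z : 'rV[R]_n => z 0 j) _ _ _ hd.
by case=> _ E; rewrite -/(pder _ _ _) -E; case: h.
Qed.

Lemma is_derive_chain (h : R -> R) (dh : R) f x i df :
  is_derive (f x) 1 h dh -> is_derive x (delta_mx 0 i) f df ->
  is_derive x (delta_mx 0 i) (fun z => h (f z)) (dh * df).
Proof.
rewrite -{1 2}(upd_id x i) => hh [hf hdf].
have h1 : is_derive (x 0 i) 1 (fun s => f (upd x i s)) df.
  by rewrite -hdf; exact: is_derive_upd.
have h2 : is_derive (x 0 i) 1 (h \o (fun s => f (upd x i s))) (dh * df).
  exact: is_derive1_comp.
have hd : derivable (fun z => h (f z)) (upd x i (x 0 i)) (delta_mx 0 i).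
  by apply: (@derivable_upd _ _ (fun z => h (f z))); case: h2.
rewrite -(upd_id x i).
apply: DeriveDef; first exact: hd.
have := @is_derive_upd _ _ (fun z => h (f z)) _ _ _ hd.
by case=> _ E; rewrite -/(pder _ _ _) -E; case: h2.
Qed.

Variables (O : set 'rV[R]_n) (oO : open O).

(** Formulas for the partial derivatives are available on [O] only, and
the class of functions has to be insensitive to what happens elsewhere. *)
Lemma Cm_on_intro m phi (dphi : 'I_n -> 'rV[R]_n -> R) :
  (forall x, O x -> {for x, continuous phi}) ->
  (forall i x, O x -> is_derive x (delta_mx 0 i) phi (dphi i x)) ->
  (forall i, Cm_on O m (dphi i)) -> Cm_on O m.+1 phi.
Proof.
move=> c hd hC; split=> // i; split=> [x Ox|]; first by have [] := hd i x Ox.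
apply: (Cm_on_eq oO) (hC i) => z Oz.
by rewrite (is_derive_pderE (hd i z Oz)).
Qed.

Lemma Cm_on_is_derive m phi i x : Cm_on O m.+1 phi -> O x ->
  is_derive x (delta_mx 0 i) phi (pder i phi x).
Proof. move=> h Ox; apply: is_derive_pder; exact: (Cm_on_derivable i h Ox). Qed.

Lemma Cm_on_cst m (c : R) : Cm_on O m (fun=> c).
Proof.
have ct (c' : R) x : {for x, continuous (fun=> c' : R)} by exact: cst_continuous.
elim: m c => [|m IH] c; first by split=> // x _; exact: ct.
apply: (@Cm_on_intro _ _ (fun=> fun=> 0)).
- by move=> x _; exact: ct.
- by move=> i; exact: IH.
Qed.

Lemma Cm_on_coord m j : Cm_on O m (fun x => x 0 j).
Proof.
have c x : {for x, continuous (fun x : 'rV[R]_n => x 0 j)} by exact: coord_continuous.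
case: m => [|m]; first by split.
apply: (@Cm_on_intro _ _ (fun i => fun=> (j == i)%:R)) => [x _//|i x _|i].
  exact: is_derive_coord.
exact: Cm_on_cst.
Qed.

Lemma Cm_onD m f g : Cm_on O m f -> Cm_on O m g -> Cm_on O m (fun x => f x + g x).
Proof.
elim: m f g => [|m IH] f g hf hg.
  split=> // x Ox; exact: (cvgD (Cm_on_continuous hf Ox) (Cm_on_continuous hg Ox)).
apply: (@Cm_on_intro _ _ (fun i x => pder i f x + pder i g x)) => [x Ox|i x Ox|i].
- exact: (cvgD (Cm_on_continuous hf Ox) (Cm_on_continuous hg Ox)).
- by apply: is_derive_add; [exact: Cm_on_is_derive hf _|exact: Cm_on_is_derive hg _].
- by apply: IH; exact: Cm_on_pder.
Qed.

Lemma Cm_onM m f g : Cm_on O m f -> Cm_on O m g -> Cm_on O m (fun x => f x * g x).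
Proof.
elim: m f g => [|m IH] f g hf hg.
  split=> // x Ox; exact: (cvgM (Cm_on_continuous hf Ox) (Cm_on_continuous hg Ox)).
apply: (@Cm_on_intro _ _ (fun i x => pder i f x * g x + f x * pder i g x)) => [x Ox|i x Ox|i].
- exact: (cvgM (Cm_on_continuous hf Ox) (Cm_on_continuous hg Ox)).
- by apply: is_derive_mul; [exact: Cm_on_is_derive hf _|exact: Cm_on_is_derive hg _].
- by apply: Cm_onD; apply: IH; (exact: Cm_on_pder || exact: Cm_onW).
Qed.

Lemma Cm_onZ m (c : R) f : Cm_on O m f -> Cm_on O m (fun x => c * f x).
Proof. by apply: Cm_onM; exact: Cm_on_cst. Qed.

Lemma Cm_onB m f g : Cm_on O m f -> Cm_on O m g -> Cm_on O m (fun x => f x - g x).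
Proof.
move=> hf hg; have := Cm_onD hf (Cm_onZ (-1) hg).
by apply: Cm_on_eq => // z _; rewrite mulN1r.
Qed.

Lemma Cm_on_sum m (I : Type) (r : seq I) (P : pred I) (F : I -> 'rV[R]_n -> R) :
  (forall k, P k -> Cm_on O m (F k)) -> Cm_on O m (fun x => \sum_(k <- r | P k) F k x).
Proof.
move=> h; elim: r => [|k r IH].
  by apply: Cm_on_eq (Cm_on_cst m 0) => // z _; rewrite big_nil.
have [Pk|nPk] := boolP (P k).
  by apply: Cm_on_eq (Cm_onD (h k Pk) IH) => // z _; rewrite big_cons Pk.
by apply: Cm_on_eq IH => // z _; rewrite big_cons (negbTE nPk).
Qed.

Lemma Cm_on_prod m (I : Type) (r : seq I) (P : pred I) (F : I -> 'rV[R]_n -> R) :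
  (forall k, P k -> Cm_on O m (F k)) -> Cm_on O m (fun x => \prod_(k <- r | P k) F k x).
Proof.
move=> h; elim: r => [|k r IH].
  by apply: Cm_on_eq (Cm_on_cst m 1) => // z _; rewrite big_nil.
have [Pk|nPk] := boolP (P k).
  by apply: Cm_on_eq (Cm_onM (h k Pk) IH) => // z _; rewrite big_cons Pk.
by apply: Cm_on_eq IH => // z _; rewrite big_cons (negbTE nPk).
Qed.

(** The induction needs all the derivatives of tanh at once, since
differentiating turns the k-th one into the (k+1)-st. *)
Lemma Cm_on_tanh m k f : Cm_on O m f -> Cm_on O m (fun x => mu k (f x)).
Proof.
have ct l g x : {for x, continuous g} -> {for x, continuous (fun x => mu l (g x))}.
  move=> h; apply: (@continuous_comp _ _ _ g (mu l)) => //.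
  exact: continuous_tanh_deriv.
elim: m k f => [|m IH] k f hf.
  by split=> // x Ox; apply: ct; exact: (Cm_on_continuous hf Ox).
apply: (@Cm_on_intro _ _ (fun i x => mu k.+1 (f x) * pder i f x)) => [x Ox|i x Ox|i].
- by apply: ct; exact: (Cm_on_continuous hf Ox).
- apply: is_derive_chain; first exact: is_derive_tanh_deriv.
  exact: Cm_on_is_derive hf _.
- by apply: Cm_onM; [apply: IH; exact: Cm_onW|exact: Cm_on_pder].
Qed.

Lemma ders_is_derive m s i f x : (size s < m)%N -> Cm_on O m f -> O x ->
  is_derive x (delta_mx 0 i) (ders s f) (ders (i :: s) f x).
Proof.
move=> sm hf Ox; have := Cm_on_ders (ltnW sm) hf.
rewrite -(subnSK sm) => h; exact: Cm_on_is_derive h Ox.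
Qed.

Lemma ders_rec s i f (F : 'rV[R]_n -> R) d x : O x ->
  (forall z, O z -> ders s f z = F z) ->
  is_derive x (delta_mx 0 i) F d -> ders (i :: s) f x = d.
Proof.
by move=> Ox hF hd; rewrite ders_cons (pder_eq_on i oO hF Ox) (is_derive_pderE hd).
Qed.

Lemma dersD m s f g x : (size s <= m)%N -> Cm_on O m f -> Cm_on O m g -> O x ->
  ders s (fun x => f x + g x) x = ders s f x + ders s g x.
Proof.
move=> + hf hg; elim: s x => [//|i s IH] x sm Ox.
apply: (@ders_rec _ _ _ (fun z => ders s f z + ders s g z)) => // [z Oz|].
  by apply: IH => //; exact: ltnW.
by apply: is_derive_add; apply: (@ders_is_derive m).
Qed.

Lemma dersZ m s (c : R) f x : (size s <= m)%N -> Cm_on O m f -> O x ->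
  ders s (fun x => c * f x) x = c * ders s f x.
Proof.
move=> + hf; elim: s x => [//|i s IH] x sm Ox.
apply: (@ders_rec _ _ _ (fun z => c * ders s f z)) => // [z Oz|].
  by apply: IH => //; exact: ltnW.
rewrite -[X in is_derive _ _ _ X]add0r -(mul0r (ders s f x)).
by apply: is_derive_mul; apply: (@ders_is_derive m).
Qed.

Lemma dersB m s f g x : (size s <= m)%N -> Cm_on O m f -> Cm_on O m g -> O x ->
  ders s (fun x => f x - g x) x = ders s f x - ders s g x.
Proof.
move=> sm hf hg Ox.
rewrite (@ders_eq_on _ _ O s _ (fun x => f x + -1 * g x) oO)//; last first.
  by move=> z _; rewrite mulN1r.
rewrite (dersD sm hf (Cm_onZ (-1) hg) Ox) (dersZ _ sm hg Ox).
by rewrite mulN1r.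
Qed.

Lemma ders_cst s (c : R) x : O x -> (0 < size s)%N -> ders s (fun=> c) x = 0.
Proof.
elim: s x => [//|i [|j s] IH] x Ox _.
  by apply: is_derive_pderE; exact: is_derive_cst.
by apply: (@ders_rec _ _ _ (fun=> 0)) => // z Oz; exact: IH.
Qed.

Lemma ders_sum m s (I : Type) (r : seq I) (P : pred I) (F : I -> 'rV[R]_n -> R) x :
  (size s <= m)%N -> (forall k, P k -> Cm_on O m (F k)) -> O x ->
  ders s (fun x => \sum_(k <- r | P k) F k x) x = \sum_(k <- r | P k) ders s (F k) x.
Proof.
move=> sm h Ox; elim: r => [|k r IH].
  rewrite big_nil (@ders_eq_on _ _ O s _ (fun=> 0) oO)//; last first.
    by move=> z _; rewrite big_nil.
  by case: s sm => [//|i s _]; apply: ders_cst.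
rewrite big_cons; case: ifP => Pk.
  rewrite (@ders_eq_on _ _ O s _ (fun x => F k x + \sum_(k <- r | P k) F k x) oO)//; last first.
    by move=> z _; rewrite big_cons Pk.
  rewrite (dersD sm _ _ Ox) ?IH//; first exact: h.
  exact: Cm_on_sum.
rewrite (@ders_eq_on _ _ O s _ (fun x => \sum_(k <- r | P k) F k x) oO)//.
by move=> z _; rewrite big_cons Pk.
Qed.

End Algebra.

Section MultiIndex.
Context {n : nat}.
Implicit Types (a b : mindex n) (i j : 'I_n).

Lemma count_mi_seq a i : count_mem i (mi_seq a) = a i.
Proof.
rewrite /mi_seq count_flatten -map_comp sumnE big_map big_enum /=.
rewrite (bigD1 i)//= count_nseq /= eqxx mul1n big1 ?addn0// => j ji.
by rewrite count_nseq /= (negbTE ji).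
Qed.

Lemma size_mi_seq a : size (mi_seq a) = mi_deg a.
Proof.
rewrite /mi_seq size_flatten /shape -map_comp sumnE big_map big_enum /=.
by apply: eq_bigr => i _; rewrite size_nseq.
Qed.

Lemma mindexDE a b i : (a + b) i = (a i + b i)%N.
Proof. by rewrite ffunE. Qed.

Lemma mindex0E i : (0 : mindex n) i = 0%N.
Proof. by rewrite ffunE. Qed.

Lemma mi_seq_perm a s : (forall i, a i = count_mem i s) -> perm_eq (mi_seq a) s.
Proof. by move=> h; apply/allP => i _ /=; rewrite count_mi_seq h. Qed.

Lemma mi_seqD a b : perm_eq (mi_seq (a + b)) (mi_seq a ++ mi_seq b).
Proof. by apply: mi_seq_perm => i; rewrite count_cat !count_mi_seq mindexDE. Qed.

Lemma mi_seq_unit i : mi_seq (unit_mi i) = [:: i].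
Proof.
apply: perm_small_eq => //; apply: mi_seq_perm => j.
by rewrite ffunE /= addn0 eq_sym.
Qed.

Lemma mi_seq0 : mi_seq (0 : mindex n) = [::].
Proof. by apply: perm_small_eq => //; apply: mi_seq_perm => j; rewrite mindex0E. Qed.

Lemma mi_degD a b : mi_deg (a + b) = (mi_deg a + mi_deg b)%N.
Proof. by rewrite -!size_mi_seq (perm_size (mi_seqD a b)) size_cat. Qed.

Lemma mi_deg_unit i : mi_deg (unit_mi i) = 1%N.
Proof. by rewrite -size_mi_seq mi_seq_unit. Qed.

Lemma mi_deg0 : mi_deg (0 : mindex n) = 0%N.
Proof. by rewrite -size_mi_seq mi_seq0. Qed.

Lemma mi_seq_inj a b : mi_seq a = mi_seq b -> a = b.
Proof. by move=> h; apply/ffunP => i; rewrite -!count_mi_seq h. Qed.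

Lemma mi_deg_eq0 a : (mi_deg a == 0%N) = (a == 0).
Proof.
apply/idP/eqP => [|->]; last by rewrite mi_deg0.
rewrite -size_mi_seq => /eqP/size0nil h; apply: mi_seq_inj.
by rewrite h mi_seq0.
Qed.

Lemma mi_seq1 a l : mi_seq a = [:: l] -> a = unit_mi l.
Proof. by move=> h; apply: mi_seq_inj; rewrite h mi_seq_unit. Qed.

Lemma mi_seq_unit_dec a :
  (exists l, a = unit_mi l) \/ forall l, mi_seq a <> [:: l].
Proof.
case E : (mi_seq a) => [|l [|? ?]]; [by right| |by right].
by left; exists l; exact: mi_seq1.
Qed.

Lemma mi_seq_sum_unit a (s : seq 'I_n) : a = \sum_(l <- s) unit_mi l ->
  perm_eq (mi_seq a) s.
Proof.
move=> ->; elim: s => [|l s IH]; first by rewrite big_nil mi_seq0.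
rewrite big_cons (perm_trans (mi_seqD _ _))// mi_seq_unit perm_cons.
exact: IH.
Qed.

(** Derivatives of order |a| are reached one direction at a time. *)
Lemma mindex_ind (P : mindex n -> Prop) : P 0 ->
  (forall a i, P a -> P (a + unit_mi i)) -> forall a, P a.
Proof.
move=> P0 PS a; move: {2}(mi_deg a) (erefl (mi_deg a)) => m.
elim: m a => [|m IH] a h.
  by have /eqP := h; rewrite mi_deg_eq0 => /eqP ->.
have /hasP[i _ ai] : has (fun i => (0 < a i)%N) (enum 'I_n).
  apply: contraT => /hasPn hn; suff : mi_deg a = 0%N by rewrite h.
  by rewrite /mi_deg big1// => i _; apply/eqP; rewrite -leqn0 leqNgt hn// mem_enum.
pose b := mi_sub a (unit_mi i).
have ab : a = b + unit_mi i.
  apply/ffunP => j; rewrite mindexDE !ffunE subnK//.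
  by case: eqP => [->|].
rewrite ab; apply: PS; apply: IH.
by move: h; rewrite ab mi_degD mi_deg_unit addn1 => -[].
Qed.

End MultiIndex.

Section Mpder.
Context {R : realType} {n : nat}.
Implicit Types (f g phi psi : 'rV[R]_n -> R) (x z : 'rV[R]_n) (i j : 'I_n) (a b : mindex n).

Lemma mpderE a f : mpder a f = ders (mi_seq a) f.
Proof. by []. Qed.

Lemma mpder0 f : mpder 0 f = f.
Proof. by rewrite mpderE mi_seq0. Qed.

Lemma mpder_unit i f : mpder (unit_mi i) f = pder i f.
Proof. by rewrite mpderE mi_seq_unit. Qed.

Variables (O : set 'rV[R]_n) (oO : open O).

(** By symmetry of mixed derivatives the order of the directions is
irrelevant. *)
Lemma mpder_ders m a s f x : Cm_on O m f -> (size s <= m)%N -> O x ->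
  (forall i, a i = count_mem i s) -> mpder a f x = ders s f x.
Proof.
move=> hf sm Ox h; have p := mi_seq_perm h.
by apply: (ders_perm oO _ hf p Ox); rewrite (perm_size p).
Qed.

Lemma mpderD m a i f x : Cm_on O m f -> (mi_deg a < m)%N -> O x ->
  mpder (a + unit_mi i) f x = pder i (mpder a f) x.
Proof.
move=> hf am Ox; apply: (@mpder_ders m _ (i :: mi_seq a)) => //=.
  by rewrite size_mi_seq.
by move=> j; rewrite mindexDE count_mi_seq ffunE addnC eq_sym.
Qed.

Lemma Cm_on_mpder m k a f : (k + mi_deg a <= m)%N -> Cm_on O m f -> Cm_on O k (mpder a f).
Proof.
move=> h hf; have am : (size (mi_seq a) <= m)%N.
  by rewrite size_mi_seq (leq_trans _ h)// leq_addl.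
apply: Cm_on_le (Cm_on_ders am hf).
by rewrite size_mi_seq leq_subRL 1?addnC// -size_mi_seq.
Qed.

End Mpder.

Section Smooth.
Context {R : realType} {n : nat}.
Implicit Types (f g phi psi : 'rV[R]_n -> R) (x z : 'rV[R]_n) (i j : 'I_n) (a b : mindex n).
Local Notation mu m := (derive1n m (@tanh R)).

Definition smooth f := forall m, Cm_on setT m f.

Lemma smooth_cst (c : R) : smooth (fun=> c).
Proof. by move=> m; apply: Cm_on_cst; exact: openT. Qed.
Lemma smooth_coord j : smooth (fun x => x 0 j).
Proof. by move=> m; apply: Cm_on_coord; exact: openT. Qed.
Lemma smoothD f g : smooth f -> smooth g -> smooth (fun x => f x + g x).
Proof. by move=> hf hg m; apply: Cm_onD => //; exact: openT. Qed.
Lemma smoothB f g : smooth f -> smooth g -> smooth (fun x => f x - g x).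
Proof. by move=> hf hg m; apply: Cm_onB => //; exact: openT. Qed.
Lemma smoothM f g : smooth f -> smooth g -> smooth (fun x => f x * g x).
Proof. by move=> hf hg m; apply: Cm_onM => //; exact: openT. Qed.
Lemma smoothZ (c : R) f : smooth f -> smooth (fun x => c * f x).
Proof. by move=> hf m; apply: Cm_onZ => //; exact: openT. Qed.
Lemma smooth_sum (I : Type) (r : seq I) (P : pred I) (F : I -> 'rV[R]_n -> R) :
  (forall k, P k -> smooth (F k)) -> smooth (fun x => \sum_(k <- r | P k) F k x).
Proof. by move=> hf m; apply: Cm_on_sum => [|k Pk]; [exact: openT|exact: hf]. Qed.
Lemma smooth_prod (I : Type) (r : seq I) (P : pred I) (F : I -> 'rV[R]_n -> R) :
  (forall k, P k -> smooth (F k)) -> smooth (fun x => \prod_(k <- r | P k) F k x).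
Proof. by move=> hf m; apply: Cm_on_prod => [|k Pk]; [exact: openT|exact: hf]. Qed.
Lemma smooth_tanh k f : smooth f -> smooth (fun x => mu k (f x)).
Proof. by move=> hf m; apply: Cm_on_tanh => //; exact: openT. Qed.

Lemma smooth_ders s f : smooth f -> smooth (ders s f).
Proof.
move=> hf m; have := Cm_on_ders (leq_addl m (size s)) (hf (m + size s)%N).
by rewrite addnK.
Qed.
Lemma smooth_pder i f : smooth f -> smooth (pder i f).
Proof. exact: (@smooth_ders [:: i]). Qed.
Lemma smooth_mpder a f : smooth f -> smooth (mpder a f).
Proof. exact: smooth_ders. Qed.

Lemma smooth_continuous f : smooth f -> continuous f.
Proof. by move=> hf x; exact: (Cm_on_continuous (hf 0%N)). Qed.
Lemma smooth_is_derive f i x : smooth f -> is_derive x (delta_mx 0 i) f (pder i f x).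
Proof. by move=> hf; apply: (Cm_on_is_derive _ (hf 1%N)). Qed.
Lemma smooth_derivable f i x : smooth f -> derivable f x (delta_mx 0 i).
Proof. by move=> /(smooth_is_derive i x)[]. Qed.

Lemma smooth_mpder_ders a s f : smooth f -> (forall i, a i = count_mem i s) ->
  mpder a f = ders s f.
Proof.
move=> hf h; apply/funext => x.
exact: (mpder_ders openT (hf (size s))).
Qed.

Lemma smooth_mpderD a i f : smooth f -> mpder (a + unit_mi i) f = pder i (mpder a f).
Proof.
move=> hf; apply/funext => x.
by apply: (@mpderD _ _ _ openT (mi_deg a).+1).
Qed.

Lemma smooth_mpderM a b f : smooth f -> mpder (a + b) f = mpder a (mpder b f).
Proof.
move=> hf; rewrite (@smooth_mpder_ders _ (mi_seq a ++ mi_seq b)) ?ders_cat//.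
by move=> i; rewrite count_cat !count_mi_seq mindexDE.
Qed.

Lemma smooth_pderD i f g : smooth f -> smooth g ->
  pder i (fun x => f x + g x) = fun x => pder i f x + pder i g x.
Proof.
move=> hf hg; apply/funext => x; apply: is_derive_pderE.
by apply: is_derive_add; exact: smooth_is_derive.
Qed.

Lemma smooth_pderM i f g : smooth f -> smooth g ->
  pder i (fun x => f x * g x) = fun x => pder i f x * g x + f x * pder i g x.
Proof.
move=> hf hg; apply/funext => x; apply: is_derive_pderE.
by apply: is_derive_mul; exact: smooth_is_derive.
Qed.

Lemma smooth_pderZ i (c : R) f : smooth f ->
  pder i (fun x => c * f x) = fun x => c * pder i f x.
Proof.
move=> hf; apply/funext => x; rewrite (smooth_pderM i (smooth_cst c) hf).
by rewrite (is_derive_pderE (is_derive_cst c x _)) mul0r add0r.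
Qed.

Lemma smooth_pder_sum i (I : Type) (r : seq I) (P : pred I) (F : I -> 'rV[R]_n -> R) :
  (forall k, P k -> smooth (F k)) ->
  pder i (fun x => \sum_(k <- r | P k) F k x) = fun x => \sum_(k <- r | P k) pder i (F k) x.
Proof.
move=> h; apply/funext => x.
exact: (@ders_sum _ _ _ openT 1 [:: i] _ r P F x isT (fun k Pk => h k Pk 1%N)).
Qed.

Lemma smooth_mpder_sum a (I : Type) (r : seq I) (P : pred I) (F : I -> 'rV[R]_n -> R) :
  (forall k, P k -> smooth (F k)) ->
  mpder a (fun x => \sum_(k <- r | P k) F k x) = fun x => \sum_(k <- r | P k) mpder a (F k) x.
Proof.
move=> h; apply/funext => x.
exact: (@ders_sum _ _ _ openT _ (mi_seq a) _ r P F x (leqnn _) (fun k Pk => h k Pk _)).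
Qed.

Lemma smooth_mpderZ a (c : R) f : smooth f ->
  mpder a (fun x => c * f x) = fun x => c * mpder a f x.
Proof. move=> hf; apply/funext => x; exact: (dersZ openT _ (leqnn _) (hf _)). Qed.

Lemma smooth_mpderDf a f g : smooth f -> smooth g ->
  mpder a (fun x => f x + g x) = fun x => mpder a f x + mpder a g x.
Proof. by move=> hf hg; apply/funext => x; exact: (dersD openT (leqnn _) (hf _) (hg _)). Qed.

Lemma mpder_cst a (c : R) : a != 0 -> mpder a (fun=> c : R) = (fun=> 0 : R) :> ('rV[R]_n -> R).
Proof.
move=> a0; apply/funext => x; apply: (@ders_cst _ _ _ openT _ c x I).
by rewrite size_mi_seq lt0n mi_deg_eq0.
Qed.

Lemma smooth_chain_tanh i k f : smooth f ->
  pder i (fun x => mu k (f x)) = fun x => mu k.+1 (f x) * pder i f x.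
Proof.
move=> hf; apply/funext => x; apply: is_derive_pderE.
by apply: is_derive_chain; [exact: is_derive_tanh_deriv|exact: smooth_is_derive].
Qed.

End Smooth.

(** * Faa di Bruno's formula *)

Section PartitionSums.
Context {R : comPzRingType} {T : finType}.
Implicit Types (A B J : {set T}) (P : {set {set T}}) (i : T).

Lemma notin_partitionD A B P : B != finset.set0 ->
  finset.partition P (A :\: B) -> B \notin P.
Proof.
move=> B0 pP; apply/negP => /(finset.partitionS pP); rewrite subsetD => /andP[_].
by rewrite -setI_eq0 finset.setIid (negbTE B0).
Qed.

Lemma partition_block_sum A B (F : {set {set T}} -> R) :
  B != finset.set0 -> B \subset A ->
  \sum_(P | finset.partition P A && (B \in P)) F P =
  \sum_(P | finset.partition P (A :\: B)) F (B |: P).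
Proof.
move=> B0 BA.
have nB P : finset.partition P (A :\: B) -> B \notin P by exact: notin_partitionD.
rewrite (reindex_onto (fun P => B |: P) (fun P => P :\ B)); last first.
  by move=> P /andP[_ BP]; rewrite finset.setD1K.
apply: eq_bigl => P; apply/idP/idP => [/andP[/andP[pP _] /eqP <-]|pP].
  by apply: finset.partitionD1 => //; rewrite finset.setU11.
rewrite finset.setU11 andbT; apply/andP; split; last by rewrite finset.setU1K ?nB.
have -> : A = B :|: (A :\: B) by rewrite -{1}(finset.setID A B) (finset.setIidPr BA).
apply: finset.partitionU1 => //.
by rewrite -setI_eq0 finset.setDE finset.setICA finset.setICr finset.setI0.
Qed.

(** The sums of Faa di Bruno's formula: [G] stands for the derivatives of the
outer function and [H] for those of the inner function. *)
Definition partition_sum A (G : nat -> R) (H : {set T} -> R) : R :=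
  \sum_(P | finset.partition P A) G #|P| * \prod_(I in P) H I.

Lemma partition_sum_block A B G (H H' : {set T} -> R) :
  B != finset.set0 -> B \subset A ->
  \sum_(P | finset.partition P A && (B \in P)) G #|P| * (H' B * \prod_(I in P :\ B) H I) =
  H' B * partition_sum (A :\: B) (G \o succn) H.
Proof.
move=> B0 BA; rewrite partition_block_sum// /partition_sum big_distrr /=.
apply: eq_bigr => P pP; have nB := notin_partitionD B0 pP.
by rewrite cardsU1 nB add1n finset.setU1K// mulrCA.
Qed.

(** Choosing a partition of [A] and one of its blocks amounts to choosing the
block [J] and a partition of what is left. *)
Lemma partition_sum_mark A G (H H' : {set T} -> R) :
  \sum_(P | finset.partition P A) G #|P| * \sum_(J in P) H' J * \prod_(I in P :\ J) H I =
  \sum_(J : {set T} | (J != finset.set0) && (J \subset A))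
     H' J * partition_sum (A :\: J) (G \o succn) H.
Proof.
under eq_bigr do rewrite big_distrr /=.
rewrite (exchange_big_dep (fun J : {set T} => (J != finset.set0) && (J \subset A)))/=; last first.
  by move=> P J pP JP; rewrite (finset.partition_neq0 pP JP) (finset.partitionS pP JP).
apply: eq_bigr => J /andP[J0 JA].
by rewrite -partition_sum_block.
Qed.

Lemma partition_sum0 G (H : {set T} -> R) : partition_sum finset.set0 G H = G 0%N.
Proof.
rewrite /partition_sum (big_pred1 finset.set0) ?cards0 ?big_set0 ?mulr1//.
by move=> P; rewrite finset.partition_set0.
Qed.

(** The partitions of [i |: A] are classified by the block containing [i],
which is {i} or [i |: J] for a nonempty subset [J] of [A]. *)
Lemma partition_sumU1 A i G (H : {set T} -> R) : i \notin A ->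
  partition_sum (i |: A) G H =
  H [set i]%SET * partition_sum A (G \o succn) H +
  \sum_(J : {set T} | (J != finset.set0) && (J \subset A))
     H (i |: J) * partition_sum (A :\: J) (G \o succn) H.
Proof.
move=> iA.
have -> : partition_sum (i |: A) G H =
   \sum_(P | finset.partition P (i |: A)) \sum_(B in P | i \in B)
      G #|P| * (H B * \prod_(I in P :\ B) H I).
  apply: eq_bigr => P pP.
  have iP : i \in finset.cover P by rewrite (finset.cover_partition pP) finset.setU11.
  rewrite [RHS](big_pred1 (finset.pblock P i)).
    by rewrite (finset.big_setD1 (finset.pblock P i)) ?finset.pblock_mem.
  move=> B; apply/andP/eqP => [[BP iB]|->].
    by apply/esym/finset.def_pblock => //; exact: finset.partition_trivIset pP.
  by rewrite finset.pblock_mem// finset.mem_pblock.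
rewrite (exchange_big_dep (fun B : {set T} => (i \in B) && (B \subset i |: A)))/=; last first.
  by move=> P B pP /andP[BP iB]; rewrite iB (finset.partitionS pP BP).
have -> : \sum_(B : {set T} | (i \in B) && (B \subset i |: A))
   \sum_(P | finset.partition P (i |: A) && ((B \in P) && (i \in B)))
      G #|P| * (H B * \prod_(I in P :\ B) H I) =
   \sum_(B : {set T} | (i \in B) && (B \subset i |: A))
     H B * partition_sum ((i |: A) :\: B) (G \o succn) H.
  apply: eq_bigr => B /andP[iB BA]; rewrite -partition_sum_block//.
    by apply: eq_bigl => P; rewrite iB andbT.
  by apply/set0Pn; exists i.
rewrite (reindex_onto (fun J : {set T} => i |: J) (fun B : {set T} => B :\ i)); last first.
  by move=> B /andP[iB _]; rewrite finset.setD1K.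
have -> : \sum_(J : {set T} | (i \in i |: J) && (i |: J \subset i |: A) && ((i |: J) :\ i == J))
     H (i |: J) * partition_sum ((i |: A) :\: (i |: J)) (G \o succn) H =
   \sum_(J : {set T} | J \subset A) H (i |: J) * partition_sum (A :\: J) (G \o succn) H.
  apply: eq_big => [J|J /andP[/andP[_ JA] /eqP iJ]].
    rewrite finset.setU11 /=; apply/andP/idP => [[JA /eqP <-]|JA].
      apply/fintype.subsetP => x; rewrite !inE => /andP[xi]; rewrite (negbTE xi) /=.
      by move=> xJ; have /fintype.subsetP/(_ x) := JA; rewrite !inE xJ (negbTE xi) orbT; apply.
    have iJ : i \notin J by apply: contra iA; exact: (fintype.subsetP JA).
    by rewrite finset.setU1K// eqxx finset.setUS.
  have {}iJ : i \notin J by rewrite -iJ !inE eqxx.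
  congr (_ * partition_sum _ _ _); apply/finset.setP => x; rewrite !inE.
  by have [->|//] := eqVneq x i; rewrite (negbTE iA) (negbTE iJ).
rewrite (bigD1 finset.set0) ?finset.sub0set//= finset.setU0 finset.setD0; congr (_ + _).
by apply: eq_bigl => J; rewrite andbC.
Qed.

End PartitionSums.

Section FaaDiBruno.
Context {R : realType} {n : nat}.
Local Notation mu m := (derive1n m (@tanh R)).
Variables (z : 'rV[R]_n -> R) (hz : smooth z).

Lemma smooth_pder_prod i (I : finType) (P : pred I) (F : I -> 'rV[R]_n -> R) :
  (forall k, smooth (F k)) ->
  pder i (fun x => \prod_(k | P k) F k x) =
  fun x => \sum_(k | P k) pder i (F k) x * \prod_(l | P l && (l != k)) F l x.
Proof.
move=> hF; apply/funext => x.
have sm Q := @smooth_prod _ _ I (index_enum I) Q F (fun k _ => hF k).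
elim: {P}_.+1 {-2}P (ltnSn #|P|) => [//|m IH] P; rewrite ltnS => Pm.
have [k Pk|P0] := pickP P; last first.
  rewrite (_ : (fun x => _) = fun=> 1); last by apply/funext => y; rewrite big_pred0.
  by rewrite big_pred0//; apply: is_derive_pderE; exact: is_derive_cst.
rewrite (_ : (fun x => _) = fun x => F k x * \prod_(l | P l && (l != k)) F l x); last first.
  by apply/funext => y; rewrite (bigD1 k).
rewrite (smooth_pderM i (hF k) (sm _)) [RHS](bigD1 k)//=; congr (_ + _).
rewrite IH; last first.
  by apply: leq_trans Pm; rewrite [ltnRHS](cardD1 k) unfold_in Pk add1n ltnS subset_leq_card//; apply/fintype.subsetP => l; rewrite !inE andbC.
rewrite big_distrr /=; apply: eq_bigr => l /andP[Pl lk].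
rewrite mulrCA (bigD1 (P := fun l' => P l' && (l' != l)) k) /=; last by rewrite Pk eq_sym.
congr (_ * (_ * _)); apply: eq_bigl => l'.
by rewrite -!andbA; congr (_ && _); rewrite andbC.
Qed.

Variables (s : nat) (d : 'I_s -> 'I_n).

(** Directions are indexed by positions rather than by coordinates, so that
repeated directions are distinguished by a partition. *)
Definition set_ders (A : {set 'I_s}) (f : 'rV[R]_n -> R) := ders [seq d j | j <- enum A] f.

Lemma set_ders0 f : set_ders finset.set0 f = f.
Proof. by rewrite /set_ders enum_set0. Qed.

Lemma smooth_set_ders (A : {set 'I_s}) f : smooth f -> smooth (set_ders A f).
Proof. exact: smooth_ders. Qed.

Lemma set_dersU1 (A : {set 'I_s}) (i : 'I_s) f : smooth f -> i \notin A ->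
  set_ders (i |: A) f = pder (d i) (set_ders A f).
Proof.
move=> hf iA; apply/funext => x; rewrite -[RHS]/(ders (d i :: [seq d j | j <- enum A]) f x).
rewrite /set_ders; apply: (@ders_perm _ _ setT _ f _ _ openT (leqnn _) (hf _)) => //.
rewrite -map_cons; apply: perm_map; apply: uniq_perm; rewrite ?enum_uniq//=.
  by rewrite mem_enum iA enum_uniq.
by move=> j; rewrite inE !mem_enum !inE.
Qed.

(** Differentiating in a further direction [i] acts either on the derivative of
tanh, which creates the block {i}, or on the derivative of [z] attached to a
block, which adds [i] to this block.  This is the recursion [partition_sumU1],
its second sum being rewritten with [partition_sum_mark]. *)
Lemma faa_di_bruno_set (A : {set 'I_s}) x :
  set_ders A (fun x => mu 0 (z x)) x =
  partition_sum A (fun k => mu k (z x)) (fun I => set_ders I z x).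
Proof.
move: {2}#|A| (erefl #|A|) => m; elim: m A x => [|m IH] A x cA.
  have -> : A = finset.set0 by apply: cards0_eq.
  by rewrite set_ders0 partition_sum0.
have /card_gt0P[i iA] : (0 < #|A|)%N by rewrite cA.
rewrite -(finset.setD1K iA).
have iD : i \notin A :\ i by rewrite !inE eqxx.
have cD : #|A :\ i| = m by move: cA; rewrite (cardsD1 i) iA => -[].
move: (A :\ i) iD cD => {iA cA}A iA cA.
have smz k : smooth (fun x => mu k (z x)) by exact: smooth_tanh.
have smp (P : {set {set 'I_s}}) : smooth (fun x => \prod_(I in P) set_ders I z x).
  by apply: smooth_prod => I _; exact: smooth_set_ders.
rewrite (set_dersU1 (smz 0%N))// (_ : set_ders A _ = fun x => \sum_(P | finset.partition P A)
    mu #|P| (z x) * \prod_(I in P) set_ders I z x); last by apply/funext => y; exact: IH.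
rewrite smooth_pder_sum; last by move=> P _; exact: smoothM.
rewrite partition_sumU1//.
have E1 : set_ders [set i]%SET z = pder (d i) z.
  by rewrite -[[set i]%SET]finset.setU0 set_dersU1 ?inE// set_ders0.
have -> : \sum_(J : {set 'I_s} | (J != finset.set0) && (J \subset A))
   set_ders (i |: J) z x * partition_sum (A :\: J) ((fun k => mu k (z x)) \o succn) (fun I => set_ders I z x)
  = \sum_(P | finset.partition P A) mu #|P| (z x) * \sum_(J in P) set_ders (i |: J) z x
      * \prod_(I in P :\ J) set_ders I z x.
  by rewrite -(partition_sum_mark A (fun k => mu k (z x)) (fun I => set_ders I z x) (fun J => set_ders (i |: J) z x)).
rewrite E1 /partition_sum big_distrr -big_split /=; apply: eq_bigr => P pP.
rewrite (smooth_pderM _ (smz _) (smp _)) smooth_chain_tanh//.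
rewrite [in RHS]mulrCA [in RHS]mulrA; congr (_ + _).
congr (_ * _); rewrite smooth_pder_prod; last by move=> I; exact: smooth_set_ders.
apply: eq_bigr => J JP.
have iJ : i \notin J by apply: contra iA; exact: (fintype.subsetP (finset.partitionS pP JP)).
rewrite set_dersU1//; congr (_ * _); apply: eq_bigl => I; by rewrite !inE andbC.
Qed.

End FaaDiBruno.

Section FaaDiBrunoMultiIndex.
Context {R : realType} {n : nat}.
Local Notation mu m := (derive1n m (@tanh R)).

Lemma mi_seq_block (a : mindex n) (I : {set 'I_(size (mi_seq a))}) :
  perm_eq (mi_seq (block_mi I)) [seq tnth (in_tuple (mi_seq a)) j | j <- enum I].
Proof.
apply: mi_seq_sum_unit; rewrite /block_mi big_map.
by rewrite -big_enum.
Qed.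

Lemma size_mi_seq_block (a : mindex n) (I : {set 'I_(size (mi_seq a))}) :
  size (mi_seq (block_mi I)) = #|I|.
Proof. by rewrite (perm_size (mi_seq_block I)) size_map cardE. Qed.

Lemma mpder_block (f : 'rV[R]_n -> R) (a : mindex n) (I : {set 'I_(size (mi_seq a))}) :
  smooth f -> mpder (block_mi I) f = set_ders (tnth (in_tuple (mi_seq a))) I f.
Proof.
move=> hf; apply/funext => x.
exact: (ders_perm openT (leqnn _) (hf _) (mi_seq_block I)).
Qed.

Lemma block_mi_setT (a : mindex n) : block_mi [set: 'I_(size (mi_seq a))]%SET = a.
Proof.
apply/ffunP => i; rewrite -[in RHS]count_mi_seq -[LHS]count_mi_seq.
rewrite (permP (mi_seq_block _)) enum_setT -enumT /=.
by have := map_tnth_enum (in_tuple (mi_seq a)); move=> ->.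
Qed.

Theorem faa_di_bruno (z : 'rV[R]_n -> R) (a : mindex n) (x : 'rV[R]_n) : smooth z ->
  mpder a (fun x => tanh (z x)) x =
  \sum_(P | finset.partition P [set: 'I_(size (mi_seq a))]%SET)
    mu #|P| (z x) * \prod_(I in P) mpder (block_mi I) z x.
Proof.
move=> hz; rewrite -[in LHS](block_mi_setT a) mpder_block; last exact: (smooth_tanh 0 hz).
rewrite faa_di_bruno_set//; apply: eq_bigr => P _; congr (_ * _).
by apply: eq_bigr => I _; rewrite mpder_block.
Qed.

End FaaDiBrunoMultiIndex.

(** * Soundness of the network bounds *)

Section Perturbation.
Context {R : realDomainType}.
Implicit Types (u v p q : R).

(** Expand u v around u0 v0 and bound each term; all summands of [Blayer] have
this shape. *)
Lemma mul_perturbation u u0 v v0 q p : `|u - u0| <= q -> `|v - v0| <= p ->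
  `|u * v - u0 * v0| <= (`|u0| + q) * (`|v0| + p) - `|u0 * v0|.
Proof.
move=> hu hv.
have -> : u * v - u0 * v0 = (u - u0) * (v - v0) + (u - u0) * v0 + u0 * (v - v0) by ring.
have -> : (`|u0| + q) * (`|v0| + p) - `|u0 * v0| = q * p + q * `|v0| + `|u0| * p.
  by rewrite normrM; ring.
rewrite (le_trans (ler_normD _ _))// lerD//.
  rewrite (le_trans (ler_normD _ _))// lerD// normrM; first exact: ler_pM.
  by rewrite ler_wpM2r.
by rewrite normrM ler_wpM2l.
Qed.

Lemma prod_perturbation (I : Type) (r : seq I) (P : pred I) (F F0 p : I -> R) :
  (forall k, P k -> `|F k - F0 k| <= p k) ->
  `|\prod_(k <- r | P k) F k - \prod_(k <- r | P k) F0 k| <=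
    \prod_(k <- r | P k) (`|F0 k| + p k) - `|\prod_(k <- r | P k) F0 k|.
Proof.
move=> h; elim: r => [|k r IH]; first by rewrite !big_nil subrr normr0 normr1 subrr.
rewrite !big_cons; case: ifP => // Pk.
have := mul_perturbation (h k Pk) IH.
set A := \prod_(j <- r | P j) F j; set B := \prod_(j <- r | P j) F0 j.
set D := \prod_(j <- r | P j) (_ + _).
by rewrite (addrC `|B|) subrK.
Qed.

End Perturbation.

Lemma abs_mxE (R : realType) m n (A : 'M[R]_(m, n)) i j : abs_mx A i j = `|A i j|.
Proof. by rewrite mxE. Qed.

Section Network.
Context {R : realType} {n w L : nat} (f : network R n w L).
Local Notation mu m := (derive1n m (@tanh R)).

Definition preact_entry (k : nat) (i : 'I_w) (x : 'rV[R]_n) : R := preact f k x i 0.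
Local Notation Z := preact_entry.

Lemma preact_entry1 i : Z 1 i = fun x => \sum_j net_W1 f i j * x 0 j + net_b1 f i 0.
Proof.
apply/funext => x; rewrite /Z /= !mxE; congr (_ + _).
by apply: eq_bigr => j _; rewrite mxE.
Qed.

Lemma preact_entryS k i :
  Z k.+2 i = fun x => \sum_j net_Wh f k.+2 i j * mu 0 (Z k.+1 j x) + net_bh f k.+2 i 0.
Proof.
apply/funext => x; rewrite /Z.
rewrite -[preact f k.+2 x]/(net_Wh f k.+2 *m map_mx tanh (preact f k.+1 x) + net_bh f k.+2).
by rewrite !mxE; congr (_ + _); apply: eq_bigr => j _; rewrite mxE.
Qed.

Lemma net_funE : net_fun f = fun x => \sum_j net_Wo f 0 j * mu 0 (Z L j x) + net_bo f.
Proof.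
apply/funext => x; rewrite /net_fun mxE; congr (_ + _).
by apply: eq_bigr => j _; rewrite mxE.
Qed.

Lemma smooth_preact k i : smooth (Z k i).
Proof.
elim: k i => [|[|k] IH] i.
- rewrite (_ : Z 0 i = fun=> 0); first exact: smooth_cst.
  by apply/funext => x; rewrite /Z mxE.
- rewrite preact_entry1; apply: smoothD; last exact: smooth_cst.
  by apply: smooth_sum => j _; apply: smoothZ; exact: smooth_coord.
- rewrite preact_entryS; apply: smoothD; last exact: smooth_cst.
  by apply: smooth_sum => j _; apply: smoothZ; apply: smooth_tanh; exact: IH.
Qed.

Lemma smooth_net : smooth (net_fun f).
Proof.
rewrite net_funE; apply: smoothD; last exact: smooth_cst.
by apply: smooth_sum => j _; apply: smoothZ; apply: smooth_tanh; exact: smooth_preact.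
Qed.

Lemma pder_preact1 i l : pder l (Z 1 i) = fun=> net_W1 f i l.
Proof.
rewrite preact_entry1; apply/funext => x; apply: is_derive_pderE.
rewrite -[X in is_derive _ _ _ X]addr0.
apply: is_derive_add.
have sm j : smooth (fun x : 'rV[R]_n => net_W1 f i j * x 0 j).
  by apply: smoothZ; exact: smooth_coord.
have := smooth_is_derive l x (@smooth_sum _ _ _ (index_enum 'I_n) xpredT (fun j (x : 'rV[R]_n) => net_W1 f i j * x 0 j) (fun j _ => sm j)).
rewrite smooth_pder_sum//.
rewrite (bigD1 l)//= big1 ?addr0.
  rewrite smooth_pderZ; last exact: smooth_coord.
  by rewrite (is_derive_pderE (is_derive_coord x l l)) eqxx mulr1.
move=> j jl; rewrite smooth_pderZ; last exact: smooth_coord.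
by rewrite (is_derive_pderE (is_derive_coord x l j)) (negbTE jl) mulr0.
Qed.

Lemma mindex_neq0P (a : mindex n) : a != 0 -> exists b i, a = b + unit_mi i.
Proof.
by move: a; apply: mindex_ind => [|a i _ _]; [rewrite eqxx|exists a, i].
Qed.

(** The first layer is affine; this is why the recursion for the bounds starts
from 0. *)
Lemma mpder_preact1 a i : a != 0 -> exists c : R, mpder a (Z 1 i) = fun=> c.
Proof.
move=> /mindex_neq0P[b [l ->]].
rewrite (smooth_mpderM _ _ (@smooth_preact 1 i)) mpder_unit pder_preact1.
have [->|b0] := eqVneq b 0; first by rewrite mpder0; eexists.
by rewrite mpder_cst//; exists 0.
Qed.

(** The pre-activations of the next layer and the output of the network are
both of this form, so that one estimate serves the induction and its conclusion. *)
Definition unit_sum (c : 'I_w -> R) (b : R) (k : nat) (x : 'rV[R]_n) : R :=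
  \sum_j c j * mu 0 (Z k j x) + b.

Lemma mpder_unit_sum c b k a : a != 0 ->
  mpder a (unit_sum c b k) = fun x => \sum_j c j * mpder a (fun x => mu 0 (Z k j x)) x.
Proof.
move=> a0.
have sm j : smooth (fun x => mu 0 (Z k j x)) by apply: smooth_tanh; exact: smooth_preact.
have sm2 j : smooth (fun x => c j * mu 0 (Z k j x)) by exact: smoothZ.
rewrite smooth_mpderDf; [|exact: smooth_sum|exact: smooth_cst].
rewrite smooth_mpder_sum// mpder_cst//; apply/funext => x; rewrite addr0.
by apply: eq_bigr => j _; rewrite smooth_mpderZ.
Qed.

Lemma unit_mi_neq0 (l : 'I_n) : unit_mi l != 0.
Proof. by rewrite -mi_deg_eq0 mi_deg_unit. Qed.

Lemma pder_unit_sum c b k l :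
  pder l (unit_sum c b k) = fun x => \sum_j c j * (mu 1 (Z k j x) * pder l (Z k j) x).
Proof.
rewrite -mpder_unit mpder_unit_sum ?unit_mi_neq0//; apply/funext => x.
apply: eq_bigr => j _; rewrite mpder_unit smooth_chain_tanh//; exact: smooth_preact.
Qed.

Section Soundness.
Variables (N : nat -> nat) (y eps : 'rV[R]_n) (eps0 : nonneg_rV eps).
Local Notation inbox x := (box y eps x).

Lemma box_center : inbox y.
Proof. by move=> j; rewrite subrr normr0. Qed.

Definition box_side (j : 'I_n) : set R := [set t | `|t - y 0 j| <= eps 0 j].

Lemma box_side_interval j : is_interval (box_side j).
Proof.
move=> s t; rewrite /box_side /= !ler_norml => /andP[s1 s2] /andP[t1 t2] u /andP[u1 u2].
by rewrite ler_norml; apply/andP; split; lra.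
Qed.

Lemma dmuE m k j : dmu f y m k j 0 = mu m (Z k j y).
Proof. by rewrite mxE. Qed.

Section Layer.
Variables (k : nat) (P : 'M[R]_(w, n)).
Hypothesis (jacE : forall j l, pder l (Z k j) y = jac f y k j l).
Hypothesis (soundP : forall j l x, inbox x -> `|pder l (Z k j) x - jac f y k j l| <= P j l).

(** The entry of [Qlayer]'s radius bounds the variation of the
pre-activation over the box, by [rect_lipschitz]. *)
Lemma layer_radius j x : inbox x ->
  `|Z k j x - Z k j y| <= ((abs_mx (jac f y k) + P) *m eps^T) j 0.
Proof.
move=> bx.
have := @rect_lipschitz R n box_side box_side_interval (Z k j)
  (fun l => `|jac f y k j l| + P j l) y x.
move=> h; apply: (le_trans (h _ _ box_center bx)).
- by move=> z q _; apply: smooth_derivable; exact: smooth_preact.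
- move=> z q bz; have := soundP j q bz => hz.
  rewrite -[pder q _ _](subrK (jac f y k j q)) (le_trans (ler_normD _ _))//.
  by rewrite addrC lerD2l.
rewrite mxE; apply: ler_sum => l _; rewrite !mxE ler_wpM2l//.
by rewrite addr_ge0// (le_trans _ (soundP j l box_center)).
Qed.

Lemma layer_Q m j x : inbox x ->
  `|mu m (Z k j x) - dmu f y m k j 0| <= Qlayer f N y eps m k P j 0.
Proof.
move=> bx; rewrite dmuE /Qlayer /Qval mxE.
have := tanh_deriv_taylor m (N m) (layer_radius j bx).
move/le_trans; apply; rewrite le_eqVlt; apply/orP; left; apply/eqP.
by congr (_ + _); apply: eq_bigr => i _; rewrite dmuE.
Qed.

Lemma layer_B1 j l x : inbox x ->
  `|mu 1 (Z k j x) * pder l (Z k j) x - dmu f y 1 k j 0 * jac f y k j l| <=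
    Blayer1 f N y eps k P j l.
Proof.
move=> bx; have := mul_perturbation (layer_Q 1 j bx) (soundP j l bx).
by rewrite /Blayer1 !mxE.
Qed.

Lemma layer_next1 c b l x : inbox x ->
  `|pder l (unit_sum c b k) x - \sum_j c j * (dmu f y 1 k j 0 * jac f y k j l)| <=
    \sum_j `|c j| * Blayer1 f N y eps k P j l.
Proof.
move=> bx; rewrite pder_unit_sum -sumrB (le_trans (ler_norm_sum _ _ _))//.
apply: ler_sum => j _; rewrite -mulrBr normrM ler_wpM2l//.
exact: layer_B1.
Qed.

End Layer.

Lemma jacSS k : jac f y k.+2 = net_Wh f k.+2 *m had_col (dmu f y 1 k.+1) (jac f y k.+1).
Proof. by []. Qed.

Lemma Player1SS k : Player1 f N y eps k.+2 =
  abs_mx (net_Wh f k.+2) *m Blayer1 f N y eps k.+1 (Player1 f N y eps k.+1).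
Proof. by []. Qed.

Lemma PlayerSS k a : (forall l, mi_seq a <> [:: l]) -> Player f N y eps k.+2 a =
  abs_mx (net_Wh f k.+2) *m Blayer f N y eps k.+1 (Player f N y eps k.+1) a.
Proof.
move=> na; rewrite -[LHS]/(if mi_seq a is [:: l] then col l (Player1 f N y eps k.+2)
  else abs_mx (net_Wh f k.+2) *m Blayer f N y eps k.+1 (Player f N y eps k.+1) a).
by case: (mi_seq a) na => [//|l [/(_ l)//|? ?]].
Qed.

Lemma Player_unit k l : Player f N y eps k.+1 (unit_mi l) = col l (Player1 f N y eps k.+1).
Proof.
rewrite -[LHS]/(if mi_seq (unit_mi l) is [:: l'] then col l' (Player1 f N y eps k.+1)
  else if k is _.+1 then abs_mx (net_Wh f k.+1) *m Blayer f N y eps k (Player f N y eps k) (unit_mi l) else 0).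
by rewrite mi_seq_unit.
Qed.

Lemma jac_pder k j l : pder l (Z k.+1 j) y = jac f y k.+1 j l.
Proof.
elim: k j l => [|k IH] j l; first by rewrite pder_preact1.
have -> : Z k.+2 j = unit_sum (net_Wh f k.+2 j) (net_bh f k.+2 j 0) k.+1.
  by rewrite preact_entryS.
rewrite pder_unit_sum jacSS mxE.
by apply: eq_bigr => i _; rewrite mxE dmuE IH.
Qed.

Lemma Player1_sound k j l x : inbox x ->
  `|pder l (Z k.+1 j) x - jac f y k.+1 j l| <= Player1 f N y eps k.+1 j l.
Proof.
elim: k j l x => [|k IH] j l x bx.
  by rewrite pder_preact1 /= subrr normr0 mxE.
have -> : Z k.+2 j = unit_sum (net_Wh f k.+2 j) (net_bh f k.+2 j 0) k.+1.
  by rewrite preact_entryS.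
have H := layer_next1 IH (net_Wh f k.+2 j) (net_bh f k.+2 j 0) l bx.
rewrite jacSS Player1SS !mxE.
under [X in _ - X]eq_bigr do rewrite mxE.
by apply: (le_trans H); apply: ler_sum => i _; rewrite abs_mxE.
Qed.

Lemma block_mi_neq0 (a : mindex n) (pi : {set {set 'I_(size (mi_seq a))}}) I :
  finset.partition pi [set: 'I_(size (mi_seq a))]%SET -> I \in pi -> block_mi I != 0.
Proof.
move=> ppi Ipi; rewrite -mi_deg_eq0 -size_mi_seq size_mi_seq_block -lt0n card_gt0.
exact: (finset.partition_neq0 ppi Ipi).
Qed.

(** The formula of Faa di Bruno at [x] and at [y], compared summand by summand:
the factor tanh^(m) varies by at most Q and the inner derivatives by at most [Pk]. *)
Lemma layer_B k (Pk : mindex n -> 'cV[R]_w) a j x : inbox x ->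
  (forall b j, b != 0 -> `|mpder b (Z k.+1 j) x - mpder b (Z k.+1 j) y| <= Pk b j 0) ->
  `|mpder a (fun x => mu 0 (Z k.+1 j x)) x - mpder a (fun x => mu 0 (Z k.+1 j x)) y| <=
    Blayer f N y eps k.+1 Pk a j 0.
Proof.
move=> bx hP; have sm := @smooth_preact k.+1 j.
rewrite !(@faa_di_bruno R n (Z k.+1 j))// -sumrB (le_trans (ler_norm_sum _ _ _))//.
rewrite /Blayer summxE; apply: ler_sum => pi ppi; rewrite [leRHS]mxE.
have hQ := layer_Q (@Player1_sound k) #|pi| j bx.
have hpr := @prod_perturbation R _ (index_enum {set 'I_(size (mi_seq a))})
  (fun I => I \in pi) (fun I => mpder (block_mi I) (Z k.+1 j) x)
  (fun I => mpder (block_mi I) (Z k.+1 j) y) (fun I => Pk (block_mi I) j 0).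
have {}hpr := hpr (fun I Ipi => hP _ j (block_mi_neq0 ppi Ipi)).
have := mul_perturbation hQ hpr.
rewrite (addrC `|\prod_(I in pi) _|) subrK dmuE.
have E I : preact_der f y k.+1 (block_mi I) j 0 = mpder (block_mi I) (Z k.+1 j) y.
  by rewrite mxE.
move/le_trans; apply; rewrite le_eqVlt; apply/orP; left; apply/eqP.
by congr (_ * _ - `|_ * _|); apply: eq_bigr => I _; rewrite E.
Qed.

Lemma layer_next k (Pk : mindex n -> 'cV[R]_w) c b a x : a != 0 -> inbox x ->
  (forall b j, b != 0 -> `|mpder b (Z k.+1 j) x - mpder b (Z k.+1 j) y| <= Pk b j 0) ->
  `|mpder a (unit_sum c b k.+1) x - mpder a (unit_sum c b k.+1) y| <=
    \sum_j `|c j| * Blayer f N y eps k.+1 Pk a j 0.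
Proof.
move=> a0 bx hP; rewrite !mpder_unit_sum// -sumrB (le_trans (ler_norm_sum _ _ _))//.
apply: ler_sum => j _; rewrite -mulrBr normrM ler_wpM2l//.
exact: layer_B.
Qed.

Lemma Player_sound k a j x : a != 0 -> inbox x ->
  `|mpder a (Z k.+1 j) x - mpder a (Z k.+1 j) y| <= Player f N y eps k.+1 a j 0.
Proof.
move=> + bx; elim: k a j => [|k IH] a j a0.
  have [c ->] := mpder_preact1 j a0; rewrite subrr normr0 /=.
  by case: (mi_seq a) => [|l [|? ?]]; rewrite !mxE.
have [[l al]|na] : (exists l, mi_seq a = [:: l]) \/ forall l, mi_seq a <> [:: l].
  by case: (mi_seq a) => [|l [|? ?]]; [right|left; exists l|right].
  have E := mi_seq1 al; rewrite E !mpder_unit jac_pder.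
  have -> : Player f N y eps k.+2 (unit_mi l) j 0 = Player1 f N y eps k.+2 j l.
    by rewrite Player_unit mxE.
  exact: Player1_sound.
rewrite PlayerSS//.
have -> : Z k.+2 j = unit_sum (net_Wh f k.+2 j) (net_bh f k.+2 j 0) k.+1.
  by rewrite preact_entryS.
have := @layer_next k _ (net_Wh f k.+2 j) (net_bh f k.+2 j 0) a x a0 bx IH.
move/le_trans; apply; rewrite mxE le_eqVlt; apply/orP; left; apply/eqP.
by apply: eq_bigr => i _; rewrite abs_mxE.
Qed.

Lemma jac_pder_pos k j l : (0 < k)%N -> pder l (Z k j) y = jac f y k j l.
Proof. by case: k => // k _; exact: jac_pder. Qed.

Lemma Player1_sound_pos k j l x : (0 < k)%N -> inbox x ->
  `|pder l (Z k j) x - jac f y k j l| <= Player1 f N y eps k j l.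
Proof. by case: k => // k _; exact: Player1_sound. Qed.

Lemma layer_next_pos k c b a x : (0 < k)%N -> a != 0 -> inbox x ->
  `|mpder a (unit_sum c b k) x - mpder a (unit_sum c b k) y| <=
    \sum_j `|c j| * Blayer f N y eps k (Player f N y eps k) a j 0.
Proof.
case: k => // k _ a0 bx; apply: layer_next => // b' j b0; exact: Player_sound.
Qed.

(** The output layer is one more [unit_sum], with the bounds on the last
hidden layer already proved. *)
Theorem ALG_sound a x : (0 < L)%N -> a != 0 -> inbox x ->
  `|mpder a (net_fun f) x - mpder a (net_fun f) y| <= ALG f N y eps a.
Proof.
move=> L0 a0 bx; rewrite /ALG.
have -> : net_fun f = unit_sum (net_Wo f 0) (net_bo f) L by rewrite net_funE.
have [[l al]|na] : (exists l, mi_seq a = [:: l]) \/ forall l, mi_seq a <> [:: l].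
  by case: (mi_seq a) => [|l [|? ?]]; [right|left; exists l|right].
  rewrite al (mi_seq1 al) !mpder_unit.
  have := layer_next1 (fun j l x => @Player1_sound_pos L j l x L0) (net_Wo f 0) (net_bo f) l bx.
  rewrite [X in _ - X](_ : _ = pder l (unit_sum (net_Wo f 0) (net_bo f) L) y); last first.
    by rewrite pder_unit_sum; apply: eq_bigr => j _; rewrite dmuE jac_pder_pos.
  move/le_trans; apply; rewrite mxE le_eqVlt; apply/orP; left; apply/eqP.
  by apply: eq_bigr => i _; rewrite abs_mxE.
have -> : (if mi_seq a is [:: l] then (abs_mx (net_Wo f) *m Blayer1 f N y eps L (Player1 f N y eps L)) 0 l
  else (abs_mx (net_Wo f) *m Blayer f N y eps L (Player f N y eps L) a) 0 0) =
   (abs_mx (net_Wo f) *m Blayer f N y eps L (Player f N y eps L) a) 0 0.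
  by move: na; case: (mi_seq a) => [//|l [|? ?]//] /(_ l).
have := layer_next_pos (net_Wo f 0) (net_bo f) L0 a0 bx.
move/le_trans; apply; rewrite mxE le_eqVlt; apply/orP; left; apply/eqP.
by apply: eq_bigr => i _; rewrite abs_mxE.
Qed.

Lemma ALG_ge0 a : (0 < L)%N -> a != 0 -> 0 <= ALG f N y eps a.
Proof. by move=> L0 a0; rewrite (le_trans _ (ALG_sound L0 a0 box_center)). Qed.

(** For positive order this is [ALG_sound] and the triangle inequality; the
value of the network itself is controlled by its first derivatives on the box. *)
Lemma Ebound_sound a x : (0 < L)%N -> inbox x ->
  `|mpder a (net_fun f) x| <= Ebound f N y eps a.
Proof.
move=> L0 bx; rewrite /Ebound.
have key b : b != 0 -> forall z, inbox z ->
    `|mpder b (net_fun f) z| <= `|mpder b (net_fun f) y| + ALG f N y eps b.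
  move=> b0 z bz; rewrite -[mpder b _ z](subrK (mpder b (net_fun f) y)).
  by rewrite (le_trans (ler_normD _ _))// addrC lerD2l ALG_sound.
case: eqP => [->|/eqP/key]; last exact.
rewrite mpder0 -[net_fun f x](subrK (net_fun f y)).
rewrite (le_trans (ler_normD _ _))// addrC lerD2l.
have := @rect_lipschitz R n box_side box_side_interval (net_fun f)
  (fun l => `|mpder (unit_mi l) (net_fun f) y| + ALG f N y eps (unit_mi l)) y x.
move=> h; apply: (le_trans (h _ _ box_center bx)).
- by move=> z q _; apply: smooth_derivable; exact: smooth_net.
- by move=> z q bz; rewrite -mpder_unit; apply: key => //; exact: unit_mi_neq0.
apply: ler_sum => l _; rewrite mulrC ler_wpM2r//.
by rewrite addr_ge0// ALG_ge0// unit_mi_neq0.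
Qed.

Lemma Ebound_ge0 a : (0 < L)%N -> 0 <= Ebound f N y eps a.
Proof. by move=> L0; rewrite (le_trans _ (Ebound_sound a L0 box_center)). Qed.

(** Justifies the definition of [Dz] at the multi-index 0. *)
Lemma net_lipschitz x : (0 < L)%N -> inbox x ->
  `|net_fun f x - net_fun f y| <= \sum_j eps 0 j * Ebound f N y eps (unit_mi j).
Proof.
move=> L0 bx.
have := @rect_lipschitz R n box_side box_side_interval (net_fun f)
  (fun l => Ebound f N y eps (unit_mi l)) y x.
move=> h; apply: (le_trans (h _ _ box_center bx)).
- by move=> z q _; apply: smooth_derivable; exact: smooth_net.
- by move=> z q bz; rewrite -mpder_unit; exact: Ebound_sound.
by apply: ler_sum => l _; rewrite mulrC ler_wpM2r// Ebound_ge0.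
Qed.

End Soundness.
End Network.

(** * Uniform boundedness of the network bounds *)

Section Bounded.
Context {R : realDomainType} {Y : Type} (S : Y -> Prop).
Implicit Types (F G : Y -> R).

(** Mostly used with [S] the set of pairs of a mesh and one of its cell centres, so
that [M] does not depend on the mesh. *)
Definition bnd F := exists M, forall t, S t -> `|F t| <= M.

Lemma bnd_ext F G : (forall t, S t -> F t = G t) -> bnd F -> bnd G.
Proof. by move=> h [M hM]; exists M => t St; rewrite -h//; exact: hM. Qed.

Lemma bnd_cst c : bnd (fun=> c).
Proof. by exists `|c|. Qed.

Lemma bndD F G : bnd F -> bnd G -> bnd (fun t => F t + G t).
Proof.
move=> [M hM] [M' hM']; exists (M + M') => t St.
by rewrite (le_trans (ler_normD _ _))// lerD ?hM ?hM'.
Qed.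

Lemma bndN F : bnd F -> bnd (fun t => - F t).
Proof. by move=> [M hM]; exists M => t St; rewrite normrN hM. Qed.

Lemma bndB F G : bnd F -> bnd G -> bnd (fun t => F t - G t).
Proof. by move=> hF hG; apply: bndD => //; exact: bndN. Qed.

Lemma bndM F G : bnd F -> bnd G -> bnd (fun t => F t * G t).
Proof.
move=> [M hM] [M' hM']; exists (M * M') => t St.
by rewrite normrM ler_pM ?hM ?hM'.
Qed.

Lemma bnd_norm F : bnd F -> bnd (fun t => `|F t|).
Proof. by move=> [M hM]; exists M => t St; rewrite normr_id hM. Qed.

Lemma bndX F m : bnd F -> bnd (fun t => F t ^+ m).
Proof.
move=> hF; elim: m => [|m IH]; first exact: bnd_cst.
by apply: (bnd_ext _ (bndM hF IH)) => t _; rewrite exprS.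
Qed.

Lemma bnd_sum (I : Type) (r : seq I) (P : pred I) (F : I -> Y -> R) :
  (forall k, P k -> bnd (F k)) -> bnd (fun t => \sum_(k <- r | P k) F k t).
Proof.
move=> h; elim: r => [|k r IH].
  by apply: (bnd_ext _ (bnd_cst 0)) => t _; rewrite big_nil.
have [Pk|nPk] := boolP (P k).
  by apply: (bnd_ext _ (bndD (h k Pk) IH)) => t _; rewrite big_cons Pk.
by apply: (bnd_ext _ IH) => t _; rewrite big_cons (negbTE nPk).
Qed.

Lemma bnd_prod (I : Type) (r : seq I) (P : pred I) (F : I -> Y -> R) :
  (forall k, P k -> bnd (F k)) -> bnd (fun t => \prod_(k <- r | P k) F k t).
Proof.
move=> h; elim: r => [|k r IH].
  by apply: (bnd_ext _ (bnd_cst 1)) => t _; rewrite big_nil.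
have [Pk|nPk] := boolP (P k).
  by apply: (bnd_ext _ (bndM (h k Pk) IH)) => t _; rewrite big_cons Pk.
by apply: (bnd_ext _ IH) => t _; rewrite big_cons (negbTE nPk).
Qed.

End Bounded.

Section BoundedNetwork.
Context {R : realType} {n w L : nat} (f : network R n w L) (N : nat -> nat).
Context {Y : Type} (S : Y -> Prop).
Variables (yy ee : Y -> 'rV[R]_n).
Hypothesis ee_bnd : forall j, bnd S (fun t => ee t 0 j).
Local Notation bnd := (bnd S).
Local Notation mu m := (derive1n m (@tanh R)).
Local Notation Z := (preact_entry f).

Lemma bnd_mu m (F : Y -> R) : bnd (fun t => mu m (F t)).
Proof. by have [C hC] := @tanh_deriv_bounded R m; exists C => t _; exact: hC. Qed.

Lemma bnd_dmu m k j : bnd (fun t => dmu f (yy t) m k j 0).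
Proof. by apply: (bnd_ext _ (bnd_mu m (fun t => Z k j (yy t)))) => t _; rewrite mxE. Qed.

Lemma bnd_jac k i l : bnd (fun t => jac f (yy t) k i l).
Proof.
elim: k i l => [|[|k] IH] i l.
- by apply: (bnd_ext _ (bnd_cst S 0)) => t _; rewrite /= mxE.
- exact: bnd_cst.
apply: (bnd_ext (F := fun t => \sum_j net_Wh f k.+2 i j * (dmu f (yy t) 1 k.+1 j 0 * jac f (yy t) k.+1 j l))).
  by move=> t _; rewrite jacSS mxE; apply: eq_bigr => j _; rewrite [had_col _ _ _ _]mxE.
apply: bnd_sum => j _; apply: bndM; first exact: bnd_cst.
by apply: bndM; [exact: bnd_dmu|exact: IH].
Qed.

(** Derivatives of tanh are bounded on the line and the exponent is at most 0,
so that only the radii need to be bounded. *)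
Lemma bnd_Qlayer m k (P : Y -> 'M[R]_(w, n)) j :
  (forall i l, bnd (fun t => P t i l)) ->
  bnd (fun t => Qlayer f N (yy t) (ee t) m k (P t) j 0).
Proof.
move=> hP.
pose rho t := ((abs_mx (jac f (yy t) k) + P t) *m (ee t)^T) j 0.
have hrho : bnd rho.
  apply: (bnd_ext (F := fun t => \sum_l (`|jac f (yy t) k j l| + P t j l) * ee t 0 l)).
    by move=> t _; rewrite /rho mxE; apply: eq_bigr => l _; rewrite !mxE.
  apply: bnd_sum => l _; apply: bndM => //; apply: bndD => //.
  by apply: bnd_norm; exact: bnd_jac.
apply: (bnd_ext (F := fun t =>
  \sum_(1 <= i < (N m).+1) rho t ^+ i / i`!%:R * `|dmu f (yy t) (m + i) k j 0|
  + rho t ^+ (N m).+1 * ((m + N m + 1)`!%:R / (N m + 1)`!%:R * 2 ^+ (m + N m + 2))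
    * expR (- 2 * Num.max 0 (`|preact f k (yy t) j 0| - rho t)))).
  by move=> t _; rewrite /Qlayer /Qval mxE.
apply: bndD.
  apply: bnd_sum => i _; apply: bndM; last by apply: bnd_norm; exact: bnd_dmu.
  by apply: bndM; [exact: bndX|exact: bnd_cst].
apply: bndM; first by apply: bndM; [exact: bndX|exact: bnd_cst].
exists 1 => t _; rewrite ger0_norm ?expR_ge0// -expR0 ler_expR mulNr oppr_le0.
by rewrite mulr_ge0// le_max lexx.
Qed.

Lemma bnd_Blayer1 k (P : Y -> 'M[R]_(w, n)) j l :
  (forall i l, bnd (fun t => P t i l)) ->
  bnd (fun t => Blayer1 f N (yy t) (ee t) k (P t) j l).
Proof.
move=> hP.
apply: (bnd_ext (F := fun t => (`|dmu f (yy t) 1 k j 0| + Qlayer f N (yy t) (ee t) 1 k (P t) j 0)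
  * (`|jac f (yy t) k j l| + P t j l) - `|dmu f (yy t) 1 k j 0 * jac f (yy t) k j l|)).
  by move=> t _; rewrite /Blayer1 !mxE.
apply: bndB.
  apply: bndM; apply: bndD => //.
  - by apply: bnd_norm; exact: bnd_dmu.
  - exact: bnd_Qlayer.
  - by apply: bnd_norm; exact: bnd_jac.
by apply: bnd_norm; apply: bndM; [exact: bnd_dmu|exact: bnd_jac].
Qed.

Lemma bnd_Player1 k i l : bnd (fun t => Player1 f N (yy t) (ee t) k i l).
Proof.
elim: k i l => [|[|k] IH] i l.
- by apply: (bnd_ext _ (bnd_cst S 0)) => t _; rewrite /= mxE.
- by apply: (bnd_ext _ (bnd_cst S 0)) => t _; rewrite /= mxE.
apply: (bnd_ext (F := fun t => \sum_j `|net_Wh f k.+2 i j| *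
    Blayer1 f N (yy t) (ee t) k.+1 (Player1 f N (yy t) (ee t) k.+1) j l)).
  by move=> t _; rewrite Player1SS mxE; apply: eq_bigr => j _; rewrite abs_mxE.
by apply: bnd_sum => j _; apply: bndM; [exact: bnd_cst|exact: bnd_Blayer1].
Qed.

Lemma bnd_mpder_tanh k a j :
  (forall b j, b != 0 -> bnd (fun t => mpder b (Z k j) (yy t))) ->
  bnd (fun t => mpder a (fun x => mu 0 (Z k j x)) (yy t)).
Proof.
move=> h.
apply: (bnd_ext (F := fun t =>
   \sum_(P | finset.partition P [set: 'I_(size (mi_seq a))]%SET)
    mu #|P| (Z k j (yy t)) * \prod_(I in P) mpder (block_mi I) (Z k j) (yy t))).
  by move=> t _; rewrite -(@faa_di_bruno R n (Z k j))//; exact: smooth_preact.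
apply: bnd_sum => P pP; apply: bndM; first exact: bnd_mu.
by apply: bnd_prod => I IP; apply: h; exact: block_mi_neq0 IP.
Qed.

Lemma bnd_mpder_preact k a j : a != 0 -> bnd (fun t => mpder a (Z k.+1 j) (yy t)).
Proof.
elim: k a j => [|k IH] a j a0.
  by have [c ->] := mpder_preact1 f j a0; exact: bnd_cst.
have -> : Z k.+2 j = unit_sum f (net_Wh f k.+2 j) (net_bh f k.+2 j 0) k.+1.
  by rewrite preact_entryS.
rewrite mpder_unit_sum//; apply: bnd_sum => i _; apply: bndM; first exact: bnd_cst.
exact: bnd_mpder_tanh.
Qed.

Lemma bnd_Blayer k (Pk : Y -> mindex n -> 'cV[R]_w) a j :
  (forall b i, b != 0 -> bnd (fun t => Pk t b i 0)) ->
  bnd (fun t => Blayer f N (yy t) (ee t) k.+1 (Pk t) a j 0).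
Proof.
move=> hP.
apply: (bnd_ext (F := fun t => \sum_(pi : {set {set 'I_(size (mi_seq a))}}
           | finset.partition pi [set: 'I_(size (mi_seq a))]%SET)
   ((`|dmu f (yy t) #|pi| k.+1 j 0| + Qlayer f N (yy t) (ee t) #|pi| k.+1 (Player1 f N (yy t) (ee t) k.+1) j 0)
            * \prod_(I in pi)
                (`|mpder (block_mi I) (Z k.+1 j) (yy t)| + Pk t (block_mi I) j 0)
            - `|dmu f (yy t) #|pi| k.+1 j 0
                * \prod_(I in pi) mpder (block_mi I) (Z k.+1 j) (yy t)|))).
  move=> t _; rewrite /Blayer summxE; apply: eq_bigr => pi _; rewrite [RHS]mxE.
  have E I : preact_der f (yy t) k.+1 (block_mi I) j 0 = mpder (block_mi I) (Z k.+1 j) (yy t).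
    by rewrite mxE.
  by congr (_ * _ - `|_ * _|); apply: eq_bigr => I _; rewrite E.
have hd I pi : finset.partition pi [set: 'I_(size (mi_seq a))]%SET -> I \in pi ->
    bnd (fun t => mpder (block_mi I) (Z k.+1 j) (yy t)).
  by move=> ppi Ipi; apply: bnd_mpder_preact; exact: block_mi_neq0 Ipi.
apply: bnd_sum => pi ppi; apply: bndB.
  apply: bndM.
    by apply: bndD; [apply: bnd_norm; exact: bnd_dmu|apply: bnd_Qlayer; exact: bnd_Player1].
  apply: bnd_prod => I Ipi; apply: bndD; first by apply: bnd_norm; exact: hd Ipi.
  by apply: hP; exact: block_mi_neq0 Ipi.
apply: bnd_norm; apply: bndM; first exact: bnd_dmu.
by apply: bnd_prod => I Ipi; exact: hd Ipi.
Qed.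

Lemma bnd_Player k a j : bnd (fun t => Player f N (yy t) (ee t) k.+1 a j 0).
Proof.
elim: k a j => [|k IH] a j; have [[l ->]|na] := mi_seq_unit_dec a.
- apply: (bnd_ext _ (bnd_Player1 1 j l)) => t _.
  by rewrite Player_unit [RHS]mxE.
- apply: (bnd_ext _ (bnd_cst S 0)) => t _ /=.
  by case: (mi_seq a) => [|l [|? ?]]; rewrite !mxE.
- apply: (bnd_ext _ (bnd_Player1 k.+2 j l)) => t _.
  by rewrite Player_unit [RHS]mxE.
- apply: (bnd_ext (F := fun t => \sum_i `|net_Wh f k.+2 j i| *
    Blayer f N (yy t) (ee t) k.+1 (Player f N (yy t) (ee t) k.+1) a i 0)).
    by move=> t _; rewrite PlayerSS// mxE; apply: eq_bigr => i _; rewrite abs_mxE.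
  by apply: bnd_sum => i _; apply: bndM; [exact: bnd_cst|exact: bnd_Blayer].
Qed.

Hypothesis L0 : (0 < L)%N.

Lemma bnd_ALG a : bnd (fun t => ALG f N (yy t) (ee t) a).
Proof.
have [[l ->]|na] := mi_seq_unit_dec a.
  apply: (bnd_ext (F := fun t => \sum_j `|net_Wo f 0 j| *
     Blayer1 f N (yy t) (ee t) L (Player1 f N (yy t) (ee t) L) j l)).
    move=> t _; rewrite /ALG mi_seq_unit mxE; apply: eq_bigr => j _.
    by rewrite abs_mxE.
  apply: bnd_sum => j _; apply: bndM; first exact: bnd_cst.
  by apply: bnd_Blayer1; exact: bnd_Player1.
apply: (bnd_ext (F := fun t => \sum_j `|net_Wo f 0 j| *
     Blayer f N (yy t) (ee t) L (Player f N (yy t) (ee t) L) a j 0)).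
  move=> t _; rewrite /ALG.
  have -> : (if mi_seq a is [:: l] then (abs_mx (net_Wo f) *m Blayer1 f N (yy t) (ee t) L (Player1 f N (yy t) (ee t) L)) 0 l
  else (abs_mx (net_Wo f) *m Blayer f N (yy t) (ee t) L (Player f N (yy t) (ee t) L) a) 0 0) =
   (abs_mx (net_Wo f) *m Blayer f N (yy t) (ee t) L (Player f N (yy t) (ee t) L) a) 0 0.
    by move: na; case: (mi_seq a) => [//|l [|? ?]//] /(_ l).
  by rewrite mxE; apply: eq_bigr => j _; rewrite abs_mxE.
apply: bnd_sum => j _; apply: bndM; first exact: bnd_cst.
have hB k : (0 < k)%N ->
    bnd (fun t => Blayer f N (yy t) (ee t) k (Player f N (yy t) (ee t) k) a j 0).
  by case: k => // k _; apply: bnd_Blayer => b i _; exact: bnd_Player.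
exact: hB.
Qed.

Lemma bnd_net : bnd (fun t => net_fun f (yy t)).
Proof.
rewrite net_funE; apply: bndD; last exact: bnd_cst.
by apply: bnd_sum => j _; apply: bndM; [exact: bnd_cst|exact: (bnd_mu 0)].
Qed.

Lemma bnd_mpder_net a : bnd (fun t => mpder a (net_fun f) (yy t)).
Proof.
have [->|a0] := eqVneq a 0; first by rewrite mpder0; exact: bnd_net.
have -> : net_fun f = unit_sum f (net_Wo f 0) (net_bo f) L by rewrite net_funE.
rewrite mpder_unit_sum//; apply: bnd_sum => j _; apply: bndM; first exact: bnd_cst.
apply: bnd_mpder_tanh => b i b0.
have h k : (0 < k)%N -> bnd (fun t => mpder b (Z k i) (yy t)).
  by case: k => // k _; exact: bnd_mpder_preact.
exact: h.
Qed.

(** With the three lemmas above, bounds for the network and for ALG that depend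
on the radii but hold for all centres. *)
Lemma bnd_Ebound a : bnd (fun t => Ebound f N (yy t) (ee t) a).
Proof.
rewrite /Ebound; case: eqP => _.
  apply: bndD; first by apply: bnd_norm; exact: bnd_net.
  apply: bnd_sum => l _; apply: bndM => //; apply: bndD; last exact: bnd_ALG.
  by apply: bnd_norm; exact: bnd_mpder_net.
by apply: bndD; [apply: bnd_norm; exact: bnd_mpder_net|exact: bnd_ALG].
Qed.

End BoundedNetwork.

(** * The Leibniz rule *)

Section Leibniz.
Context {R : realType} {n : nat}.
Implicit Types (a b c : mindex n) (i : 'I_n) (F : mindex n -> R).

Definition nat_mi m (u : {ffun 'I_n -> 'I_m}) : mindex n := [ffun i => nat_of_ord (u i)].

(** The index type of [sum_mi_le] depends on the multi-index; sums over lists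
can be compared by [perm_eq] when it changes. *)
Definition mi_list a : seq (mindex n) :=
  [seq nat_mi u | u <- enum [pred u : {ffun 'I_n -> 'I_(mi_deg a).+1} |
                  mi_le (nat_mi u) a]].

Lemma sum_mi_leE a F : sum_mi_le a F = \sum_(b <- mi_list a) F b.
Proof. by rewrite /sum_mi_le /mi_list big_map big_enum. Qed.

Lemma mi_list_uniq a : uniq (mi_list a).
Proof.
rewrite map_inj_uniq ?enum_uniq// => u u' /ffunP h.
by apply/ffunP => i; apply: val_inj; have := h i; rewrite !ffunE.
Qed.

Lemma mi_leP b a : reflect (forall i, b i <= a i)%N (mi_le b a).
Proof. exact: forallP. Qed.

Lemma mem_mi_list a b : (b \in mi_list a) = mi_le b a.
Proof.
apply/mapP/idP => [[u + ->]|h]; first by rewrite mem_enum.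
have bi i : (b i < (mi_deg a).+1)%N.
  by rewrite ltnS (leq_trans (mi_leP _ _ h i))// /mi_deg (bigD1 i)//= leq_addr.
have E : b = nat_mi [ffun i => Ordinal (bi i)].
  by apply/ffunP => i; rewrite !ffunE.
by exists [ffun i => Ordinal (bi i)]; rewrite // mem_enum inE -E.
Qed.

Lemma mi_bin_eq0 a b : ~~ mi_le b a -> mi_bin a b = 0%N.
Proof.
rewrite /mi_le negb_forall => /existsP[i]; rewrite -ltnNge => ai.
by rewrite /mi_bin (bigD1 i)//= bin_small.
Qed.

Lemma unit_miE i j : unit_mi i j = (j == i) :> nat.
Proof. by rewrite ffunE. Qed.

Lemma mi_subE a b i : mi_sub a b i = (a i - b i)%N.
Proof. by rewrite ffunE. Qed.

Lemma mi_bin_pascal a b i :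
  mi_bin (a + unit_mi i) b =
  (mi_bin a b + (if (0 < b i)%N then mi_bin a (mi_sub b (unit_mi i)) else 0))%N.
Proof.
rewrite /mi_bin (bigD1 i)//= mindexDE unit_miE eqxx addn1.
have E c : (forall j, j != i -> c j = b j) ->
    (\prod_(j < n | j != i) 'C((a + unit_mi i)%R j, b j) = \prod_(j < n | j != i) 'C(a j, c j))%N.
  move=> h; apply: eq_bigr => j ji.
  by rewrite mindexDE unit_miE (negbTE ji) addn0 h.
rewrite [in RHS](bigD1 i)//= -(E b)//; set K := (\prod_(_ < n | _) _)%N.
case bi : (b i) => [|k] /=; first by rewrite !bin0 addn0.
rewrite binS mulnDl [in RHS](bigD1 i)//= !ffunE eqxx bi subn1 /=.
congr (_ + _ * _)%N; rewrite /K (E (mi_sub b (unit_mi i)))// => j ji.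
by rewrite !ffunE (negbTE ji) subn0.
Qed.

Definition leibniz_sum a (X : mindex n -> mindex n -> R) : R :=
  sum_mi_le a (fun b => (mi_bin a b)%:R * X b (mi_sub a b)).

(** Pascal's rule for [mi_bin] splits the left-hand side in two sums, and the
index [b] is shifted by e_i in one of them. *)
Lemma leibniz_sum_step a i X :
  leibniz_sum (a + unit_mi i) X =
  leibniz_sum a (fun b c => X (b + unit_mi i) c) +
  leibniz_sum a (fun b c => X b (c + unit_mi i)).
Proof.
rewrite /leibniz_sum !sum_mi_leE.
under eq_bigr do rewrite mi_bin_pascal natrD mulrDl.
rewrite big_split /= addrC; congr (_ + _).
  rewrite (bigID (fun b : mindex n => (0 < b i)%N))/= [X in _ + X]big1 ?addr0; last first.
    by move=> b /negbTE ->; rewrite mul0r.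
  rewrite -big_filter.
  have P : perm_eq [seq b : mindex n <- mi_list (a + unit_mi i) | (0 < b i)%N]
                   [seq b + unit_mi i | b <- mi_list a].
    apply: uniq_perm.
    - by rewrite filter_uniq// mi_list_uniq.
    - rewrite map_inj_uniq ?mi_list_uniq// => b b' h.
      by apply/ffunP => j; move/ffunP/(_ j) : h; rewrite !mindexDE => /addIn.
    move=> b; rewrite mem_filter mem_mi_list; apply/andP/mapP => [[bi /mi_leP h]|[c + ->]].
      exists (mi_sub b (unit_mi i)).
        rewrite mem_mi_list; apply/mi_leP => j; have := h j.
        by rewrite mindexDE !ffunE; case: eqP => _; lia.
      by apply/ffunP => j; rewrite mindexDE !ffunE; case: eqP => [->|_]; rewrite ?subn0 ?addn0 ?subnK.
    rewrite mem_mi_list => /mi_leP h; split; first by rewrite mindexDE unit_miE eqxx addn1.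
    by apply/mi_leP => j; rewrite !mindexDE leq_add2r.
  rewrite (perm_big _ P) /= big_map; apply: eq_bigr => b _.
  rewrite mindexDE unit_miE eqxx addn1 /=.
  have -> : mi_sub (b + unit_mi i) (unit_mi i) = b.
    by apply/ffunP => j; rewrite ffunE mindexDE addnK.
  congr (_ * X _ _); apply/ffunP => j; by rewrite !ffunE subnDr.
rewrite (bigID (fun b : mindex n => mi_le b a))/= [X in _ + X]big1 ?addr0; last first.
  by move=> b /mi_bin_eq0 ->; rewrite mul0r.
rewrite -big_filter.
have P : perm_eq [seq b : mindex n <- mi_list (a + unit_mi i) | mi_le b a] (mi_list a).
  apply: uniq_perm; rewrite ?mi_list_uniq ?filter_uniq ?mi_list_uniq//.
  move=> b; rewrite mem_filter !mem_mi_list; apply/andP/idP => [[]//|h]; split=> //.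
  by apply/mi_leP => j; rewrite mindexDE (leq_trans (mi_leP _ _ h j))// leq_addr.
rewrite (perm_big _ P) /=; apply: eq_big_seq => b; rewrite mem_mi_list => /mi_leP h.
congr (_ * X _ _); apply/ffunP => j. by rewrite mi_subE !mindexDE mi_subE addnBAC.
Qed.

Lemma leibniz_sum0 X : leibniz_sum 0 X = X 0 0.
Proof.
rewrite /leibniz_sum sum_mi_leE.
have P : perm_eq (mi_list 0) [:: 0].
  apply: uniq_perm; rewrite ?mi_list_uniq// => b; rewrite mem_mi_list inE.
  apply/mi_leP/eqP => [h|->//]; apply/ffunP => i.
  by apply/eqP; have := h i; rewrite mindex0E leqn0.
rewrite (perm_big _ P) /= big_seq1.
have -> : mi_sub 0 0 = 0 :> mindex n by apply/ffunP => i; rewrite !ffunE.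
by rewrite /mi_bin big1 ?mul1r// => i _; rewrite mindex0E.
Qed.

Theorem leibniz (u v : 'rV[R]_n -> R) a x : smooth u -> smooth v ->
  mpder a (fun x => u x * v x) x = leibniz_sum a (fun b c => mpder b u x * mpder c v x).
Proof.
move=> hu hv; move: a x; apply: mindex_ind => [|a i IH] x.
  by rewrite leibniz_sum0 !mpder0.
rewrite (smooth_mpderD a i (smoothM hu hv)) (_ : mpder a _ = fun x =>
    leibniz_sum a (fun b c => mpder b u x * mpder c v x)); last by apply/funext.
have sm b c : smooth (fun x => mpder b u x * mpder c v x).
  by apply: smoothM; exact: smooth_mpder.
rewrite leibniz_sum_step /leibniz_sum.
under [X in pder i X]eq_fun do rewrite sum_mi_leE.
rewrite smooth_pder_sum; last by move=> b _; exact: smoothZ.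
rewrite !sum_mi_leE -big_split /=; apply: eq_bigr => b _.
rewrite smooth_pderZ// -mulrDr; congr (_ * _).
rewrite smooth_pderM; [|exact: smooth_mpder|exact: smooth_mpder].
by rewrite !smooth_mpderD.
Qed.

End Leibniz.

(** * Integration over cells that overlap on their frontiers *)

Section CellDecomposition.
Context {d0 : measure_display} {T : measurableType d0} {R : realType}.
Variable mu : {measure set T -> \bar R}.
Context {I : eqType}.
Variables (Z : seq I) (A : set T) (B O : I -> set T).
Variables (phi : T -> R) (F : I -> T -> R) (kappa : R).
Hypotheses (mA : measurable A) (mB : forall c, measurable (B c))
  (mO : forall c, measurable (O c)).
Hypotheses (mphi : measurable_fun A phi) (mF : forall c, measurable_fun (B c) (F c)).
Hypotheses (kappa0 : 0 <= kappa) (F0 : forall c x, c \in Z -> B c x -> 0 <= F c x).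
Hypotheses (OB : forall c, c \in Z -> O c `<=` B c) (BO0 : forall c, c \in Z -> mu (B c `\` O c) = 0%E).
Hypotheses (uZ : uniq Z) (OA : forall c, c \in Z -> O c `<=` A).
Hypothesis AB : forall x, A x -> exists2 c, c \in Z & B c x.
Hypothesis Odisj : forall c c' x, c \in Z -> c' \in Z -> O c x -> O c' x -> c = c'.
Hypothesis lower : forall c x, c \in Z -> A x -> B c x -> phi x ^+ 2 <= F c x.
Hypothesis upper : forall c x, c \in Z -> O c x -> F c x <= phi x ^+ 2 + kappa.

Local Open Scope ereal_scope.

Let phi2 (x : T) : R := (phi x ^+ 2)%R.

Let mphi2 : measurable_fun A (EFin \o phi2).
Proof. by apply/measurable_EFinP; exact: measurable_funX. Qed.

Let mFE c : measurable_fun (B c) (fun x => (F c x)%:E).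
Proof. exact/(measurable_EFinP (B c) (F c)). Qed.

Lemma integral_seq_mem (D : I -> set T) (G : I -> T -> \bar R) :
  \sum_(c <- Z) \int[mu]_(x in D c) G c x =
  \sum_(c <- Z) \int[mu]_x (if c \in Z then (G c \_ (D c)) x else 0).
Proof.
by apply: eq_big_seq => c cZ; rewrite integral_mkcond; apply: eq_integral => x _; rewrite cZ.
Qed.

(** The closed cells cover [A], so the integral over [A] is at most the sum of
the integrals over the closed cells even where they overlap. *)
Lemma integral_cells_lower :
  \int[mu]_(x in A) ((phi x ^+ 2)%R)%:E <= \sum_(c <- Z) \int[mu]_(x in B c) (F c x)%:E.
Proof.
rewrite (integral_seq_mem B (fun c x => (F c x)%:E)) -ge0_integral_sum//; last 2 first.
- move=> c; case cZ : (c \in Z); last exact: measurable_cst.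
  by apply/(measurable_restrictT _ (mB c)); exact: mFE.
- move=> c x _; case cZ : (c \in Z) => //; apply: erestrict_ge0 => y By.
  by rewrite lee_fin F0.
rewrite [X in X <= _]integral_mkcond; apply: ge0_le_integral => //.
- by move=> x _; apply: erestrict_ge0 => y _; rewrite lee_fin sqr_ge0.
- by apply/(measurable_restrictT _ mA).
- apply: emeasurable_sum => c; case cZ : (c \in Z); last exact: measurable_cst.
  by apply/(measurable_restrictT _ (mB c)); exact: mFE.
move=> x _.
have ge0 c : 0 <= (if c \in Z then ((fun x => (F c x)%:E) \_ (B c)) x else 0).
  case cZ : (c \in Z) => //; apply: erestrict_ge0 => y By.
  by rewrite lee_fin F0.
rewrite patchE; case: ifPn => [|_]; last by apply: sume_ge0.
rewrite inE => /[dup] Ax /AB[c cZ Bcx].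
rewrite (bigD1_seq c)//= cZ patchE mem_set//.
apply: (@le_trans _ _ (F c x)%:E); first by rewrite lee_fin lower.
by rewrite leeDl// sume_ge0.
Qed.

(** Conversely the open cells are disjoint subsets of [A], and each of them
has full measure in its closed cell. *)
Lemma integral_cells_upper :
  \sum_(c <- Z) \int[mu]_(x in B c) (F c x)%:E <=
  \int[mu]_(x in A) ((phi x ^+ 2)%R)%:E + kappa%:E * mu A.
Proof.
pose G2 (x : T) : R := (phi x ^+ 2 + kappa)%R; pose G : T -> \bar R := EFin \o G2.
have mG : measurable_fun A G.
  by apply/measurable_EFinP; apply: measurable_funD => //; exact: measurable_funX.
have G0 x : 0 <= G x by rewrite lee_fin addr_ge0// sqr_ge0.
have mGO c : c \in Z -> measurable_fun (O c) G.
  by move=> cZ; apply: (measurable_funS mA (OA cZ)).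
apply: (@le_trans _ _ (\sum_(c <- Z) \int[mu]_(x in O c) G x)).
  rewrite big_seq [X in _ <= X]big_seq; apply: lee_sum => c cZ.
  rewrite (@ge0_negligible_integral _ _ _ mu (B c) (B c `\` O c))//; last 3 first.
  - exact: measurableD.
  - by move=> x Bx; rewrite lee_fin F0.
  - exact: BO0.
  have -> : B c `\` (B c `\` O c) = O c.
    by rewrite setDD; apply/setIidPr; exact: OB.
  apply: ge0_le_integral => //.
  - by move=> x Ox; rewrite lee_fin F0//; exact: OB.
  - exact: (measurable_funS (mB c) (OB cZ)).
  - exact: mGO.
  - by move=> x Ox; rewrite lee_fin upper.
rewrite (integral_seq_mem O (fun c x => G x)) -ge0_integral_sum//; last 2 first.
- move=> c; case cZ : (c \in Z); last exact: measurable_cst.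
  by apply/(measurable_restrictT _ (mO c)); exact: mGO.
- by move=> c x _; case cZ : (c \in Z) => //; apply: erestrict_ge0.
apply: (@le_trans _ _ (\int[mu]_(x in A) G x)); last first.
  have -> : \int[mu]_(x in A) G x =
      \int[mu]_(x in A) (((phi x ^+ 2)%R)%:E + cst kappa%:E x).
    by apply: eq_integral => x _; rewrite /G /= /G2 EFinD.
  rewrite ge0_integralD//; last by move=> x _; rewrite lee_fin sqr_ge0.
  by rewrite integral_cst.
rewrite [X in _ <= X]integral_mkcond; apply: ge0_le_integral => //.
- move=> x _; apply: sume_ge0 => c _; case cZ : (c \in Z) => //; exact: erestrict_ge0.
- apply: emeasurable_sum => c; case cZ : (c \in Z); last exact: measurable_cst.
  by apply/(measurable_restrictT _ (mO c)); exact: mGO.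
- by apply/(measurable_restrictT _ mA).
move=> x _.
have [[c cZ Ocx]|nO] := pselect (exists2 c, c \in Z & O c x).
  rewrite (bigD1_seq c)//= cZ patchE mem_set// big_seq_cond big1 ?adde0.
    by rewrite patchE mem_set//; exact: OA Ocx.
  move=> c' /andP[c'Z c'c]; rewrite c'Z patchE memNset// => Oc'x.
  by move/eqP: c'c; apply; exact: (Odisj c'Z cZ Oc'x Ocx).
rewrite big_seq big1; first exact: erestrict_ge0.
move=> c cZ; rewrite cZ patchE memNset// => Ocx.
by apply: nO; exists c.
Qed.

End CellDecomposition.

(** * Lebesgue measure of boxes *)

Section Boxes.
Context {R : realType}.
Local Notation tupR n := (n.-tuple (measurableTypeR R)).
Local Notation rowT := (@row_of_tuple R _).

Lemma row_of_tupleE n (t : tupR n) j : row_of_tuple t 0 j = tnth t j.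
Proof. by rewrite mxE. Qed.

Lemma measurable_rect n (J : 'I_n -> set (measurableTypeR R)) :
  (forall j, measurable (J j)) -> measurable (@row_of_tuple R n @^-1` rect J).
Proof.
move=> mJ.
have -> : @row_of_tuple R n @^-1` rect J =
    \bigcap_(j in [set: 'I_n]) ((fun t : tupR n => tnth t j) @^-1` (J j)).
  apply/seteqP; split => [t h j _ /=|t h j]; last by rewrite row_of_tupleE; exact: h.
  by rewrite -row_of_tupleE; exact: h.
apply: fin_bigcap_measurable; first exact: finite_finset.
move=> j _; rewrite -[X in measurable X]setTI.
exact: (measurable_tnth j measurableT (mJ j)).
Qed.

Lemma lebesgue_rectS n (J : 'I_n.+1 -> set (measurableTypeR R)) :
  (forall j, measurable (J j)) ->
  lebesgue_tuple n.+1 (@row_of_tuple R n.+1 @^-1` rect J) =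
  (lebesgue_measure (J ord0) *
   lebesgue_tuple n (@row_of_tuple R n @^-1` rect (fun j => J (lift ord0 j))))%E.
Proof.
move=> mJ; rewrite /= /pushforward.
have -> : @tuple_cons R n @^-1` (@row_of_tuple R n.+1 @^-1` rect J) =
    J ord0 `*` (@row_of_tuple R n @^-1` rect (fun j => J (lift ord0 j))).
  apply/seteqP; split => [[x t] h|[x t] [h0 h] j].
    split; first by have := h ord0; rewrite row_of_tupleE.
    by move=> j; have := h (lift ord0 j); rewrite !row_of_tupleE tnthS.
  rewrite row_of_tupleE; case: (unliftP ord0 j) => [j'|] -> //.
  by have := h j'; rewrite row_of_tupleE /tuple_cons /= tnthS.
rewrite product_measure1E//.
by apply: measurable_rect => j.
Qed.

Lemma lebesgue_rect0 (J : 'I_0 -> set (measurableTypeR R)) :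
  lebesgue_tuple 0 (@row_of_tuple R 0 @^-1` rect J) = 1%E.
Proof.
rewrite /= diracE mem_set//= => j; by case: j.
Qed.

Lemma lebesgue_rect_lty n (J : 'I_n -> set (measurableTypeR R)) :
  (forall j, measurable (J j)) -> (forall j, lebesgue_measure (J j) < +oo)%E ->
  (lebesgue_tuple n (@row_of_tuple R n @^-1` rect J) < +oo)%E.
Proof.
elim: n J => [|n IH] J mJ fJ; first by rewrite lebesgue_rect0 ltry.
by rewrite lebesgue_rectS// lte_mul_pinfty// ?ge0_fin_numE// IH.
Qed.

Lemma lebesgue_rect_gt0 n (J : 'I_n -> set (measurableTypeR R)) :
  (forall j, measurable (J j)) -> (forall j, 0 < lebesgue_measure (J j))%E ->
  (0 < lebesgue_tuple n (@row_of_tuple R n @^-1` rect J))%E.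
Proof.
elim: n J => [|n IH] J mJ fJ; first by rewrite lebesgue_rect0 lte01.
by rewrite lebesgue_rectS// mule_gt0// IH.
Qed.

Lemma lebesgue_rect_eq n (J J' : 'I_n -> set (measurableTypeR R)) :
  (forall j, measurable (J j)) -> (forall j, measurable (J' j)) ->
  (forall j, lebesgue_measure (J j) = lebesgue_measure (J' j)) ->
  lebesgue_tuple n (@row_of_tuple R n @^-1` rect J) =
  lebesgue_tuple n (@row_of_tuple R n @^-1` rect J').
Proof.
elim: n J J' => [|n IH] J J' mJ mJ' h; first by rewrite !lebesgue_rect0.
by rewrite !lebesgue_rectS// h (IH _ (fun j => J' (lift ord0 j))).
Qed.

Definition obox n (c e : 'rV[R]_n) : set 'rV[R]_n :=
  [set x | forall j, `|x 0 j - c 0 j| < e 0 j].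

Lemma obox_sub_box n (c e : 'rV[R]_n) : obox c e `<=` box c e.
Proof. by move=> x h j; exact: ltW. Qed.

Let cside n (c e : 'rV[R]_n) (j : 'I_n) : set (measurableTypeR R) :=
  `[c 0 j - e 0 j, c 0 j + e 0 j]%classic.
Let oside n (c e : 'rV[R]_n) (j : 'I_n) : set (measurableTypeR R) :=
  `]c 0 j - e 0 j, c 0 j + e 0 j[%classic.

Lemma box_rect n (c e : 'rV[R]_n) : box c e = rect (cside c e).
Proof.
apply/seteqP; split => x h j; have := h j; rewrite /cside /= in_itv /= ler_norml => /andP[? ?].
  by apply/andP; split; lra.
by apply/andP; split; lra.
Qed.

Lemma obox_rect n (c e : 'rV[R]_n) : obox c e = rect (oside c e).
Proof.
apply/seteqP; split => x h j; have := h j; rewrite /oside /= in_itv /= ltr_norml => /andP[? ?].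
  by apply/andP; split; lra.
by apply/andP; split; lra.
Qed.

Lemma measurable_box n (c e : 'rV[R]_n) : measurable (@row_of_tuple R n @^-1` box c e).
Proof. by rewrite box_rect; apply: measurable_rect => j; exact: measurable_itv. Qed.

Lemma measurable_obox n (c e : 'rV[R]_n) : measurable (@row_of_tuple R n @^-1` obox c e).
Proof. by rewrite obox_rect; apply: measurable_rect => j; exact: measurable_itv. Qed.

Lemma lebesgue_box_lty n (c e : 'rV[R]_n) :
  (lebesgue_tuple n (@row_of_tuple R n @^-1` box c e) < +oo)%E.
Proof.
rewrite box_rect; apply: lebesgue_rect_lty => j; first exact: measurable_itv.
by rewrite lebesgue_measure_itv /=; case: ifP => _; rewrite ?ltry// -EFinB ltry.
Qed.

Lemma lebesgue_obox_gt0 n (c e : 'rV[R]_n) : (forall j, 0 < e 0 j) ->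
  (0 < lebesgue_tuple n (@row_of_tuple R n @^-1` obox c e))%E.
Proof.
move=> e0; rewrite obox_rect; apply: lebesgue_rect_gt0 => j; first exact: measurable_itv.
rewrite lebesgue_measure_itv /= lte_fin.
have -> : c 0 j - e 0 j < c 0 j + e 0 j by have := e0 j; lra.
by rewrite -EFinB lte_fin; have := e0 j; lra.
Qed.

(** Open and closed intervals have the same length, hence a box and its
interior have the same measure, which is finite. *)
Lemma lebesgue_box_frontier n (c e : 'rV[R]_n) :
  lebesgue_tuple n (@row_of_tuple R n @^-1` box c e `\` @row_of_tuple R n @^-1` obox c e) = 0%E.
Proof.
have mb := measurable_box c e; have mo := measurable_obox c e.
have E : lebesgue_tuple n (@row_of_tuple R n @^-1` box c e) =
         lebesgue_tuple n (@row_of_tuple R n @^-1` obox c e).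
  rewrite box_rect obox_rect; apply: lebesgue_rect_eq => j.
  - exact: measurable_itv.
  - exact: measurable_itv.
  - by rewrite !lebesgue_measure_itv.
have fb := lebesgue_box_lty c e.
rewrite measureD//.
have -> : @row_of_tuple R n @^-1` box c e `&` @row_of_tuple R n @^-1` obox c e =
   @row_of_tuple R n @^-1` obox c e.
  by apply/setIidPr => t; exact: obox_sub_box.
rewrite [X in (_ - X)%E](_ : _ = lebesgue_tuple n (@row_of_tuple R n @^-1` box c e)); last exact: esym E.
by apply: subee; rewrite ge0_fin_numE.
Qed.

Lemma open_obox n (c e : 'rV[R]_n) : (forall j, 0 < e 0 j) -> open (obox c e).
Proof.
move=> e0; rewrite openE => x h.
have : \forall z \near x, forall j, `|(z : 'rV[R]_n) 0 j - c 0 j| < e 0 j.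
  apply: (@filter_forall _ 'I_n (fun j => [set z : 'rV[R]_n | `|z 0 j - c 0 j| < e 0 j]) (nbhs (x : 'rV[R]_n)) _) => j.
  have ct : {for x, continuous (fun z : 'rV[R]_n => z 0 j)} by exact: coord_continuous.
  have := h j; rewrite -subr_gt0 => dj.
  move/cvgrPdist_lt/(_ _ dj) : ct; apply: filterS => z hz.
  have {}hz : `|z 0 j - x 0 j| < e 0 j - `|x 0 j - c 0 j| by rewrite distrC.
  by have /= := ler_normD (z 0 j - x 0 j) (x 0 j - c 0 j); rewrite subrKA; lra.
by [].
Qed.

(** An open set is the countable union of the boxes with rational vertices that
it contains.  This relates the topology of row vectors to the product
sigma-algebra on tuples. *)
Lemma measurable_open n (U : set 'rV[R]_n) : open U -> measurable (@row_of_tuple R n @^-1` U).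
Proof.
move=> oU.
pose cube (p : {ffun 'I_n -> rat * rat}) : set 'rV[R]_n :=
  rect (fun j => `]ratr (p j).1, ratr (p j).2[%classic).
pose I := {ffun 'I_n -> rat * rat}.
have -> : @row_of_tuple R n @^-1` U =
    \bigcup_(p in [set: I]) (if pselect (cube p `<=` U) then @row_of_tuple R n @^-1` cube p else set0).
  apply/seteqP; split => [t Ut|t [p _]]; last first.
    by case: pselect => [cU|nU] //= ct; exact: cU.
  have := oU; rewrite openE => /(_ _ Ut)/nbhs_rVP[e e0 eU].
  pose x := row_of_tuple t.
  have h j : exists p : rat * rat, x 0 j - e < ratr p.1 < x 0 j /\ x 0 j < ratr p.2 < x 0 j + e.
    have [q1] := @rat_in_itvoo R (x 0 j - e) (x 0 j) ltac:(lra).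
    have [q2] := @rat_in_itvoo R (x 0 j) (x 0 j + e) ltac:(lra).
    by rewrite !in_itv /= => h2 h1; exists (q1, q2).
  have [p hp] := choice h.
  exists [ffun j => p j] => //; case: pselect => [cU|nU] /=.
  - by move=> j; rewrite ffunE /= in_itv /=; have [/andP[_ ->] /andP[-> _]] := hp j.
  - exfalso; apply: nU => z hz; apply: eU => j; have := hz j; rewrite ffunE /= in_itv /=.
  have [/andP[a1 a2] /andP[a3 a4]] := hp j; move=> /andP[a5 a6].
  by rewrite ltr_norml; apply/andP; split; rewrite -/x; lra.
apply: countable_bigcupT_measurable => [|p]; first exact: countableP.
case: pselect => [cU|nU] /=; last exact: measurable0.
apply: measurable_rect => j; exact: measurable_itv.
Qed.

Lemma measurable_continuous_on n (U : set 'rV[R]_n) (phi : 'rV[R]_n -> R) : open U ->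
  (forall x, U x -> {for x, continuous phi}) ->
  measurable_fun (@row_of_tuple R n @^-1` U) (phi \o @row_of_tuple R n).
Proof.
move=> oU cphi; apply: (measurability _ (RGenOpens.measurableE R)).
move=> _ [_ [a [b ->] <-]].
have -> : @row_of_tuple R n @^-1` U `&` (phi \o @row_of_tuple R n) @^-1` `]a, b[%classic =
   @row_of_tuple R n @^-1` (U `&` phi @^-1` `]a, b[%classic) by [].
apply: measurable_open; rewrite openE => x [Ux fx].
have := @cphi x Ux `]a, b[%classic.
have nb : nbhs (phi x) `]a, b[%classic by apply: open_nbhs_nbhs; split => //; exact: interval_open.
move=> /(_ nb) h; apply: filterI => //.
by apply: open_nbhs_nbhs.
Qed.

End Boxes.

(** * From pointwise remainders to norm bounds *)

Section CellSum.
Context {R : realType} {n : nat}.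
Local Notation mu := (@lebesgue_tuple R n).
Local Notation rowT := (@row_of_tuple R n).
Implicit Types (x c e : 'rV[R]_n) (phi : 'rV[R]_n -> R).

Lemma measurable_continuousT (phi : 'rV[R]_n -> R) (A : set 'rV[R]_n) :
  measurable (rowT @^-1` A) -> continuous phi ->
  measurable_fun (rowT @^-1` A) (phi \o rowT).
Proof.
move=> mA cphi.
have m := @measurable_continuous_on R n setT phi openT (fun x _ => cphi x).
exact: (measurable_funS measurableT (@subsetT _ _) m).
Qed.

Lemma bounded_integrable (phi : 'rV[R]_n -> R) (A : set 'rV[R]_n) (M : R) :
  measurable (rowT @^-1` A) -> (mu (rowT @^-1` A) < +oo)%E ->
  measurable_fun (rowT @^-1` A) (phi \o rowT) ->
  (forall x, A x -> `|phi x| <= M) ->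
  mu.-integrable (rowT @^-1` A) (EFin \o (phi \o rowT)).
Proof.
move=> mA fA mphi hM; apply: measurable_bounded_integrable => //.
exists M; split; first exact: num_real.
move=> y My t At /=; apply: le_trans (ltW My); exact: hM.
Qed.

Variables (A O : set 'rV[R]_n).
Hypotheses (OA : O `<=` A) (oO : open O) (mA : measurable (rowT @^-1` A))
  (fA : (mu (rowT @^-1` A) < +oo)%E).

(** What the norm bounds use of a mesh.  The domain [A] and the open set [O]
are kept apart because the space-time cylinder contains its final time and is not
open. *)
Definition cells (Z : seq 'rV[R]_n) (e : 'rV[R]_n) : Prop :=
  [/\ uniq Z, (forall j, 0 < e 0 j), (forall c, c \in Z -> obox c e `<=` O),
      (forall x, A x -> exists2 c, c \in Z & box c e x) &
      (forall c c' x, c \in Z -> c' \in Z -> obox c e x -> obox c' e x -> c = c')].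

Lemma cells_center Z e c : cells Z e -> c \in Z -> O c.
Proof.
by move=> [_ e0 h _ _] cZ; apply: (h c cZ) => j; rewrite subrr normr0.
Qed.

Definition volume : R := fine (mu (rowT @^-1` A)).

Lemma volume_ge0 : 0 <= volume.
Proof. exact: fine_ge0. Qed.

(** On a cell, |phi| <= |P| + D and |P| <= Aa give phi^2 <= P^2 + 2 Aa D + D^2,
and |P| <= |phi| + D gives the converse up to a multiple of D.  The two
inequalities are integrated with [integral_cells_lower] and
[integral_cells_upper]. *)
Lemma cell_sum_bounds Z e phi (P Aa D : 'rV[R]_n -> 'rV[R]_n -> R) (M M' delta : R) :
  cells Z e ->
  measurable_fun (rowT @^-1` A) (phi \o rowT) ->
  (forall x, A x -> `|phi x| <= M) ->
  (forall c, continuous (P c)) -> (forall c, continuous (Aa c)) -> (forall c, continuous (D c)) ->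
  (forall c x, c \in Z -> box c e x -> `|P c x| <= Aa c x) ->
  (forall c x, c \in Z -> box c e x -> Aa c x <= M') ->
  (forall c x, c \in Z -> box c e x -> 0 <= D c x <= delta) ->
  (forall c x, c \in Z -> A x -> box c e x -> `|phi x - P c x| <= D c x) ->
  0 <= M -> 0 <= M' -> 0 <= delta ->
  integral_rV A (fun x => phi x ^+ 2) <= cell_sum Z e P Aa D <=
  integral_rV A (fun x => phi x ^+ 2) + (2 * M * delta + 2 * M' * delta + 2 * delta ^+ 2) * volume.
Proof.
move=> [uZ e0 cO cA cdisj] mphi hM cP cAa cD hP hA hD hT M0 M'0 delta0.
have A0 c x : c \in Z -> box c e x -> 0 <= Aa c x.
  by move=> cZ bx; exact: le_trans (hP _ _ cZ bx).
have D0 c x : c \in Z -> box c e x -> 0 <= D c x.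
  by move=> cZ bx; have /andP[] := hD _ _ cZ bx.
have Dd c x : c \in Z -> box c e x -> D c x <= delta.
  by move=> cZ bx; have /andP[] := hD _ _ cZ bx.
pose F c x := P c x ^+ 2 + 2 * (Aa c x * D c x) + D c x ^+ 2.
have mb c := measurable_box c e.
have fb c := lebesgue_box_lty c e.
have mPb c : measurable_fun (rowT @^-1` box c e) (P c \o rowT) by exact: measurable_continuousT.
have mAb c : measurable_fun (rowT @^-1` box c e) (Aa c \o rowT) by exact: measurable_continuousT.
have mDb c : measurable_fun (rowT @^-1` box c e) (D c \o rowT) by exact: measurable_continuousT.
have mP2 c : measurable_fun (rowT @^-1` box c e) ((fun x => P c x ^+ 2) \o rowT).
  exact: (measurable_funX 2 (mPb c)).
have mD2 c : measurable_fun (rowT @^-1` box c e) ((fun x => D c x ^+ 2) \o rowT).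
  exact: (measurable_funX 2 (mDb c)).
have mAD c : measurable_fun (rowT @^-1` box c e) ((fun x => Aa c x * D c x) \o rowT).
  exact: (measurable_funM (mAb c) (mDb c)).
have mF c : measurable_fun (rowT @^-1` box c e) (F c \o rowT).
  apply: measurable_funD; last exact: mD2.
  apply: measurable_funD; first exact: mP2.
  by apply: measurable_funM => //; exact: mAD.
have iP2 c : c \in Z -> mu.-integrable (rowT @^-1` box c e) (EFin \o ((fun x => P c x ^+ 2) \o rowT)).
  move=> cZ; apply: (@bounded_integrable _ _ (M' ^+ 2)) => // x bx.
  by rewrite normrX lerXn2r ?nnegrE// (le_trans (hP _ _ cZ bx)) ?hA.
have iD2 c : c \in Z -> mu.-integrable (rowT @^-1` box c e) (EFin \o ((fun x => D c x ^+ 2) \o rowT)).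
  move=> cZ; apply: (@bounded_integrable _ _ (delta ^+ 2)) => // x bx.
  by rewrite normrX lerXn2r ?nnegrE// ger0_norm ?D0// Dd.
have iAD c : c \in Z -> mu.-integrable (rowT @^-1` box c e) (EFin \o ((fun x => Aa c x * D c x) \o rowT)).
  move=> cZ; apply: (@bounded_integrable _ _ (M' * delta)) => // x bx.
  by rewrite normrM ler_pM// ger0_norm ?A0 ?D0 ?hA ?Dd.
have E : cell_sum Z e P Aa D = \sum_(c <- Z) integral_rV (box c e) (F c).
  rewrite /cell_sum; apply: eq_big_seq => c cZ; rewrite /integral_rV.
  rewrite -(RintegralZl 2 (mb c) (iAD c cZ)).
  rewrite -RintegralD//; [|exact: iP2|]; last first.
    apply: (@bounded_integrable (fun x => 2 * (Aa c x * D c x)) _ (2 * (M' * delta))) => //.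
      by apply: measurable_funM => //; exact: mAD.
    move=> x bx; rewrite normrM normr_nat ler_wpM2l// normrM ler_pM//.
      by rewrite ger0_norm ?A0 ?hA.
    by rewrite ger0_norm ?D0 ?Dd.
  rewrite -RintegralD//; last exact: iD2.
  apply: (@bounded_integrable (fun x => P c x ^+ 2 + 2 * (Aa c x * D c x)) _ (M' ^+ 2 + 2 * (M' * delta))) => //.
    by apply: measurable_funD; [exact: mP2|apply: measurable_funM => //; exact: mAD].
  move=> x bx; rewrite (le_trans (ler_normD _ _))// lerD//.
    by rewrite normrX lerXn2r ?nnegrE// (le_trans (hP _ _ cZ bx)) ?hA.
  rewrite normrM normr_nat ler_wpM2l// normrM ler_pM//.
    by rewrite ger0_norm ?A0 ?hA.
  by rewrite ger0_norm ?D0 ?Dd.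
have F0 c x : c \in Z -> box c e x -> 0 <= F c x.
  move=> cZ bx; rewrite /F addr_ge0 ?sqr_ge0// addr_ge0 ?sqr_ge0// mulr_ge0// mulr_ge0 ?A0 ?D0//.
have iF c : c \in Z -> mu.-integrable (rowT @^-1` box c e) (EFin \o (F c \o rowT)).
  move=> cZ; apply: (@bounded_integrable (F c) _ (M' ^+ 2 + 2 * (M' * delta) + delta ^+ 2)) => // x bx.
  rewrite ger0_norm ?F0// /F lerD//.
    rewrite lerD//; first by rewrite -real_normK ?num_real// lerXn2r ?nnegrE// (le_trans (hP _ _ cZ bx)) ?hA.
    by rewrite ler_wpM2l// ler_pM ?A0 ?D0 ?hA ?Dd.
  by rewrite lerXn2r ?nnegrE ?D0 ?Dd.
have iphi : mu.-integrable (rowT @^-1` A) (EFin \o ((fun x => phi x ^+ 2) \o rowT)).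
  apply: (@bounded_integrable _ _ (M ^+ 2)) => //; first exact: (measurable_funX 2 mphi).
  by move=> x Ax; rewrite normrX lerXn2r ?nnegrE ?hM.
set kappa := 2 * M * delta + 2 * M' * delta + 2 * delta ^+ 2.
have kappa0 : 0 <= kappa by rewrite /kappa !addr_ge0// ?mulr_ge0 ?exprn_ge0.
have sumE : (\sum_(c <- Z) \int[mu]_(t in rowT @^-1` box c e) (F c (rowT t))%:E)%E =
    (\sum_(c <- Z) integral_rV (box c e) (F c))%:E.
  rewrite -sumEFin; apply: eq_big_seq => c cZ.
  by rewrite /integral_rV /Rintegral fineK//; exact: integrable_fin_num (iF c cZ).
have intE : (\int[mu]_(t in rowT @^-1` A) ((phi (rowT t) ^+ 2)%R)%:E)%E =
    (integral_rV A (fun x => phi x ^+ 2))%:E.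
  by rewrite /integral_rV /Rintegral fineK//; exact: integrable_fin_num iphi.
have lower c (t : n.-tuple (measurableTypeR R)) : c \in Z -> (rowT @^-1` A) t ->
    (rowT @^-1` box c e) t -> phi (rowT t) ^+ 2 <= F c (rowT t).
  move=> cZ At bt; set x := rowT t.
  have h1 : `|phi x| <= `|P c x| + D c x.
    rewrite -[phi x](subrK (P c x)) (le_trans (ler_normD _ _))// addrC lerD2l.
    exact: hT.
  have h2 := hP c x cZ bt; have h3 := D0 c x cZ bt.
  rewrite /F -(real_normK (num_real (phi x))) -(real_normK (num_real (P c x))).
  have h4 : `|phi x| ^+ 2 <= (`|P c x| + D c x) ^+ 2.
    by rewrite lerXn2r ?nnegrE ?addr_ge0.
  apply: (le_trans h4).
  have : `|P c x| * D c x <= Aa c x * D c x by rewrite ler_wpM2r.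
  by rewrite sqrrD mulr2n; lra.
have upper c (t : n.-tuple (measurableTypeR R)) : c \in Z ->
    (rowT @^-1` obox c e) t -> F c (rowT t) <= phi (rowT t) ^+ 2 + kappa.
  move=> cZ ot; set x := rowT t.
  have bt : box c e x by exact: obox_sub_box.
  have At : A x by apply: OA; exact: (cO c cZ).
  have h1 : `|P c x| <= `|phi x| + D c x.
    rewrite -[P c x](subrK (phi x)) (le_trans (ler_normD _ _))// addrC lerD2l.
    by rewrite distrC; exact: hT.
  have h3 := D0 c x cZ bt; have h3' := Dd c x cZ bt.
  rewrite /F -(real_normK (num_real (phi x))) -(real_normK (num_real (P c x))).
  have h4 : `|P c x| ^+ 2 <= (`|phi x| + D c x) ^+ 2.
    by rewrite lerXn2r ?nnegrE ?addr_ge0.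
  have h5 : `|phi x| * D c x <= M * delta by rewrite ler_pM// hM.
  have h6 : Aa c x * D c x <= M' * delta by rewrite ler_pM ?A0 ?hA.
  have h7 : D c x ^+ 2 <= delta ^+ 2 by rewrite lerXn2r ?nnegrE.
  move: h4; rewrite sqrrD mulr2n /kappa => h4; lra.
have BO0 c : c \in Z -> mu (rowT @^-1` box c e `\` rowT @^-1` obox c e) = 0%E.
  by move=> _; exact: lebesgue_box_frontier.
have OB c : c \in Z -> rowT @^-1` obox c e `<=` rowT @^-1` box c e.
  by move=> _ t; exact: obox_sub_box.
have OAc c : c \in Z -> rowT @^-1` obox c e `<=` rowT @^-1` A.
  by move=> cZ t ot; apply: OA; exact: (cO c cZ).
rewrite E; apply/andP; split.
  rewrite -lee_fin -intE -sumE.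
  apply: (@integral_cells_lower _ _ _ mu _ Z (rowT @^-1` A) (fun c => rowT @^-1` box c e)
    (phi \o rowT) (fun c => F c \o rowT)) => //.
  - by move=> c t cZ; exact: F0.
  - by move=> t; exact: cA.
have volE : mu (rowT @^-1` A) = volume%:E by rewrite /volume fineK// ge0_fin_numE.
rewrite -lee_fin EFinD EFinM -intE -sumE -volE.
apply: (@integral_cells_upper _ _ _ mu _ Z (rowT @^-1` A) (fun c => rowT @^-1` box c e)
    (fun c => rowT @^-1` obox c e) (phi \o rowT) (fun c => F c \o rowT) kappa) => //.
- by move=> c; exact: measurable_obox.
- by move=> c t cZ; exact: F0.
- by move=> c c' t cZ c'Z; exact: cdisj.
Qed.

(** If [phi] did not vanish at [x], then phi^2 would be bounded below on a small
box, which has positive measure. *)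
Lemma integral_sq_eq0 phi (M : R) x :
  measurable_fun (rowT @^-1` A) (phi \o rowT) ->
  (forall x, A x -> `|phi x| <= M) ->
  (forall x, O x -> {for x, continuous phi}) ->
  integral_rV A (fun x => phi x ^+ 2) = 0 -> O x -> phi x = 0.
Proof.
move=> mphi hM cphi I0 Ox; apply/eqP; apply: contraT => px.
pose dl := `|phi x| / 2; have dl0 : 0 < dl by rewrite divr_gt0// normr_gt0.
have n1 : \forall z \near x, `|phi x - phi z| < dl.
  by move/cvgrPdist_lt : (cphi x Ox) => /(_ _ dl0).
have n2 : nbhs x O by apply: open_nbhs_nbhs.
have [e e0 he] := (nbhs_rVP _ _).1 (filterI n1 n2).
pose ee : 'rV[R]_n := const_mx e.
have ob z : obox x ee z -> O z /\ dl <= `|phi z|.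
  move=> oz; have [|h Oz] := he z; first by move=> j; have := oz j; rewrite mxE.
  split=> //; have := ler_normB (phi x - phi z) (- phi z).
  rewrite opprK subrK normrN => h2; rewrite /dl in h *.
  by have := lt_le_trans h (lexx _); lra.
have ee0 j : 0 < ee 0 j by rewrite mxE.
have mo := measurable_obox x ee.
have pos := lebesgue_obox_gt0 x ee0.
have iphi : mu.-integrable (rowT @^-1` A) (EFin \o ((fun x => phi x ^+ 2) \o rowT)).
  apply: (@bounded_integrable _ _ (M ^+ 2)) => //; first exact: (measurable_funX 2 mphi).
  move=> z Az; rewrite normrX lerXn2r ?nnegrE ?hM//.
  by rewrite (le_trans _ (hM _ Az)).
have intE : (\int[mu]_(t in rowT @^-1` A) ((phi (rowT t) ^+ 2)%R)%:E)%E = 0%E.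
  rewrite -[LHS]fineK; last exact: integrable_fin_num iphi.
  by move: I0; rewrite /integral_rV /Rintegral => ->.
have mphi2 : measurable_fun (rowT @^-1` A) (EFin \o ((fun x => phi x ^+ 2) \o rowT)).
  by apply/measurable_EFinP; exact: (measurable_funX 2 mphi).
have oA : rowT @^-1` obox x ee `<=` rowT @^-1` A.
  by move=> t /ob[Oz _]; exact: OA.
have : (0 < \int[mu]_(t in rowT @^-1` A) ((phi (rowT t) ^+ 2)%R)%:E)%E.
  apply: (@lt_le_trans _ _ (\int[mu]_(t in rowT @^-1` obox x ee) cst (dl ^+ 2)%:E t)%E).
    by rewrite integral_cst// mule_gt0// lte_fin exprn_gt0.
  apply: (@le_trans _ _ (\int[mu]_(t in rowT @^-1` obox x ee) ((phi (rowT t) ^+ 2)%R)%:E)%E).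
    apply: ge0_le_integral => //.
    - by move=> t _; rewrite lee_fin exprn_ge0// ltW.
    - exact: (measurable_funS mA oA mphi2).
    - move=> t /ob[_ h]; rewrite lee_fin -[leRHS]real_normK ?num_real// lerXn2r ?nnegrE//.
      exact: ltW.
  apply: ge0_subset_integral => //.
  by move=> t _; rewrite lee_fin sqr_ge0.
by rewrite intE ltxx.
Qed.

End CellSum.

(** The square root is Lipschitz away from 0, which keeps the order of the
error when passing from squares of norms to norms. *)
Lemma sqrt_perturbation (R : rcfType) (a b k : R) : 0 < a -> 0 <= k -> b <= a + k ->
  Num.sqrt b <= Num.sqrt a + k / Num.sqrt a.
Proof.
move=> a0 k0 bk; have sa : 0 < Num.sqrt a by rewrite sqrtr_gt0.
have r0 : 0 <= Num.sqrt a + k / Num.sqrt a by rewrite addr_ge0 ?divr_ge0 ?sqrtr_ge0.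
rewrite -(ler_sqr (sqrtr_ge0 b) r0).
have [b0|b0] := leP 0 b; last by rewrite (ler0_sqrtr (ltW b0)) expr0n /= sqr_ge0.
rewrite sqr_sqrtr// (le_trans bk)// sqrrD (sqr_sqrtr (ltW a0)).
have -> : Num.sqrt a * (k / Num.sqrt a) = k by rewrite mulrC divfK// gt_eqF.
have := sqr_ge0 (k / Num.sqrt a); rewrite mulr2n; lra.
Qed.

Section Sandwich.
Context {R : realType} {n : nat}.
Local Notation mu := (@lebesgue_tuple R n).
Local Notation rowT := (@row_of_tuple R n).
Implicit Types (x c e : 'rV[R]_n) (phi : 'rV[R]_n -> R).
Variables (J : 'I_n -> set R) (iJ : forall j, is_interval (J j)) (O : set 'rV[R]_n).
Local Notation A := (rect J).
Hypotheses (OA : O `<=` A) (oO : open O) (mA : measurable (rowT @^-1` A))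
  (fA : (mu (rowT @^-1` A) < +oo)%E).

Section General.
Variables (phi : 'rV[R]_n -> R) (M : R).
Hypotheses (mphi : measurable_fun (rowT @^-1` A) (phi \o rowT))
  (hM : forall x, A x -> `|phi x| <= M) (cphi : forall x, O x -> {for x, continuous phi})
  (M0 : 0 <= M).

(** If the norm of [phi] is positive, [sqrt_perturbation] applies.  Otherwise
[phi] vanishes on [O], hence so do [Aa] and [P] on the cells; then [cell_sum] is at
most a multiple of the square of the remainder, and its root is of the right
order again. *)
Lemma norm_sandwich (M' C H : R) (p : nat) : 0 <= M' -> 0 <= C -> 0 <= H ->
  exists2 K : R, 0 <= K & forall Z e (P Aa D : 'rV[R]_n -> 'rV[R]_n -> R) h,
    cells A O Z e -> 0 <= h <= H ->
  (forall c, continuous (P c)) -> (forall c, continuous (Aa c)) -> (forall c, continuous (D c)) ->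
  (forall c x, c \in Z -> box c e x -> `|P c x| <= Aa c x) ->
  (forall c x, c \in Z -> box c e x -> Aa c x <= M') ->
  (forall c x, c \in Z -> box c e x -> 0 <= D c x <= C * h ^+ p) ->
  (forall c x, c \in Z -> A x -> box c e x -> `|phi x - P c x| <= D c x) ->
  ((forall x, O x -> phi x = 0) -> forall c x, c \in Z -> box c e x -> Aa c x = 0) ->
  normL2s A phi <= Num.sqrt (cell_sum Z e P Aa D) <= normL2s A phi + K * h ^+ p.
Proof.
move=> M'0 C0 H0.
set I := integral_rV A (fun x => phi x ^+ 2).
set V := volume A; have V0 : 0 <= V by exact: volume_ge0.
pose d0 := C * H ^+ p.
have d00 : 0 <= d0 by rewrite mulr_ge0 ?exprn_ge0.
(* the first summand serves the case I = 0, the second the case 0 < I *)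
exists (C * (Num.sqrt (2 * V) + (2 * M + 2 * M' + 2 * d0) * V / Num.sqrt I)).
  rewrite mulr_ge0// addr_ge0 ?sqrtr_ge0// divr_ge0 ?sqrtr_ge0//.
  by rewrite mulr_ge0// addr_ge0// ?addr_ge0// mulr_ge0.
move=> Z e P Aa D h cZ /andP[h0 hH] cP cAa cD hP hA hD hT hz.
have dl0 : 0 <= C * h ^+ p by rewrite mulr_ge0 ?exprn_ge0.
set dl := C * h ^+ p in hD dl0 *.
have dld : dl <= d0 by rewrite ler_wpM2l// lerXn2r ?nnegrE.
have /andP[lo up] := cell_sum_bounds OA mA fA cZ mphi hM cP cAa cD hP hA hD hT M0 M'0 dl0.
rewrite -/I -/V in lo up.
apply/andP; split; first by rewrite ler_wsqrtr.
rewrite -mulrA [_ * h ^+ p]mulrC mulrA -/dl.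
have I0 : 0 <= I.
  by apply: fine_ge0; apply: integral_ge0 => t _; rewrite lee_fin sqr_ge0.
rewrite /normL2s -/I mulrDr.
have [Ipos|] := ltP 0 I.
  have k0 : 0 <= (2 * M * dl + 2 * M' * dl + 2 * dl ^+ 2) * V.
    by rewrite mulr_ge0// !addr_ge0// ?mulr_ge0 ?exprn_ge0.
  rewrite (le_trans (sqrt_perturbation Ipos k0 up))// lerD2l.
  rewrite (@le_trans _ _ (dl * ((2 * M + 2 * M' + 2 * d0) * V / Num.sqrt I)))//.
    rewrite mulrA ler_wpM2r ?invr_ge0 ?sqrtr_ge0// mulrA ler_wpM2r//.
    rewrite expr2 !mulrDr; apply: lerD; first by rewrite le_eqVlt; apply/orP; left; apply/eqP; ring.
    by rewrite mulrCA ler_wpM2l// ler_wpM2l.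
  by rewrite lerDr mulr_ge0 ?sqrtr_ge0.
move=> Ile; have {}I0 : I = 0 by apply/eqP; rewrite eq_le Ile.
have phi0 x : O x -> phi x = 0 by exact: (integral_sq_eq0 OA oO mA fA mphi hM cphi I0).
have A0 := hz phi0.
have P0 c x : c \in Z -> box c e x -> P c x = 0.
  by move=> c_Z bx; apply/eqP; rewrite -normr_le0 -(A0 c x c_Z bx); exact: hP.
have m0 : measurable_fun (rowT @^-1` A) ((fun=> 0 : R) \o rowT) by exact: measurable_cst.
have /andP[_ up2] := @cell_sum_bounds R n A O OA mA fA Z e (fun=> 0) P Aa D 0 0 dl cZ m0
  (fun x _ => ltac:(by rewrite normr0)) cP cAa cD hP
  (fun c x cZ bx => ltac:(by rewrite A0)) hD
  (fun c x cZ Ax bx => ltac:(rewrite P0// subrr normr0; by have /andP[] := hD c x cZ bx))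
  (lexx 0) (lexx 0) dl0.
rewrite I0 sqrtr0 add0r invr0 mulr0 mulr0 addr0.
have i0 : integral_rV A (fun=> (0 : R) ^+ 2) = 0.
  rewrite /integral_rV; under eq_Rintegral do rewrite expr0n.
  by rewrite /Rintegral integral0.
rewrite i0 add0r !mulr0 !mul0r !add0r -/V in up2.
rewrite (le_trans (ler_wsqrtr up2))// -[dl in leRHS]ger0_norm// -sqrtr_sqr -sqrtrM ?sqr_ge0//.
by have -> : 2 * dl ^+ 2 * V = dl ^+ 2 * (2 * V) by ring.
Qed.

End General.

Lemma box_side_interval' c e j : is_interval [set t : R | J j t /\ `|t - c 0 j| <= e 0 j].
Proof.
move=> s t [Js s1] [Jt t1] u /andP[su ut]; split; first by apply: (iJ Js Jt); rewrite su.
move: s1 t1; rewrite !ler_norml => /andP[s1 s2] /andP[t1 t2].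
by apply/andP; split; lra.
Qed.

Lemma abs_coord_continuous c (q : 'I_n) : continuous (fun x : 'rV[R]_n => `|x 0 q - c 0 q|).
Proof.
move=> x.
have h : {for x, continuous (fun x : 'rV[R]_n => x 0 q)} by exact: coord_continuous.
have k : {for x, continuous (fun _ : 'rV[R]_n => c 0 q)} by exact: cst_continuous.
exact: (cvg_norm (cvgB h k)).
Qed.

Lemma coordB_continuous c (q : 'I_n) : continuous (fun x : 'rV[R]_n => x 0 q - c 0 q).
Proof.
move=> x.
have h : {for x, continuous (fun x : 'rV[R]_n => x 0 q)} by exact: coord_continuous.
have k : {for x, continuous (fun _ : 'rV[R]_n => c 0 q)} by exact: cst_continuous.
exact: (cvgB h k).
Qed.

Lemma continuous_sumE (I : Type) (r : seq I) (F : I -> 'rV[R]_n -> R) :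
  (forall i, continuous (F i)) -> continuous (fun x => \sum_(i <- r) F i x).
Proof.
move=> h x; elim: r => [|i r IH].
  rewrite (_ : (fun x => _) = fun=> 0); last by apply/funext => y; rewrite big_nil.
  exact: cst_continuous.
rewrite (_ : (fun x => _) = fun x => F i x + \sum_(i <- r) F i x); last first.
  by apply/funext => y; rewrite big_cons.
exact: (cvgD (h i x) IH).
Qed.

Lemma continuousME (f g : 'rV[R]_n -> R) : continuous f -> continuous g ->
  continuous (fun x => f x * g x).
Proof. by move=> hf hg x; exact: (cvgM (hf x) (hg x)). Qed.

Lemma continuousDE (f g : 'rV[R]_n -> R) : continuous f -> continuous g ->
  continuous (fun x => f x + g x).
Proof. by move=> hf hg x; exact: (cvgD (hf x) (hg x)). Qed.

Lemma continuous_cstE (k : R) : continuous (fun _ : 'rV[R]_n => k).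
Proof. by move=> x; exact: cst_continuous. Qed.

Section Zero.
Variables (phi : 'rV[R]_n -> R) (M H : R).
Hypotheses (mphi : measurable_fun (rowT @^-1` A) (phi \o rowT))
  (hM : forall x, A x -> `|phi x| <= M) (cphi : forall x, O x -> {for x, continuous phi})
  (dphi : forall z q, A z -> derivable phi z (delta_mx 0 q))
  (M0 : 0 <= M) (H0 : 0 <= H).

(** [norm_sandwich] with Taylor polynomials of degree 0: the remainder is
bounded by [rect_lipschitz] on the intersection of the cell with the domain. *)
Lemma U0_sandwich : exists2 K : R, 0 <= K & forall Z e b h,
  cells A O Z e -> 0 <= h <= H -> (forall j, e 0 j <= h) ->
  (forall c q, c \in Z -> 0 <= b c q <= M) ->
  (forall c z q, c \in Z -> A z -> box c e z -> `|pder q phi z| <= b c q) ->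
  normL2s A phi <= U0 Z e phi b <= normL2s A phi + K * h.
Proof.
have C0 : 0 <= n%:R * M by rewrite mulr_ge0.
have [K K0 hK] := norm_sandwich mphi hM cphi M0 1 M0 C0 H0.
exists K => // Z e b h cZ hH eh hb hp.
have [_ e0 cO _ _] := cZ.
rewrite -[K * h]/(K * h ^+ 1); apply: hK => //.
- by move=> c; exact: continuous_cstE.
- by move=> c; exact: continuous_cstE.
- move=> c; apply: continuous_sumE => q; apply: continuousME; first exact: continuous_cstE.
  exact: abs_coord_continuous.
- move=> c x c_Z _; apply: hM; apply: OA; exact: (cells_center cZ c_Z).
- move=> c x c_Z bx; rewrite sumr_ge0 /=; last first.
    by move=> q _; rewrite mulr_ge0//; have /andP[] := hb c q c_Z.
  rewrite expr1 -mulrA mulr_natl -[X in _ *+ X](card_ord n) -sumr_const.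
  apply: ler_sum => q _; have /andP[b0 bM] := hb c q c_Z.
  by rewrite ler_pM// (le_trans (bx q)).
- move=> c x c_Z Ax bx.
  have Oc := cells_center cZ c_Z.
  apply: (@rect_lipschitz R n (fun j => [set t : R | J j t /\ `|t - c 0 j| <= e 0 j])
    (fun j => @box_side_interval' c e j)).
  + by move=> z q Jz; apply: dphi => j; case: (Jz j).
  + by move=> z q Jz; apply: hp => // j; case: (Jz j).
  + by move=> j; split; [exact: OA|rewrite subrr normr0 ltW].
  + by move=> j; split; [exact: Ax|exact: bx].
- by move=> phi0 c x c_Z _; rewrite phi0 ?normr0//; exact: (cells_center cZ c_Z).
Qed.

Hypotheses (d2phi : forall z q l, A z -> derivable (pder q phi) z (delta_mx 0 l))
  (hM1 : forall z q, O z -> `|pder q phi z| <= M).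

(** [norm_sandwich] with Taylor polynomials of degree 1 and [rect_taylor2].  If
[phi] vanishes on the open set [O], so do its partial derivatives, which is what
the degenerate case of [norm_sandwich] asks for. *)
Lemma U1_sandwich : exists2 K : R, 0 <= K & forall Z e b h,
  cells A O Z e -> 0 <= h <= H -> (forall j, e 0 j <= h) ->
  (forall c q l, c \in Z -> 0 <= b c q l <= M) -> (forall c q l, b c q l = b c l q) ->
  (forall c z q l, c \in Z -> A z -> box c e z -> `|pder l (pder q phi) z| <= b c q l) ->
  normL2s A phi <= U1 Z e phi b <= normL2s A phi + K * h ^+ 2.
Proof.
have C0 : 0 <= 2^-1 * (n%:R * (n%:R * M)) by rewrite !mulr_ge0.
have M'0 : 0 <= M + n%:R * (M * H) by rewrite addr_ge0// !mulr_ge0.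
have [K K0 hK] := norm_sandwich mphi hM cphi M0 2 M'0 C0 H0.
exists K => // Z e b h cZ hH eh hb bC hp.
have [_ e0 cO _ _] := cZ; have /andP[h0 hle] := hH.
have bx_le c x q : box c e x -> `|x 0 q - c 0 q| <= h by move=> bx; rewrite (le_trans (bx q)).
apply: hK => //.
- move=> c; apply: continuousDE; first exact: continuous_cstE.
  apply: continuous_sumE => q; apply: continuousME; first exact: continuous_cstE.
  exact: coordB_continuous.
- move=> c; apply: continuousDE; first exact: continuous_cstE.
  apply: continuous_sumE => q; apply: continuousME; first exact: continuous_cstE.
  exact: abs_coord_continuous.
- move=> c; apply: continuousME; first exact: continuous_cstE.
  apply: continuous_sumE => q; apply: continuous_sumE => l; apply: continuousME.
    apply: continuousME; first exact: continuous_cstE.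
    exact: abs_coord_continuous.
  exact: abs_coord_continuous.
- move=> c x c_Z bx; rewrite (le_trans (ler_normD _ _))// lerD2l.
  rewrite (le_trans (ler_norm_sum _ _ _))//; apply: ler_sum => q _.
  by rewrite normrM.
- move=> c x c_Z bx; have Oc := cells_center cZ c_Z.
  apply: lerD; first by apply: hM; exact: OA.
  rewrite mulr_natl -[X in _ *+ X](card_ord n) -sumr_const.
  apply: ler_sum => q _; rewrite ler_pM ?hM1//.
  exact: le_trans (bx_le c x q bx) hle.
- move=> c x c_Z bx; apply/andP; split.
    rewrite mulr_ge0// sumr_ge0// => q _; rewrite sumr_ge0// => l _.
    by rewrite !mulr_ge0//; have /andP[] := hb c q l c_Z.
  rewrite -!mulrA ler_wpM2l//.
  rewrite mulr_natl -[X in _ *+ X](card_ord n) -sumr_const; apply: ler_sum => q _.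
  rewrite mulr_natl -[X in _ *+ X](card_ord n) -sumr_const; apply: ler_sum => l _.
  have /andP[b0 bM] := hb c q l c_Z.
  rewrite expr2 mulrA -mulrA -[leRHS]mulrA ler_pM// ?mulr_ge0//.
  by rewrite ler_pM// bx_le.
- move=> c x c_Z Ax bx; have Oc := cells_center cZ c_Z.
  apply: (@rect_taylor2 R n (fun j => [set t : R | J j t /\ `|t - c 0 j| <= e 0 j])
    (fun j => @box_side_interval' c e j)).
  + by move=> q l; exact: bC.
  + by move=> z q Jz; apply: dphi => j; case: (Jz j).
  + by move=> z q l Jz; apply: d2phi => j; case: (Jz j).
  + by move=> z q l Jz; apply: hp => // j; case: (Jz j).
  + by move=> j; split; [exact: OA|rewrite subrr normr0 ltW].
  + by move=> j; split; [exact: Ax|exact: bx].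
- move=> phi0 c x c_Z _; have Oc := cells_center cZ c_Z.
  rewrite phi0// normr0 add0r big1// => q _.
  have -> : pder q phi c = 0.
    rewrite (@pder_eq_on _ _ O phi (fun=> 0) q c oO phi0 Oc).
    by apply: is_derive_pderE; exact: is_derive_cst.
  by rewrite normr0 mul0r.
Qed.

End Zero.
End Sandwich.

(** * Geometry of the meshes *)

Section UnitCube.
Context {R : realType} {d : nat}.
Implicit Types (x y z : 'rV[R]_d).

Definition unit_side (j : 'I_d) : set R := [set t | 0 < t < 1].

Lemma unit_side_interval j : is_interval (unit_side j).
Proof.
by move=> s t /andP[s0 _] /andP[_ t1] u /andP[su ut]; apply/andP; split; lra.
Qed.

Lemma open_Omega : open (Omega d : set 'rV[R]_d).
Proof.
have -> : Omega d = obox (const_mx 2^-1) (const_mx 2^-1) :> set 'rV[R]_d.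
  apply/seteqP; split => x h j; have := h j; rewrite !mxE.
    by move=> /andP[? ?]; rewrite ltr_norml; apply/andP; split; lra.
  by rewrite ltr_norml => /andP[? ?]; apply/andP; split; lra.
by apply: open_obox => j; rewrite mxE invr_gt0.
Qed.

Lemma closure_Omega_bounds x j : closure (Omega d) x -> 0 <= x 0 j <= 1.
Proof.
move=> cx; apply/andP; split; rewrite leNgt; apply/negP => xj.
  have [|z [Oz hz]] := cx [set z | forall k, `|z 0 k - x 0 k| < - x 0 j].
    by apply/nbhs_rVP; exists (- x 0 j) => //; lra.
  have /andP[z0 _] := Oz j; have := hz j; rewrite ltr_norml => /andP[_]; lra.
have [|z [Oz hz]] := cx [set z | forall k, `|z 0 k - x 0 k| < x 0 j - 1].
  by apply/nbhs_rVP; exists (x 0 j - 1) => //; lra.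
have /andP[_ z1] := Oz j; have := hz j; rewrite ltr_norml => /andP[+ _]; lra.
Qed.

Lemma unit_side_measure (j : 'I_d) : lebesgue_measure (unit_side j : set (measurableTypeR R)) = 1%E.
Proof.
have -> : unit_side j = `]0, 1[%classic by apply/seteqP; split => t; rewrite /= in_itv.
by rewrite lebesgue_measure_itv /= lte_fin ltr01 oppr0 adde0.
Qed.

Lemma measurable_unit_side (j : 'I_d) : measurable (unit_side j : set (measurableTypeR R)).
Proof. by apply: is_interval_measurable; exact: unit_side_interval. Qed.

Lemma measurable_Omega : measurable (@row_of_tuple R d @^-1` Omega d).
Proof. exact: (measurable_rect measurable_unit_side). Qed.

Lemma volume_Omega_lty : (lebesgue_tuple d (@row_of_tuple R d @^-1` Omega d) < +oo)%E.
Proof.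
apply: (@lebesgue_rect_lty R d unit_side); first exact: measurable_unit_side.
by move=> j; rewrite unit_side_measure ltry.
Qed.

End UnitCube.

Section Mesh.
Context {R : realType} {d : nat}.
Variables (T : R) (P : mesh R d).
Hypotheses (d0 : (0 < d)%N) (T0 : 0 < T) (meshP : is_mesh T P).

(** Pushing one coordinate of the centre to either end of the cell gives a
point of the cell, hence of the closed cube. *)
Lemma mesh_box_side y j : y \in centers P ->
  0 <= y 0 j - radx P 0 j /\ y 0 j + radx P 0 j <= 1.
Proof.
move=> yP; have [[r0 _] [_ _ _ cover] _] := meshP.
have corner s : `|s| <= radx P 0 j -> 0 <= y 0 j + s <= 1.
  move=> hs.
  have b : box y (radx P) (upd y j (y 0 j + s)).
    move=> k; rewrite mxE; case: eqP => [->|_]; first by rewrite addrC addKr.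
    by rewrite subrr normr0 ltW.
  have : closure (Omega d) (upd y j (y 0 j + s)) by rewrite -cover; exists y.
  by move=> /(closure_Omega_bounds j); rewrite mxE eqxx.
have nr : `|radx P 0 j| = radx P 0 j by rewrite ger0_norm// ltW.
split.
  by have := corner (- radx P 0 j); rewrite normrN nr => /(_ (lexx _))/andP[].
by have := corner (radx P 0 j); rewrite nr => /(_ (lexx _))/andP[].
Qed.

Lemma mesh_cells : cells (rect (@unit_side R d)) (Omega d) (centers P) (radx P).
Proof.
have [[r0 _] [uC cO disj cover] _] := meshP; split=> //.
- move=> y yP x ox j; have [h1 h2] := mesh_box_side j yP.
  by have := ox j; rewrite ltr_norml => /andP[? ?]; apply/andP; split; lra.
- move=> x Ox; have : closure (Omega d) x by exact: subset_closure.
  by rewrite -cover => -[y /= yP bx]; exists y.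
- move=> y y' x yP y'P ox ox'; apply/eqP; apply: contraT => yy'.
  have := disj y y' yP y'P yy'.
  have oi c : obox c (radx P) `<=` interior (box c (radx P)).
    rewrite -open_subsetE; first exact: obox_sub_box.
    exact: open_obox.
  by move/seteqP => [/(_ x (conj (oi _ _ ox) (oi _ _ ox')))].
Qed.

Lemma mesh_center_Omega y : y \in centers P -> Omega d y.
Proof. by move=> yP; exact: (cells_center mesh_cells yP). Qed.

Lemma mesh_has_center : exists y, y \in centers P.
Proof.
have [_ _ _ hA _] := mesh_cells.
have [|y yP _] := hA (const_mx 2^-1); last by exists y.
by move=> j; rewrite mxE; apply/andP; split; lra.
Qed.

Lemma radx_le1 j : radx P 0 j <= 1.
Proof. by have [y yP] := mesh_has_center; have := mesh_box_side j yP; lra. Qed.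

Lemma radx_gt0 j : 0 < radx P 0 j.
Proof. by have [[r0 _] _ _] := meshP. Qed.

Lemma radt_gt0 : 0 < radt P.
Proof. by have [[_ r0] _ _] := meshP. Qed.

Lemma radx_le_h j : radx P 0 j <= h_Omega P.
Proof. by rewrite /h_Omega; exact: le_bigmax. Qed.

Lemma h_Omega_ge0 : 0 <= h_Omega P.
Proof. by rewrite /h_Omega; exact: bigmax_ge_id. Qed.

Lemma h_Omega_le1 : h_Omega P <= 1.
Proof. by rewrite /h_Omega; apply: bigmax_le => // j _; exact: radx_le1. Qed.

Lemma mesh_time_side t : t \in times P -> 0 <= t - radt P /\ t + radt P <= T.
Proof.
move=> tP; have [_ _ [_ _ _ cover]] := meshP; have r0 := radt_gt0.
have corner s : t - radt P <= s <= t + radt P -> 0 <= s <= T.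
  move=> hs; have : `[0, T]%classic s by rewrite -cover; exists t => //=; rewrite in_itv.
  by rewrite /= in_itv.
have /andP[? _] : 0 <= t - radt P <= T by apply: corner; rewrite lexx /=; lra.
have /andP[_ ?] : 0 <= t + radt P <= T by apply: corner; rewrite lexx andbT; lra.
by split.
Qed.

Lemma mesh_has_time : exists t, t \in times P.
Proof.
have [_ _ [_ _ _ cover]] := meshP.
have : `[0, T]%classic T by rewrite /= in_itv /= lexx ltW.
by rewrite -cover => -[t /= tP _]; exists t.
Qed.

Lemma radt_leT : radt P <= T.
Proof.
by have [t tP] := mesh_has_time; have [? ?] := mesh_time_side tP; have := radt_gt0; lra.
Qed.

Lemma h_P_ge0 : 0 <= h_P P.
Proof. by rewrite le_max h_Omega_ge0. Qed.

Lemma h_P_le : h_P P <= 1 + T.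
Proof.
rewrite ge_max; have := h_Omega_le1; have := radt_leT; have := T0 => ? ? ?.
by apply/andP; split; lra.
Qed.

Lemma stpoint_sidx (x : 'rV[R]_d) t j : stpoint x t 0 (sidx j) = x 0 j.
Proof. by rewrite mxE liftK. Qed.

Lemma stpoint_max (x : 'rV[R]_d) t : stpoint x t 0 ord_max = t.
Proof. by rewrite mxE unlift_none. Qed.

Lemma space_stpoint (x : 'rV[R]_d) t : Defs.space (stpoint x t) = x.
Proof. by apply/rowP => j; rewrite mxE stpoint_sidx. Qed.

Lemma time_stpoint (x : 'rV[R]_d) t : time (stpoint x t) = t.
Proof. by rewrite /time stpoint_max. Qed.

Lemma spacetime_ind (Q : 'I_d.+1 -> Prop) : (forall j, Q (sidx j)) -> Q ord_max -> forall i, Q i.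
Proof. by move=> h h' i; case: (unliftP ord_max i) => [j|] ->; [exact: h|]. Qed.

Definition st_side (i : 'I_d.+1) : set R :=
  if unlift ord_max i is Some _ then [set t | 0 < t < 1] else [set t | 0 < t <= T].

(** Regularity is stated on open sets, and the space-time cylinder, which
contains its final time, is not open. *)
Definition st_open : set 'rV[R]_d.+1 := [set z | Omega d (Defs.space z) /\ 0 < time z < T].

Lemma st_side_sidx j : st_side (sidx j) = [set t | 0 < t < 1].
Proof. by rewrite /st_side liftK. Qed.

Lemma st_side_max : st_side ord_max = [set t | 0 < t <= T].
Proof. by rewrite /st_side unlift_none. Qed.

Lemma OmegaT_rect : OmegaT T = rect st_side :> set 'rV[R]_d.+1.
Proof.
apply/seteqP; split => z.
  move=> [Oz tz]; apply: spacetime_ind => [j|]; last by rewrite st_side_max.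
  by rewrite st_side_sidx; have := Oz j; rewrite mxE.
move=> h; split; last by have := h ord_max; rewrite st_side_max.
by move=> j; have := h (sidx j); rewrite st_side_sidx mxE.
Qed.

Lemma st_side_interval i : is_interval (st_side i).
Proof.
rewrite /st_side; case: unliftP => [j _|_] s t /andP[s0 _] /andP[_ t1] u /andP[su ut];
  by apply/andP; split; lra.
Qed.

Lemma measurable_OmegaT : measurable (@row_of_tuple R d.+1 @^-1` rect st_side).
Proof.
by apply: measurable_rect => i; apply: is_interval_measurable; exact: st_side_interval.
Qed.

Lemma volume_OmegaT_lty : (lebesgue_tuple d.+1 (@row_of_tuple R d.+1 @^-1` rect st_side) < +oo)%E.
Proof.
apply: lebesgue_rect_lty => i; first by apply: is_interval_measurable; exact: st_side_interval.
rewrite /st_side; case: (unlift _ _) => [j|].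
  by have := @unit_side_measure R d j; rewrite /unit_side => ->; rewrite ltry.
have -> : [set t | 0 < t <= T] = `]0, T]%classic by apply/seteqP; split => t; rewrite /= in_itv.
by rewrite lebesgue_measure_itv /= lte_fin T0 -EFinB ltry.
Qed.

Lemma st_open_obox : st_open = obox (stpoint (const_mx 2^-1) (T / 2)) (stpoint (const_mx 2^-1) (T / 2)).
Proof.
apply/seteqP; split => z.
  move=> [Oz tz]; apply: spacetime_ind => [j|].
    have := Oz j; rewrite !stpoint_sidx !mxE => /andP[? ?].
    by rewrite ltr_norml; apply/andP; split; lra.
  rewrite !stpoint_max; move: tz; rewrite /Defs.time => /andP[? ?].
  by rewrite ltr_norml; apply/andP; split; lra.
move=> h; split.
  move=> j; have := h (sidx j); rewrite !stpoint_sidx !mxE ltr_norml => /andP[? ?].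
  by apply/andP; split; lra.
have := h ord_max; rewrite !stpoint_max /time ltr_norml => /andP[? ?].
by apply/andP; split; lra.
Qed.

Lemma open_st_open : open st_open.
Proof.
rewrite st_open_obox; apply: open_obox; apply: spacetime_ind => [j|].
  by rewrite stpoint_sidx mxE invr_gt0.
by rewrite stpoint_max divr_gt0.
Qed.

Lemma st_open_sub : st_open `<=` rect st_side.
Proof.
rewrite -OmegaT_rect => z [Oz /andP[t0 t1]]; split=> //.
by rewrite t0 ltW.
Qed.

Lemma mem_st_centers z : z \in st_centers P ->
  exists y t, [/\ y \in centers P, t \in times P & z = stpoint y t].
Proof. by move=> /allpairsP[[y t] /= [yP tP ->]]; exists y, t. Qed.

Lemma st_box y t (z : 'rV[R]_d.+1) : box (stpoint y t) (st_rad P) z <->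
  box y (radx P) (Defs.space z) /\ `|time z - t| <= radt P.
Proof.
split=> [h|[h ht]].
  split; last by have := h ord_max; rewrite !stpoint_max.
  by move=> j; have := h (sidx j); rewrite !stpoint_sidx mxE.
apply: spacetime_ind => [j|]; last by rewrite !stpoint_max.
by have := h j; rewrite !stpoint_sidx mxE.
Qed.

Lemma st_obox y t (z : 'rV[R]_d.+1) : obox (stpoint y t) (st_rad P) z <->
  obox y (radx P) (Defs.space z) /\ `|time z - t| < radt P.
Proof.
split=> [h|[h ht]].
  split; last by have := h ord_max; rewrite !stpoint_max.
  by move=> j; have := h (sidx j); rewrite !stpoint_sidx mxE.
apply: spacetime_ind => [j|]; last by rewrite !stpoint_max.
by have := h j; rewrite !stpoint_sidx mxE.
Qed.

(** Two space-time cells with a common interior point agree in their spatial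
and temporal factors separately. *)
Lemma mesh_st_cells : cells (rect st_side) st_open (st_centers P) (st_rad P).
Proof.
have [_ _ cO cA cdisj] := mesh_cells.
have [_ [uC _ _ _] [uT tO tdisj tcover]] := meshP.
split.
- apply: allpairs_uniq => // -[y t] [y' t'] _ _ /= h.
  by congr pair; [rewrite -(space_stpoint y t) h space_stpoint|rewrite -(time_stpoint y t) h time_stpoint].
- apply: spacetime_ind => [j|]; first by rewrite stpoint_sidx radx_gt0.
  by rewrite stpoint_max radt_gt0.
- move=> z0 /mem_st_centers[y [t [yP tP ->]]] z /st_obox[oy ot]; split.
    exact: (cO y yP).
  have [h1 h2] := mesh_time_side tP.
  by move: ot; rewrite ltr_norml => /andP[? ?]; apply/andP; split; lra.
- rewrite -OmegaT_rect => z [Oz tz].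
  have [y yP by_] := cA _ Oz.
  have : `[0, T]%classic (time z) by rewrite /= in_itv /=; move: tz => /andP[? ?]; apply/andP; split; lra.
  rewrite -tcover => -[t /= tP]; rewrite in_itv /= => /andP[? ?].
  exists (stpoint y t); first by apply/allpairsP; exists (y, t).
  by apply/st_box; split=> //; rewrite ler_norml; apply/andP; split; lra.
- move=> z0 z1 z /mem_st_centers[y [t [yP tP ->]]] /mem_st_centers[y' [t' [y'P t'P ->]]].
  move=> /st_obox[oy ot] /st_obox[oy' ot'].
  have -> : y = y' by exact: cdisj oy oy'.
  suff -> : t = t' by [].
  apply/eqP; apply: contraT => tt'.
  have := tdisj t t' tP t'P tt'.
  have oi s : `|time z - s| < radt P -> interior `[s - radt P, s + radt P] (time z).
    move=> hs; have : `]s - radt P, s + radt P[%classic (time z).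
      by move: hs; rewrite /= in_itv /= ltr_norml => /andP[? ?]; apply/andP; split; lra.
    have oI : open `]s - radt P, s + radt P[%classic by exact: interval_open.
    have : `]s - radt P, s + radt P[%classic `<=` `[s - radt P, s + radt P]%classic.
      by move=> u; rewrite /= !in_itv /= => /andP[? ?]; apply/andP; split; lra.
    by rewrite (open_subsetE _ oI); apply.
  by move/seteqP => [/(_ (time z) (conj (oi _ ot) (oi _ ot')))].
Qed.

Lemma st_rad_le_h i : st_rad P 0 i <= h_P P.
Proof.
elim/spacetime_ind: i => [j|]; rewrite /h_P le_max.
  by rewrite stpoint_sidx radx_le_h.
by rewrite stpoint_max lexx orbT.
Qed.

Lemma st_rad_gt0 i : 0 < st_rad P 0 i.
Proof. by have [_ + _ _ _] := mesh_st_cells. Qed.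

End Mesh.

(** * Bounds on the initial data *)

Section Data.
Context {R : realType} {d : nat}.
Implicit Types (x y z e : 'rV[R]_d) (a : 'rV[R]_d -> R).
Local Notation Om := (Omega d : set 'rV[R]_d).

Lemma within_Omega x : Om x -> within Om (nbhs x) = nbhs x.
Proof.
move=> Ox; have nO : nbhs x Om by apply: open_nbhs_nbhs; split=> //; exact: open_Omega.
apply/seteqP; split => B; rewrite /within /=.
  by move=> h; apply: filterS (filterI nO h) => z [Oz]; apply.
by apply: filterS => z.
Qed.

Lemma cvg_at_point (f : 'rV[R]_d -> R) x : cvg (f @ x) -> {for x, continuous f}.
Proof.
move=> /cvg_ex[l fl]; rewrite /prop_for /continuous_at.
suff -> : f x = l by [].
apply/eqP; apply: contraT => fxl.
have e0 : 0 < `|l - f x| by rewrite normr_gt0 subr_eq0 eq_sym.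
move/cvgrPdist_lt : fl => /(_ _ e0) /nbhs_singleton.
by rewrite ltxx.
Qed.

Lemma Cm_closure_Cm_on m a : Cm_closure m a -> Cm_on Om m a.
Proof.
have ct f : (forall x, closure Om x -> cvg (f @ within Om (nbhs x))) ->
    forall x, Om x -> {for x, continuous (f : 'rV[R]_d -> R)}.
  move=> h x Ox; apply: cvg_at_point; rewrite -(within_Omega Ox).
  exact: (h x (subset_closure Ox)).
elim: m a => [|m IH] a /= [h1 h2]; split=> //; first exact: ct.
  exact: ct.
by move=> i; have [hd hC] := h2 i; split=> //; exact: IH.
Qed.

(** Inside Omega the limit defining [mpder_closure] is a value, so the
hypothesis on the data bounds the derivatives themselves. *)
Lemma mpder_closureE m a b x : Cm_closure m a -> (mi_deg b <= m)%N -> Om x ->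
  mpder_closure b a x = mpder b a x.
Proof.
move=> ha bm Ox; rewrite /mpder_closure within_Omega//.
have hC : Cm_on Om 0 (mpder b a) by exact: (@Cm_on_mpder _ _ Om m 0 b a bm (Cm_closure_Cm_on ha)).
apply: cvg_lim; first exact: norm_hausdorff.
exact: (Cm_on_continuous hC Ox).
Qed.

Lemma closed_unit_box : compact [set e : 'rV[R]_d | forall j, `[0, 1]%classic (e ord0 j)].
Proof. by apply: (@rV_compact R d (fun=> `[0, 1]%classic)) => j; exact: segment_compact. Qed.

Lemma compact_closure_Omega : compact (closure Om).
Proof.
apply: subclosed_compact closed_unit_box _; first exact: closed_closure.
move=> x cx j /=; rewrite in_itv /=; exact: closure_Omega_bounds.
Qed.

Section DataBounds.
Variables (m : nat) (a : 'rV[R]_d -> R) (D : mindex d -> 'rV[R]_d -> 'rV[R]_d -> R).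
Hypothesis hD : data_assumption m a D.

Lemma data_Cm_on : Cm_on Om m a.
Proof. by case: hD => _ h _; exact: Cm_closure_Cm_on. Qed.

Lemma data_le b y e x : (mi_deg b <= m)%N -> Om y -> nonneg_rV e -> Om x -> box y e x ->
  `|mpder b a x| <= D b y e.
Proof.
move=> bm Oy e0 Ox bx; have [_ hC /(_ b bm)[_ _ h]] := hD.
rewrite -(mpder_closureE hC bm Ox).
by apply: h => //; exact: subset_closure.
Qed.

(** A locally bounded function is bounded on a compact set; here the centre
ranges over the closed cube and the radius vector over [0, 1]^d. *)
Lemma data_bounded b : (mi_deg b <= m)%N ->
  exists M : R, forall y e, Om y -> (forall j, 0 <= e 0 j <= 1) -> D b y e <= M.
Proof.
move=> bm; have [_ _ /(_ b bm)[_ hloc _]] := hD.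
pose K : set ('rV[R]_d * 'rV[R]_d) :=
  closure Om `*` [set e : 'rV[R]_d | forall j, `[0, 1]%classic (e ord0 j)].
have cK : compact K by apply: compact_setX; [exact: compact_closure_Omega|exact: closed_unit_box].
have ncK := (compact_near_coveringP K).1 cK.
pose Q (M : R) (p : 'rV[R]_d * 'rV[R]_d) :=
  closure Om p.1 -> nonneg_rV p.2 -> D b p.1 p.2 <= M.
(* compactness as a near covering: the bound [Q M] holds near each point for all
   large M, hence on all of [K] for some M *)
have [|M hM] := @filter_ex _ (@pinfty_nbhs R) _ _ (ncK R (@pinfty_nbhs R) Q _ _).
  move=> [y e] [/= cy he].
  have e0 : nonneg_rV e by move=> j; have := he j; rewrite /= in_itv /= => /andP[].
  have [M0 hM0] := hloc y e cy e0.
  exists ([set p | closure Om p.1 -> nonneg_rV p.2 -> D b p.1 p.2 <= M0], [set M | M0 <= M]).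
    split; first exact: hM0.
    by exists M0; split; [exact: num_real|move=> M /ltW].
  by move=> [p M] /= [hp hM] cp np; rewrite (le_trans (hp cp np)).
exists M => y e Oy he; apply: (hM (y, e)) => /=.
- split; first exact: subset_closure.
  by move=> j /=; rewrite in_itv /=; exact: he.
- exact: subset_closure.
- by move=> j; have /andP[] := he j.
Qed.

(** The box of radius 1 around the centre of the cube contains the cube. *)
Lemma data_derivative_bounded b : (mi_deg b <= m)%N ->
  exists M : R, forall x, Om x -> `|mpder b a x| <= M.
Proof.
move=> bm; have [M hM] := data_bounded bm.
pose y : 'rV[R]_d := const_mx 2^-1; pose e : 'rV[R]_d := const_mx 1.
have Oy : Om y by move=> j; rewrite mxE; apply/andP; split; lra.
exists M => x Ox; apply: le_trans (hM y e Oy _); last first.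
  by move=> j; rewrite mxE ler01 lexx.
apply: data_le => //; first by move=> j; rewrite mxE.
move=> j; have /andP[? ?] := Ox j; rewrite !mxE ler_norml; apply/andP; split; lra.
Qed.

End DataBounds.
End Data.

(** * Space-time slices and the boundary factor *)

Section Slices.
Context {R : realType} {d : nat}.
Implicit Types (x y : 'rV[R]_d) (z : 'rV[R]_d.+1) (F : 'rV[R]_d.+1 -> R) (G : 'rV[R]_d -> R).

Lemma stpoint_add (h t : R) (j : 'I_d) x :
  stpoint (h *: delta_mx 0 j + x) t = h *: delta_mx 0 (sidx j) + stpoint x t.
Proof.
apply/rowP; apply: spacetime_ind => [k|].
  rewrite stpoint_sidx !mxE /= liftK (inj_eq lift_inj).
  by [].
rewrite stpoint_max !mxE unlift_none /= (negbTE (neq_lift _ _)) mulr0 add0r.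
by [].
Qed.

Lemma space_add_sidx (h : R) (j : 'I_d) z :
  Defs.space (h *: delta_mx 0 (sidx j) + z) = h *: delta_mx 0 j + Defs.space z.
Proof. by apply/rowP => k; rewrite !mxE (inj_eq lift_inj). Qed.

Lemma space_add_max (h : R) z :
  Defs.space (h *: delta_mx 0 ord_max + z) = Defs.space z.
Proof. by apply/rowP => k; rewrite !mxE /= eq_sym (negbTE (neq_lift _ _)) mulr0 add0r. Qed.

Lemma is_derive_slice F t j x : derivable F (stpoint x t) (delta_mx 0 (sidx j)) ->
  is_derive x (delta_mx 0 j) (fun x => F (stpoint x t)) (pder (sidx j) F (stpoint x t)).
Proof.
have E : (fun h : R => h^-1 *: (F (stpoint (h *: delta_mx 0 j + x) t) - F (stpoint x t))) =
  (fun h : R => h^-1 *: (F (h *: delta_mx 0 (sidx j) + stpoint x t) - F (stpoint x t))).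
  by apply/funext => h; rewrite stpoint_add.
move=> hd; apply: DeriveDef.
  by move: hd; rewrite /derivable -E.
by rewrite /pder /derive -E.
Qed.

Lemma is_derive_space_sidx G j z : derivable G (Defs.space z) (delta_mx 0 j) ->
  is_derive z (delta_mx 0 (sidx j)) (fun z => G (Defs.space z)) (pder j G (Defs.space z)).
Proof.
have E : (fun h : R => h^-1 *: (G (Defs.space (h *: delta_mx 0 (sidx j) + z)) - G (Defs.space z))) =
  (fun h : R => h^-1 *: (G (h *: delta_mx 0 j + Defs.space z) - G (Defs.space z))).
  by apply/funext => h; rewrite space_add_sidx.
move=> hd; apply: DeriveDef.
  by move: hd; rewrite /derivable -E.
by rewrite /pder /derive -E.
Qed.

Lemma is_derive_space_max G z :
  is_derive z (delta_mx 0 ord_max) (fun z => G (Defs.space z)) 0.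
Proof.
have E : (fun h : R => h^-1 *: (G (Defs.space (h *: delta_mx 0 ord_max + z)) - G (Defs.space z))) =
  (fun h : R => h^-1 *: (cst (G (Defs.space z)) (h *: delta_mx 0 ord_max + z) - cst (G (Defs.space z)) z)).
  by apply/funext => h; rewrite space_add_max.
have [hd hv] := is_derive_cst (G (Defs.space z)) z (delta_mx 0 ord_max).
apply: DeriveDef.
  by move: hd; rewrite /derivable -E.
by rewrite -hv /derive -E.
Qed.

Lemma continuous_slice F t x : {for stpoint x t, continuous F} ->
  {for x, continuous (fun x => F (stpoint x t))}.
Proof.
move=> cF B nB; have := cF B nB; rewrite /= => /nbhs_rVP[e e0 he].
apply/nbhs_rVP; exists e => // x' hx; apply: he; apply: spacetime_ind => [j|].
  by rewrite !stpoint_sidx.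
by rewrite !stpoint_max subrr normr0.
Qed.

Lemma continuous_space G z : {for Defs.space z, continuous G} ->
  {for z, continuous (fun z => G (Defs.space z))}.
Proof.
move=> cG B nB; have := cG B nB; rewrite /= => /nbhs_rVP[e e0 he].
apply/nbhs_rVP; exists e => // z' hz; apply: he => j.
by rewrite !mxE; exact: hz.
Qed.

Lemma smooth_slice F t : smooth F -> smooth (fun x => F (stpoint x t)).
Proof.
move=> hF m; elim: m F hF => [|m IH] F hF.
  by split=> // x _; apply: continuous_slice; exact: smooth_continuous.
apply: (@Cm_on_intro _ _ _ openT _ _ (fun i x => pder (sidx i) F (stpoint x t))).
- by move=> x _; apply: continuous_slice; exact: smooth_continuous.
- by move=> i x _; apply: is_derive_slice; exact: smooth_derivable.
- by move=> i; apply: IH; exact: smooth_pder.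
Qed.

Lemma smooth_space G : smooth G -> smooth (fun z => G (Defs.space z)).
Proof.
move=> hG m; elim: m G hG => [|m IH] G hG.
  by split=> // x _; apply: continuous_space; exact: smooth_continuous.
apply: (@Cm_on_intro _ _ _ openT _ _ (fun i z =>
   if unlift ord_max i is Some j then pder j G (Defs.space z) else 0)).
- by move=> x _; apply: continuous_space; exact: smooth_continuous.
- move=> i z _; case: (unliftP ord_max i) => [j|] ->.
    by apply: is_derive_space_sidx; exact: smooth_derivable.
  exact: is_derive_space_max.
- move=> i; case: (unlift _ _) => [j|]; last exact: (Cm_on_cst openT).
  by apply: IH; exact: smooth_pder.
Qed.

Lemma pder_slice F t j : smooth F ->
  pder j (fun x => F (stpoint x t)) = fun x => pder (sidx j) F (stpoint x t).
Proof.
move=> hF; apply/funext => x; apply: is_derive_pderE.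
by apply: is_derive_slice; exact: smooth_derivable.
Qed.

Lemma pder_space_sidx G j : smooth G ->
  pder (sidx j) (fun z => G (Defs.space z)) = fun z => pder j G (Defs.space z).
Proof.
move=> hG; apply/funext => z; apply: is_derive_pderE.
by apply: is_derive_space_sidx; exact: smooth_derivable.
Qed.

Lemma pder_space_max G : pder ord_max (fun z => G (Defs.space z)) = fun=> 0.
Proof. by apply/funext => z; apply: is_derive_pderE; exact: is_derive_space_max. Qed.

Lemma st_miD (a b : mindex d) : st_mi (a + b) = st_mi a + st_mi b.
Proof.
apply/ffunP => i; rewrite mindexDE !ffunE; case: (unlift _ _) => [j|//].
by rewrite mindexDE.
Qed.

Lemma st_mi_unit (j : 'I_d) : st_mi (unit_mi j) = unit_mi (sidx j).
Proof.
apply/ffunP; apply: spacetime_ind => [k|].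
  by rewrite !ffunE liftK ffunE (inj_eq lift_inj).
by rewrite !ffunE unlift_none (negbTE (neq_lift _ _)).
Qed.

Lemma st_mi0 : st_mi (0 : mindex d) = 0.
Proof.
apply/ffunP => i; rewrite !ffunE; case: (unlift _ _) => [j|//].
by rewrite mindex0E.
Qed.

Lemma mpder_slice F t (b : mindex d) : smooth F ->
  mpder b (fun x => F (stpoint x t)) = fun x => mpder (st_mi b) F (stpoint x t).
Proof.
move=> hF; move: b; apply: mindex_ind => [|b i IH]; first by rewrite st_mi0 !mpder0.
rewrite smooth_mpderD; last exact: smooth_slice.
rewrite IH st_miD st_mi_unit smooth_mpderD// pder_slice//.
exact: smooth_mpder.
Qed.

End Slices.

Section BoundaryFactor.
Context {R : realType} {d : nat}.
Implicit Types (x y : 'rV[R]_d) (S : pred 'I_d) (m : 'I_d -> nat) (t : R).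

Definition s01_deriv (k : nat) t : R :=
  match k with 0 => t * (1 - t) | 1 => 1 - 2 * t | 2 => -2 | _ => 0 end.

Lemma is_derive_s01 k t : is_derive t 1 (s01_deriv k) (s01_deriv k.+1 t).
Proof.
case: k => [|[|[|k]]].
- have -> : s01_deriv 0 = id * (cst 1 - id) by apply/funext.
  by apply: is_derive_eq; rewrite !fctE /GRing.scale/=; ring.
- have -> : s01_deriv 1 = cst 1 - (2 \*: id) by apply/funext.
  by apply: is_derive_eq; rewrite /GRing.scale/=; ring.
- exact: is_derive_cst.
- exact: is_derive_cst.
Qed.

Lemma smooth_s01 k j : smooth (fun x => s01_deriv k (x 0 j)).
Proof.
case: k => [|[|[|k]]]; rewrite /s01_deriv.
- apply: smoothM; first exact: smooth_coord.
  by apply: smoothB; [exact: smooth_cst|exact: smooth_coord].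
- by apply: smoothB; [exact: smooth_cst|apply: smoothZ; exact: smooth_coord].
- exact: smooth_cst.
- exact: smooth_cst.
Qed.

Lemma pder_s01 k i j : pder i (fun x => s01_deriv k (x 0 j)) =
  fun x => s01_deriv k.+1 (x 0 j) * (j == i)%:R.
Proof.
apply/funext => x; apply: is_derive_pderE.
by apply: is_derive_chain; [exact: is_derive_s01|exact: is_derive_coord].
Qed.

Definition bprod S m x : R := \prod_(j | S j) s01_deriv (m j) (x 0 j).

Lemma smooth_bprod S m : smooth (bprod S m).
Proof. by apply: smooth_prod => j _; exact: smooth_s01. Qed.

Lemma pder_bprod S m i : pder i (bprod S m) =
  fun x => if S i then bprod S (fun j => (m j + unit_mi i j)%N) x else 0.
Proof.
rewrite /bprod smooth_pder_prod; last by move=> k; exact: smooth_s01.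
apply/funext => x; case: ifPn => Si.
  rewrite (bigD1 i)//= [X in _ + X]big1 ?addr0; last first.
    by move=> j /andP[_ ji]; rewrite pder_s01 (negbTE ji) mulr0 mul0r.
  rewrite pder_s01 eqxx mulr1 [RHS](bigD1 i)//= ffunE eqxx addn1; congr (_ * _).
  by apply: eq_bigr => j /andP[_ ji]; rewrite ffunE (negbTE ji) addn0.
rewrite big1// => j Sj; rewrite pder_s01.
have /negbTE -> : j != i by apply: contra Si => /eqP <-.
by rewrite mulr0 mul0r.
Qed.

Lemma BcutE : @Bcut R d = bprod predT (fun=> 0%N).
Proof. by []. Qed.

Lemma smooth_Bcut : smooth (@Bcut R d).
Proof. by rewrite BcutE; exact: smooth_bprod. Qed.

Lemma mpder_Bcut (b : mindex d) : mpder b (@Bcut R d) = bprod predT b.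
Proof.
move: b; apply: mindex_ind => [|b i IH].
  rewrite mpder0 BcutE; apply/funext => x.
  by apply: eq_bigr => j _; rewrite mindex0E.
rewrite smooth_mpderD; last exact: smooth_Bcut.
rewrite IH pder_bprod; apply/funext => x /=.
by apply: eq_bigr => j _; rewrite mindexDE.
Qed.

Lemma s01_deriv_bsup k t : 0 < t < 1 -> `|s01_deriv k t| <= bsup k.
Proof.
move=> /andP[t0 t1]; case: k => [|[|[|k]]] /=.
- rewrite ger0_norm ?mulr_ge0//; [|lra|lra].
  have := sqr_ge0 (t - 2^-1); rewrite expr2; nra.
- by rewrite ler_norml; apply/andP; split; lra.
- by rewrite normrN normr_nat.
- by rewrite normr0.
Qed.

Lemma bsup_ge0 k : 0 <= bsup k :> R.
Proof. by case: k => [|[|[|k]]] /=. Qed.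

Lemma bprod_bsup m x : Omega d x -> `|bprod predT m x| <= \prod_j bsup (m j).
Proof.
move=> Ox; rewrite /bprod normr_prod; apply: ler_prod => j _.
by rewrite normr_ge0 s01_deriv_bsup//; exact: Ox.
Qed.

(** Over Omega the derivative of order b + e_j of B is at most the j-th product
in [omegaB], so this is [rect_lipschitz] on the cube. *)
Lemma Bcut_lipschitz (b : mindex d) x y (rho : R) : Omega d x -> Omega d y ->
  (forall j, `|x 0 j - y 0 j| <= rho) ->
  `|mpder b (@Bcut R d) x| <= `|mpder b (@Bcut R d) y| + omegaB b rho.
Proof.
move=> Ox Oy hrho.
rewrite -[mpder b _ x](subrK (mpder b (@Bcut R d) y)).
rewrite (le_trans (ler_normD _ _))// addrC lerD2l.
have sm : smooth (mpder b (@Bcut R d)) by apply: smooth_mpder; exact: smooth_Bcut.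
have := @rect_lipschitz R d unit_side unit_side_interval (mpder b (@Bcut R d))
  (fun q => \prod_i bsup (b i + (i == q))%N) y x.
move=> h; apply: (le_trans (h _ _ Oy Ox)).
- by move=> z q _; exact: smooth_derivable.
- move=> z q Oz; rewrite -smooth_mpderD; last exact: smooth_Bcut.
  rewrite mpder_Bcut (le_trans (bprod_bsup _ Oz))//.
  rewrite le_eqVlt; apply/orP; left; apply/eqP; apply: eq_bigr => i _.
  by rewrite mindexDE ffunE.
rewrite /omegaB mulr_sumr; apply: ler_sum => q _; rewrite mulrC.
by rewrite ler_wpM2r// prodr_ge0// => i _; exact: bsup_ge0.
Qed.

End BoundaryFactor.

(** * Initial residuals *)

Section InitialResidual.
Context {R : realType} {d : nat}.
Variables (T : R) (d0 : (0 < d)%N) (T0 : 0 < T).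
Implicit Types (x y : 'rV[R]_d) (P : mesh R d) (b : mindex d).
Local Notation Om := (Omega d : set 'rV[R]_d).

Variables (m : nat) (a : 'rV[R]_d -> R) (D : mindex d -> 'rV[R]_d -> 'rV[R]_d -> R)
  (V : 'rV[R]_d -> R) (VB : mesh R d -> 'rV[R]_d -> mindex d -> R).
Hypotheses (hD : data_assumption m a D) (smV : smooth V).
Hypothesis VB_sound : forall P y x b, is_mesh T P -> y \in centers P -> Om x ->
  box y (radx P) x -> `|mpder b V x| <= VB P y b.
Hypothesis VB_bounded : forall b, exists M : R, forall P y, is_mesh T P -> y \in centers P ->
  VB P y b <= M.
Hypothesis V_bounded : forall b, exists M : R, forall x, Om x -> `|mpder b V x| <= M.

Let phi x := a x - V x.

Lemma Cm_on_sub n (O O' : set 'rV[R]_n) k F : O' `<=` O -> Cm_on O k F -> Cm_on O' k F.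
Proof.
move=> sub; elim: k F => [|k IH] F /= [ct h]; split=> //; try by move=> x /sub/ct.
by move=> i; have [dF hF] := h i; split=> [x /sub/dF//|]; exact: IH.
Qed.

Let V_Cm : Cm_on Om m V. Proof. by apply: Cm_on_sub (smV m). Qed.

Let phi_Cm : Cm_on Om m phi.
Proof. by apply: Cm_onB; [exact: open_Omega|exact: (data_Cm_on hD)|exact: V_Cm]. Qed.

Let mpder_phi b x : (mi_deg b <= m)%N -> Om x -> mpder b phi x = mpder b a x - mpder b V x.
Proof.
move=> bm Ox; apply: (dersB open_Omega) (data_Cm_on hD) V_Cm Ox.
by rewrite size_mi_seq.
Qed.

Definition cell_coef P y b : R := D b y (radx P) + VB P y b.

Let radx_nonneg P : is_mesh T P -> nonneg_rV (radx P).
Proof. by move=> hP j; rewrite ltW// (radx_gt0 hP). Qed.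

Lemma cell_coef_sound P y x b : is_mesh T P -> y \in centers P -> (mi_deg b <= m)%N -> Om x ->
  box y (radx P) x -> `|mpder b phi x| <= cell_coef P y b.
Proof.
move=> hP yP bm Ox bx; rewrite mpder_phi// (le_trans (ler_normB _ _))//.
have Oy : Om y by exact: (mesh_center_Omega hP yP).
apply: lerD; last exact: VB_sound.
by apply: (data_le hD bm) => //; exact: radx_nonneg.
Qed.

Lemma cell_coef_bounded b : (mi_deg b <= m)%N ->
  exists M : R, forall P y, is_mesh T P -> y \in centers P -> 0 <= cell_coef P y b <= M.
Proof.
move=> bm; have [M hM] := data_bounded hD bm; have [M' hM'] := VB_bounded b.
exists (M + M') => P y hP yP; have Oy : Om y by exact: (mesh_center_Omega hP yP).
apply/andP; split.
  apply: le_trans (normr_ge0 (mpder b phi y)) _; apply: cell_coef_sound => // j.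
  by rewrite subrr normr0 ltW// (radx_gt0 hP).
apply: lerD; last exact: hM'.
apply: hM => // j; rewrite ltW ?(radx_gt0 hP)//=; exact: (radx_le1 hP).
Qed.

Lemma phi_bounded b : (mi_deg b <= m)%N ->
  exists M : R, forall x, Om x -> `|mpder b phi x| <= M.
Proof.
move=> bm; have [M hM] := data_derivative_bounded hD bm; have [M' hM'] := V_bounded b.
exists (M + M') => x Ox; rewrite mpder_phi// (le_trans (ler_normB _ _))//.
by apply: lerD; [exact: hM|exact: hM'].
Qed.

Lemma uniform_bound (I : finType) (Q : I -> R -> Prop) :
  (forall i M M', Q i M -> M <= M' -> Q i M') -> (forall i, exists M, Q i M) ->
  exists2 M : R, 0 <= M & forall i, Q i M.
Proof.
move=> mono h; have [F hF] := choice h.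
exists (\big[Num.max/0]_i F i); first exact: bigmax_ge_id.
by move=> i; apply: mono (hF i) _; exact: le_bigmax.
Qed.

Variables (beta : mindex d) (r : nat).
Hypotheses (r1 : (r <= 1)%N) (deg_m : (mi_deg beta + r + 1 <= m)%N).

Let deg1 q : (mi_deg (beta + unit_mi q)%R <= m)%N.
Proof. by rewrite mi_degD mi_deg_unit (leq_trans _ deg_m)// addn1 addn1 ltnS leq_addr. Qed.

Let deg0 : (mi_deg beta <= m)%N.
Proof. by rewrite (leq_trans _ deg_m)// -addnA leq_addr. Qed.

Let deg2 q l : r = 1%N -> (mi_deg (beta + unit_mi q + unit_mi l)%R <= m)%N.
Proof. by move=> r1'; rewrite !mi_degD !mi_deg_unit -{2}r1' (leq_trans _ deg_m)// r1'. Qed.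

Let pder_psi q x : Om x -> pder q (mpder beta phi) x = mpder (beta + unit_mi q) phi x.
Proof.
move=> Ox; rewrite (mpderD (@open_Omega R d) q phi_Cm)//.
by rewrite (leq_trans _ (deg1 q))// mi_degD mi_deg_unit addn1.
Qed.

Let pder2_psi q l x : r = 1%N -> Om x ->
  pder l (pder q (mpder beta phi)) x = mpder (beta + unit_mi q + unit_mi l) phi x.
Proof.
move=> rE Ox; rewrite (pder_eq_on l open_Omega (fun z Oz => pder_psi q Oz) Ox).
rewrite (mpderD (@open_Omega R d) l phi_Cm)//.
by rewrite (leq_trans _ (deg2 q l rE))// [in leqRHS]mi_degD mi_deg_unit addn1.
Qed.

Let psi_Cm : Cm_on Om (r + 1) (mpder beta phi).
Proof. by apply: (Cm_on_mpder _ phi_Cm); rewrite addnC addnA. Qed.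

Lemma initial_residual_regular :
  (forall x, Om x -> {for x, continuous (mpder beta phi)}) /\
  (exists M : R, forall x, Om x -> `|mpder beta phi x| <= M).
Proof. by split; [move=> x; exact: (Cm_on_continuous psi_Cm)|exact: phi_bounded deg0]. Qed.

(** The residuals e_0, e_v and the components of the gradient of e_0 are all
derivatives of a difference a - V of a datum and a smooth function, with
coefficients of the same form; one argument treats them together. *)
Lemma initial_residual_sandwich :
  exists2 K : R, 0 <= K & forall P, is_mesh T P ->
    normL2s Om (mpder beta phi) <=
    Ubound (centers P) (radx P) r (mpder beta phi)
      (fun y q => cell_coef P y (beta + unit_mi q))
      (fun y q l => cell_coef P y (beta + unit_mi q + unit_mi l)) <=
    normL2s Om (mpder beta phi) + K * h_Omega P ^+ (r + 1).
Proof.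
have [ct [M1 hM1]] := initial_residual_regular.
have mpsi : measurable_fun (@row_of_tuple R d @^-1` rect unit_side) (mpder beta phi \o @row_of_tuple R d).
  exact: (measurable_continuous_on open_Omega ct).
have [M2 M20 hM2] : exists2 M : R, 0 <= M & forall q P y, is_mesh T P -> y \in centers P ->
    0 <= cell_coef P y (beta + unit_mi q) <= M.
  apply: (@uniform_bound _ (fun q M => forall P y, is_mesh T P -> y \in centers P ->
    0 <= cell_coef P y (beta + unit_mi q) <= M)).
    by move=> q M M' h MM' P y hP yP; have /andP[-> /= h2] := h P y hP yP; exact: le_trans MM'.
  by move=> q; exact: cell_coef_bounded.
have dpsi z q : Om z -> derivable (mpder beta phi) z (delta_mx 0 q).
  by move=> Oz; move: psi_Cm; rewrite addn1 => h; exact: (Cm_on_derivable q h Oz).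
have subOm : Om `<=` rect unit_side by [].
case: r r1 deg_m deg2 pder2_psi psi_Cm => [|[|//]] _ degm _ p2 pC.
  pose M := Num.max M1 M2.
  have M0 : 0 <= M by rewrite le_max M20 orbT.
  have hM1' x : rect unit_side x -> `|mpder beta phi x| <= M.
    by move=> Ox; rewrite (le_trans (hM1 x Ox))// le_max lexx.
  have [K K0 hK] := @U0_sandwich R d unit_side unit_side_interval Om subOm open_Omega
    measurable_Omega volume_Omega_lty (mpder beta phi) M 1 mpsi
    hM1' ct dpsi M0 ler01.
  exists K => // P hP; rewrite add0n; apply: hK.
  - exact: (mesh_cells hP).
  - by rewrite (h_Omega_ge0 P) (h_Omega_le1 hP).
  - by move=> j; exact: radx_le_h.
  - move=> c q cZ; have /andP[-> /= h2] := hM2 q P c hP cZ.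
    by rewrite le_max h2 orbT.
  - move=> c z q cZ Oz bz; rewrite pder_psi//.
    exact: cell_coef_sound.
have deg2' q l : (mi_deg (beta + unit_mi q + unit_mi l)%R <= m)%N.
  by rewrite (leq_trans _ degm)// !mi_degD !mi_deg_unit.
have [M3 M30 hM3] : exists2 M : R, 0 <= M & forall ql : 'I_d * 'I_d, forall P y,
    is_mesh T P -> y \in centers P ->
    0 <= cell_coef P y (beta + unit_mi ql.1 + unit_mi ql.2) <= M.
  apply: (@uniform_bound _ (fun ql M => forall P y, is_mesh T P -> y \in centers P ->
    0 <= cell_coef P y (beta + unit_mi ql.1 + unit_mi ql.2) <= M)).
    by move=> q M M' h MM' P y hP yP; have /andP[-> /= h2] := h P y hP yP; exact: le_trans MM'.
  by move=> ql; exact: cell_coef_bounded.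
have [M4 M40 hM4] : exists2 M : R, 0 <= M & forall q x, Om x ->
    `|mpder (beta + unit_mi q) phi x| <= M.
  apply: (@uniform_bound _ (fun q M => forall x, Om x -> `|mpder (beta + unit_mi q) phi x| <= M)).
    by move=> q M M' h MM' x Ox; exact: le_trans (h x Ox) MM'.
  by move=> q; exact: phi_bounded.
pose M := Num.max M1 (Num.max M3 M4).
have M0 : 0 <= M by rewrite !le_max M30 orbT.
have d2psi z q l : Om z -> derivable (pder q (mpder beta phi)) z (delta_mx 0 l).
  by move=> Oz; exact: (Cm_on_derivable l (Cm_on_pder q pC) Oz).
have hM1' x : rect unit_side x -> `|mpder beta phi x| <= M.
  by move=> Ox; rewrite (le_trans (hM1 x Ox))// le_max lexx.
have hM4' z q : Om z -> `|pder q (mpder beta phi) z| <= M.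
  by move=> Oz; rewrite pder_psi// (le_trans (hM4 q z Oz))// !le_max lexx !orbT.
have [K K0 hK] := @U1_sandwich R d unit_side unit_side_interval Om subOm open_Omega
    measurable_Omega volume_Omega_lty (mpder beta phi) M 1 mpsi hM1' ct dpsi M0 ler01 d2psi hM4'.
exists K => // P hP; apply: hK.
- exact: (mesh_cells hP).
- by rewrite (h_Omega_ge0 P) (h_Omega_le1 hP).
- by move=> j; exact: radx_le_h.
- move=> c q l cZ; have /andP[-> /= h2] := hM3 (q, l) P c hP cZ.
  by rewrite !le_max h2 !orbT.
- by move=> c q l; rewrite addrAC.
- move=> c z q l cZ Oz bz; rewrite p2//.
  exact: cell_coef_sound.
Qed.

End InitialResidual.

Section InitialVelocity.
Context {R : realType} {d w L : nat}.
Variables (T : R) (d0 : (0 < d)%N) (T0 : 0 < T) (f : network R d.+1 w L) (N : nat -> nat)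
  (L0 : (0 < L)%N).
Implicit Types (x y : 'rV[R]_d) (P : mesh R d) (a b : mindex d) (ta : mindex d.+1).
Local Notation Om := (Omega d : set 'rV[R]_d).

Definition net_slice ta x : R := mpder ta (net_fun f) (stpoint x 0).
(** The order 0 derivative, [ta = 0], gives v(., 0); as B does not depend on
time, [ta = tau d] gives the time derivative of v at t = 0. *)
Definition cut_slice ta x : R := Bcut x * net_slice ta x.
Definition cut_slice_coef ta P y a : R :=
  sum_mi_le a (fun b => (mi_bin a b)%:R * Bk P y b * Fk f N P y (st_mi (mi_sub a b) + ta)).

Lemma smooth_net_slice ta : smooth (net_slice ta).
Proof. by apply: (@smooth_slice R d _ 0); apply: smooth_mpder; exact: smooth_net. Qed.

Lemma smooth_cut_slice ta : smooth (cut_slice ta).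
Proof. by apply: smoothM; [exact: smooth_Bcut|exact: smooth_net_slice]. Qed.

Lemma mpder_net_slice ta b x :
  mpder b (net_slice ta) x = mpder (st_mi b + ta) (net_fun f) (stpoint x 0).
Proof.
have sm : smooth (mpder ta (net_fun f)) by apply: smooth_mpder; exact: smooth_net.
rewrite (@mpder_slice R d _ 0 b sm) smooth_mpderM//; exact: smooth_net.
Qed.

Lemma mpder_cut_slice ta a x : mpder a (cut_slice ta) x =
  \sum_(b <- mi_list a) (mi_bin a b)%:R * (mpder b (@Bcut R d) x *
    mpder (st_mi (mi_sub a b) + ta) (net_fun f) (stpoint x 0)).
Proof.
rewrite (leibniz a x (@smooth_Bcut R d) (smooth_net_slice ta)) /leibniz_sum sum_mi_leE.
by apply: eq_bigr => b _; rewrite mpder_net_slice.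
Qed.

Lemma max_radx_ge P j : `|radx P 0 j| <= \big[Num.max/0]_i `|radx P 0 i|.
Proof. exact: le_bigmax. Qed.

Lemma slice_rad_ge0 P : is_mesh T P -> nonneg_rV (stpoint (radx P) 0).
Proof.
move=> hP; apply: spacetime_ind => [j|]; last by rewrite stpoint_max.
by rewrite stpoint_sidx ltW// (radx_gt0 hP).
Qed.

Lemma slice_box P y x : box y (radx P) x ->
  box (stpoint y 0) (stpoint (radx P) 0) (stpoint x (0 : R)).
Proof.
move=> bx; apply: spacetime_ind => [j|]; last by rewrite !stpoint_max subrr normr0.
by rewrite !stpoint_sidx.
Qed.

(** The Leibniz rule is bounded term by term, the factor B by
[Bcut_lipschitz] and the network by [Ebound_sound] on a box of radius 0 in time. *)
Lemma cut_slice_sound ta P y x b : is_mesh T P -> y \in centers P -> Om x ->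
  box y (radx P) x -> `|mpder b (cut_slice ta) x| <= cut_slice_coef ta P y b.
Proof.
move=> hP yP Ox bx; rewrite mpder_cut_slice /cut_slice_coef sum_mi_leE.
have Oy : Om y by exact: (mesh_center_Omega hP yP).
rewrite (le_trans (ler_norm_sum _ _ _))//; apply: ler_sum => c _.
rewrite normrM normr_nat -mulrA ler_wpM2l// normrM ler_pM//.
  apply: Bcut_lipschitz => // j; rewrite (le_trans (bx j))//.
  by rewrite (le_trans (ler_norm _))// max_radx_ge.
by apply: Ebound_sound; [exact: slice_rad_ge0|exact: L0|exact: slice_box].
Qed.

Lemma cut_slice_coef_bounded ta b : exists M : R, forall P y, is_mesh T P -> y \in centers P ->
  cut_slice_coef ta P y b <= M.
Proof.
pose S (p : mesh R d * 'rV[R]_d) := is_mesh T p.1 /\ p.2 \in centers p.1.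
have brad j : bnd S (fun p => stpoint (radx p.1) 0 0 j).
  exists 1 => -[P y] [/= hP _]; move: j; apply: spacetime_ind => [j|].
    by rewrite stpoint_sidx ger0_norm ?(radx_le1 hP)// ltW// (radx_gt0 hP).
  by rewrite stpoint_max normr0.
have [M hM] : bnd S (fun p => cut_slice_coef ta p.1 p.2 b).
  apply: (@bnd_ext _ _ _ (fun p => \sum_(c <- mi_list b) (mi_bin b c)%:R * Bk p.1 p.2 c *
    Fk f N p.1 p.2 (st_mi (mi_sub b c) + ta))).
    by move=> p _; rewrite /cut_slice_coef sum_mi_leE.
  apply: bnd_sum => c _; apply: bndM; first (apply: bndM; first exact: bnd_cst).
    apply: bndD.
      exists (\prod_j bsup (c j)) => -[P y] [/= hP yP].
      by rewrite normr_id mpder_Bcut bprod_bsup//; exact: (mesh_center_Omega hP yP).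
    apply: bndM; last exact: bnd_cst.
    exists 1 => -[P y] [/= hP _]; rewrite ger0_norm; last exact: bigmax_ge_id.
    apply/bigmax_leP; split=> // j _; rewrite ger0_norm ?(radx_le1 hP)//.
    by rewrite ltW// (radx_gt0 hP).
  by apply: (@bnd_Ebound R _ _ _ f N _ S (fun p => stpoint p.2 0)).
by exists M => P y hP yP; rewrite (le_trans (ler_norm _))//; exact: (hM (P, y)).
Qed.

Lemma cut_slice_bounded ta b : exists M : R, forall x, Om x -> `|mpder b (cut_slice ta) x| <= M.
Proof.
suff [M hM] : bnd Om (mpder b (cut_slice ta)) by exists M.
apply: (@bnd_ext _ _ _ (fun x => \sum_(c <- mi_list b) (mi_bin b c)%:R * (mpder c (@Bcut R d) x *
    mpder (st_mi (mi_sub b c) + ta) (net_fun f) (stpoint x 0)))).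
  by move=> x _; rewrite mpder_cut_slice.
apply: bnd_sum => c _; apply: bndM; [exact: bnd_cst|apply: bndM].
  by exists (\prod_j bsup (c j)) => x Ox; rewrite mpder_Bcut bprod_bsup.
exact: bnd_mpder_net.
Qed.

Lemma vfun_slice x : vfun f (stpoint x 0) = cut_slice 0 x.
Proof. by rewrite /vfun space_stpoint /cut_slice /net_slice mpder0. Qed.

Lemma vfun_time_slice x : pder ord_max (vfun f) (stpoint x 0) = cut_slice (tau d) x.
Proof.
rewrite /vfun smooth_pderM; last 2 first.
- exact: (smooth_space (@smooth_Bcut R d)).
- exact: smooth_net.
rewrite pder_space_max mul0r add0r space_stpoint /cut_slice /net_slice.
by rewrite mpder_unit.
Qed.

Lemma cut_slice_coef0 P y b : cut_slice_coef 0 P y b = Vk f N P y b.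
Proof.
by rewrite /cut_slice_coef /Vk !sum_mi_leE; apply: eq_bigr => c _; rewrite addr0.
Qed.

Lemma cut_slice_regular ta m (a : 'rV[R]_d -> R) (D : mindex d -> 'rV[R]_d -> 'rV[R]_d -> R)
    (beta : mindex d) (r : nat) :
  data_assumption m a D -> (mi_deg beta + r + 1 <= m)%N ->
  (forall x, Om x -> {for x, continuous (mpder beta (fun x => a x - cut_slice ta x))}) /\
  (exists M : R, forall x, Om x -> `|mpder beta (fun x => a x - cut_slice ta x) x| <= M).
Proof.
move=> hD deg; apply: (initial_residual_regular hD (smooth_cut_slice ta) _ deg).
exact: cut_slice_bounded.
Qed.

Lemma cut_slice_sandwich ta m (a : 'rV[R]_d -> R) (D : mindex d -> 'rV[R]_d -> 'rV[R]_d -> R) (beta : mindex d) (r : nat) :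
  data_assumption m a D -> (r <= 1)%N -> (mi_deg beta + r + 1 <= m)%N ->
  exists2 K : R, 0 <= K & forall P, is_mesh T P ->
    normL2s Om (mpder beta (fun x => a x - cut_slice ta x)) <=
    Ubound (centers P) (radx P) r (mpder beta (fun x => a x - cut_slice ta x))
      (fun y q => cell_coef D (cut_slice_coef ta) P y (beta + unit_mi q))
      (fun y q l => cell_coef D (cut_slice_coef ta) P y (beta + unit_mi q + unit_mi l)) <=
    normL2s Om (mpder beta (fun x => a x - cut_slice ta x)) + K * h_Omega P ^+ (r + 1).
Proof.
move=> hD r1 deg; apply: (initial_residual_sandwich hD (smooth_cut_slice ta)) => //.
- by move=> P y x b; exact: cut_slice_sound.
- exact: cut_slice_coef_bounded.
- exact: cut_slice_bounded.
Qed.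

End InitialVelocity.

Section InitialSandwiches.
Context {R : realType} {d w L : nat}.
Variables (T : R) (d0 : (0 < d)%N) (T0 : 0 < T) (f : network R d.+1 w L) (N : nat -> nat)
  (L0 : (0 < L)%N).
Implicit Types (x y : 'rV[R]_d) (P : mesh R d) (a b : mindex d).
Local Notation Om := (Omega d : set 'rV[R]_d).

Lemma Ubound_ext n (Z : seq 'rV[R]_n) e r phi
    (b b' : 'rV[R]_n -> 'I_n -> R) h h' :
  (forall c q, b c q = b' c q) -> (forall c q l, h c q l = h' c q l) ->
  Ubound Z e r phi b h = Ubound Z e r phi b' h'.
Proof.
move=> bb hh; have -> : b = b' by apply/funext => c; apply/funext => q.
suff -> : h = h' by []. by apply/funext => c; apply/funext => q; apply/funext => l.
Qed.

Variables (g h : 'rV[R]_d -> R) (Dg Dh : mindex d -> 'rV[R]_d -> 'rV[R]_d -> R) (r : nat).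
Hypothesis r1 : (r <= 1)%N.

Let e0E : e0 f g = fun x => g x - cut_slice f 0 x.
Proof. by apply/funext => x; rewrite /e0 vfun_slice. Qed.

Let evE : ev f h = fun x => h x - cut_slice f (tau d) x.
Proof. by apply/funext => x; rewrite /ev vfun_time_slice. Qed.

Let Vk_coefE P y b : cell_coef Dg (cut_slice_coef f N 0) P y b = Gk Dg P y b + Vk f N P y b.
Proof. by rewrite /cell_coef cut_slice_coef0. Qed.

Lemma e0_sandwich : data_assumption (r + 1) g Dg ->
  exists2 K : R, 0 <= K & forall P, is_mesh T P ->
    normL2s Om (e0 f g) <= U_e0 f g N Dg P r <= normL2s Om (e0 f g) + K * h_Omega P ^+ (r + 1).
Proof.
move=> hg; have m0 : (mi_deg (0%R : mindex d) + r + 1 <= r + 1)%N by rewrite mi_deg0.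
have [K K0 hK] := cut_slice_sandwich T f N L0 0 hg r1 m0.
exists K => // P hP; have := hK P hP; rewrite mpder0 -e0E /U_e0.
rewrite (@Ubound_ext _ _ _ r (e0 f g) _ (b_e0 f N Dg P) _ (h_e0 f N Dg P))//.
- by move=> y q; rewrite Vk_coefE add0r.
- by move=> y q l; rewrite Vk_coefE add0r.
Qed.

Lemma grad_e0_sandwich (j : 'I_d) : data_assumption (r + 2) g Dg ->
  exists2 K : R, 0 <= K & forall P, is_mesh T P ->
    normL2s Om (pder j (e0 f g)) <=
    Ubound (centers P) (radx P) r (pder j (e0 f g)) (b_de0 f N Dg P j) (h_de0 f N Dg P j) <=
    normL2s Om (pder j (e0 f g)) + K * h_Omega P ^+ (r + 1).
Proof.
move=> hg; have m0 : (mi_deg (unit_mi j) + r + 1 <= r + 2)%N.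
  by rewrite mi_deg_unit -addnA addnC -addnA.
have [K K0 hK] := cut_slice_sandwich T f N L0 0 hg r1 m0.
exists K => // P hP; have := hK P hP; rewrite mpder_unit -e0E.
rewrite (@Ubound_ext _ _ _ r (pder j (e0 f g)) _ (b_de0 f N Dg P j) _ (h_de0 f N Dg P j))//.
by move=> y q; rewrite Vk_coefE [unit_mi j + _]addrC.
Qed.

Lemma grad_e0_regular (j : 'I_d) : data_assumption (r + 2) g Dg ->
  (forall x, Om x -> {for x, continuous (pder j (e0 f g))}) /\
  (exists M : R, forall x, Om x -> `|pder j (e0 f g) x| <= M).
Proof.
move=> hg; have m0 : (mi_deg (unit_mi j) + r + 1 <= r + 2)%N.
  by rewrite mi_deg_unit -addnA addnC -addnA.
have := cut_slice_regular f L0 0 hg m0; by rewrite mpder_unit -e0E.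
Qed.

Lemma ev_sandwich : data_assumption (r + 1) h Dh ->
  exists2 K : R, 0 <= K & forall P, is_mesh T P ->
    normL2s Om (ev f h) <= U_ev f h N Dh P r <= normL2s Om (ev f h) + K * h_Omega P ^+ (r + 1).
Proof.
move=> hh; have m0 : (mi_deg (0%R : mindex d) + r + 1 <= r + 1)%N by rewrite mi_deg0.
have [K K0 hK] := cut_slice_sandwich T f N L0 (tau d) hh r1 m0.
exists K => // P hP; have := hK P hP; rewrite mpder0 -evE /U_ev.
rewrite (@Ubound_ext _ _ _ r (ev f h) _ (b_ev f N Dh P) _ (h_ev f N Dh P))//.
- by move=> y q; rewrite add0r.
- by move=> y q l; rewrite add0r.
Qed.

End InitialSandwiches.

(** * Structure of the PDE residual *)

Section DerivativeFamilies.
Context {R : realType} {n : nat}.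
Implicit Types (X Y : mindex n -> 'rV[R]_n -> R) (q l : 'I_n).

(** The coefficients of the PDE bound are indexed by the order of
differentiation of each factor.  Stating the product rule on families indexed
like the partial derivatives of [X 0] yields them directly. *)
Definition der_family X :=
  (forall b, smooth (X b)) /\ (forall b q, pder q (X b) = X (b + unit_mi q)).

Lemma der_family_mpder (F : 'rV[R]_n -> R) : smooth F -> der_family (fun b => mpder b F).
Proof.
by move=> hF; split=> [b|b q]; [exact: smooth_mpder|rewrite smooth_mpderD].
Qed.

Lemma pder2_familyM X Y q l : der_family X -> der_family Y ->
  pder l (pder q (fun z => X 0 z * Y 0 z)) =
  fun z => X (unit_mi q + unit_mi l) z * Y 0 z + X (unit_mi q) z * Y (unit_mi l) z
           + X (unit_mi l) z * Y (unit_mi q) z + X 0 z * Y (unit_mi q + unit_mi l) z.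
Proof.
move=> [sX pX] [sY pY].
rewrite (smooth_pderM _ (sX _) (sY _)) pX pY !add0r.
rewrite smooth_pderD; [|exact: smoothM|exact: smoothM].
rewrite (smooth_pderM _ (sX _) (sY _)) (smooth_pderM _ (sX _) (sY _)) !pX !pY !add0r.
by apply/funext => z; rewrite !addrA.
Qed.

Lemma pder_familyM X Y q : der_family X -> der_family Y ->
  pder q (fun z => X 0 z * Y 0 z) = fun z => X (unit_mi q) z * Y 0 z + X 0 z * Y (unit_mi q) z.
Proof.
by move=> [sX pX] [sY pY]; rewrite (smooth_pderM _ (sX _) (sY _)) pX pY !add0r.
Qed.

End DerivativeFamilies.

Section Residual.
Context {R : realType} {d w L : nat}.
Variables (kappa c : R) (f : network R d.+1 w L).
Implicit Types (z : 'rV[R]_d.+1) (b : mindex d.+1) (S : pred 'I_d) (i j : 'I_d).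
Local Notation F := (net_fun f).

(** The derivative of order [b] in space-time of the product of the
x_j (1 - x_j) over [S].  For [S = predT] it is that of B, and for [S = predC1 i]
that of B without its i-th factor. *)
Definition Bst S b z : R :=
  if (b ord_max == 0%N) && [forall j, S j || (b (sidx j) == 0%N)]
  then bprod S (fun j => b (sidx j)) (Defs.space z) else 0.

Lemma unit_mi_sidx i j : unit_mi (sidx i) (sidx j) = (j == i) :> nat.
Proof. by rewrite ffunE (inj_eq lift_inj). Qed.

Lemma unit_mi_sidx_max i : unit_mi (sidx i) (ord_max : 'I_d.+1) = 0%N.
Proof. by rewrite ffunE (negbTE (neq_lift _ _)). Qed.

Lemma BstE S b : Bst S b =
  if (b ord_max == 0%N) && [forall j, S j || (b (sidx j) == 0%N)]
  then fun z => bprod S (fun j => b (sidx j)) (Defs.space z) else fun=> 0.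
Proof. by rewrite /Bst; case: (_ && _). Qed.

Lemma Bst_family S : der_family (Bst S).
Proof.
have sm b : smooth (fun z => bprod S (fun j => b (sidx j)) (Defs.space z) : R).
  exact: (smooth_space (smooth_bprod S (fun j => b (sidx j)))).
split=> [b|b q].
  rewrite BstE; case: ifP => _; first exact: sm.
  exact: smooth_cst.
move: q; apply: spacetime_ind => [i|]; last first.
  have -> : Bst S (b + unit_mi ord_max) = fun=> 0.
    by apply/funext => z; rewrite /Bst (mindexDE b) ffunE eqxx addn1.
  rewrite BstE; case: ifP => _; first exact: (pder_space_max (bprod S (fun j => b (sidx j)))).
  by apply/funext => z; apply: is_derive_pderE; exact: is_derive_cst.
have [Si|nSi] := boolP (S i).
  have E : (b + unit_mi (sidx i)) ord_max = b ord_max.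
    by rewrite mindexDE unit_mi_sidx_max addn0.
  rewrite !BstE E.
  have -> : [forall j, S j || ((b + unit_mi (sidx i)) (sidx j) == 0%N)]
          = [forall j, S j || (b (sidx j) == 0%N)].
    apply: eq_forallb => j; rewrite mindexDE unit_mi_sidx.
    by case: (eqVneq j i) => [->|_]; rewrite ?Si//= addn0.
  case: ifP => _.
    rewrite (pder_space_sidx i (smooth_bprod S (fun j => b (sidx j)))) pder_bprod Si.
    apply/funext => z; congr (bprod _ _ _); apply/funext => j.
    by rewrite mindexDE unit_mi_sidx ffunE.
  by apply/funext => z; apply: is_derive_pderE; exact: is_derive_cst.
have -> : Bst S (b + unit_mi (sidx i)) = fun=> 0.
  apply/funext => z; rewrite /Bst ifN// negb_and; apply/orP; right.
  apply/forallPn; exists i; rewrite negb_or nSi mindexDE unit_mi_sidx eqxx.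
  by rewrite addn1.
rewrite BstE; case: ifP => _.
  rewrite (pder_space_sidx i (smooth_bprod S (fun j => b (sidx j)))) pder_bprod.
  by rewrite (negbTE nSi).
by apply/funext => z; apply: is_derive_pderE; exact: is_derive_cst.
Qed.

Lemma Bst0 S z : Bst S 0 z = bprod S (fun=> 0%N) (Defs.space z).
Proof.
rewrite /Bst mindex0E eqxx/= ifT; last by apply/forallP => j; rewrite mindex0E eqxx orbT.
by congr bprod; apply/funext => j; rewrite mindex0E.
Qed.

Lemma vfunE : vfun f = fun z => Bst predT 0 z * F z.
Proof. by apply/funext => z; rewrite /vfun Bst0 -BcutE. Qed.

Lemma Bst_line m i z : Bst predT (unit_mi (sidx i) *+ m) z =
  s01_deriv m (z 0 (sidx i)) * Bst (predC1 i) 0 z.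
Proof.
have E j : (unit_mi (sidx i) *+ m) (sidx j) = (m * (j == i))%N.
  elim: m => [|m IH]; first by rewrite mulr0n mindex0E.
  by rewrite mulrSr mindexDE IH unit_mi_sidx mulSn addnC.
have Em : (unit_mi (sidx i) *+ m) ord_max = 0%N.
  elim: m {E} => [|m IH]; first by rewrite mulr0n mindex0E.
  by rewrite mulrSr mindexDE IH unit_mi_sidx_max.
rewrite Bst0 /Bst Em eqxx/= ifT; last by apply/forallP.
rewrite /bprod (bigD1 i)//= E eqxx muln1 mxE; congr (_ * _).
by apply: eq_bigr => j ji; rewrite E (negbTE ji) muln0.
Qed.

Let famF : der_family (fun b => mpder b F).
Proof. by apply: der_family_mpder; exact: smooth_net. Qed.

Let famB S := Bst_family S.

Lemma iter_pder_vfun k : iter k (pder ord_max) (vfun f) =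
  fun z => Bst predT 0 z * mpder (tau d *+ k) F z.
Proof.
elim: k => [|k IH]; first by rewrite mulr0n mpder0 vfunE.
rewrite iterS IH smooth_pderM; [|exact: (famB _).1|exact: famF.1].
rewrite (famB _).2 famF.2 add0r mulrSr; apply/funext => z.
have -> : Bst predT (unit_mi ord_max) z = 0 by rewrite /Bst ffunE eqxx.
by rewrite mul0r add0r.
Qed.

(** With B = x_i (1 - x_i) B_i, the terms where B is differentiated add up to
2 B_i ((1 - 2 x_i) d_i f - f). *)
Lemma pder2_vfun i : pder (sidx i) (pder (sidx i) (vfun f)) =
  fun z => Bst predT 0 z * mpder (unit_mi (sidx i) *+ 2) F z
    + 2 * (Bst (predC1 i) 0 z * Hop f i 0 z).
Proof.
have -> : vfun f = fun z => Bst predT 0 z * mpder 0 F z by rewrite mpder0 vfunE.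
rewrite (pder2_familyM _ _ (famB predT) famF); apply/funext => z.
have B1 : Bst predT (unit_mi (sidx i)) z = s01_deriv 1 (z 0 (sidx i)) * Bst (predC1 i) 0 z.
  by rewrite -Bst_line mulr1n.
rewrite -mulr2n Bst_line B1 /Hop.
by rewrite add0r mindex0E muln0 add0n /=; ring.
Qed.

Lemma pde_residualE p : pde_residual kappa c f p = fun z =>
  Bst predT 0 z * Aop kappa c f p 0 z
  - 2 * lam kappa c p * \sum_i Bst (predC1 i) 0 z * Hop f i 0 z.
Proof.
apply/funext => z; rewrite /pde_residual iter_pder_vfun.
under eq_bigr do rewrite pder2_vfun.
have -> : Aop kappa c f p 0 z = mpder (tau d *+ torder p) F z
    - lam kappa c p * \sum_(i < d) mpder (unit_mi (sidx i) *+ 2) F z.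
  by rewrite /Aop add0r; congr (_ - _ * _); apply: eq_bigr => i _; rewrite add0r.
by rewrite big_split/= -!mulr_sumr; ring.
Qed.

(** The operator has constant coefficients. *)
Lemma Aop_family p : der_family (Aop kappa c f p).
Proof.
have sm : forall b k, smooth (fun z => \sum_(i < d) mpder (b + unit_mi (sidx i) *+ k) F z).
  by move=> b k; apply: smooth_sum => i _; exact: famF.1.
split=> [b|b q].
  by apply: smoothB; [exact: famF.1|apply: smoothZ; exact: sm].
rewrite /Aop.
have -> : (fun z => mpder (b + tau d *+ torder p) F z -
    lam kappa c p * \sum_(i < d) mpder (b + unit_mi (sidx i) *+ 2) F z) =
  (fun z => mpder (b + tau d *+ torder p) F z +
    (- lam kappa c p) * \sum_(i < d) mpder (b + unit_mi (sidx i) *+ 2) F z).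
  by apply/funext => z; rewrite mulNr.
rewrite smooth_pderD; [|exact: famF.1|by apply: smoothZ; exact: sm].
rewrite smooth_pderZ; last exact: sm.
rewrite smooth_pder_sum; last by move=> i _; exact: famF.1.
apply/funext => z; rewrite famF.2 mulNr addrAC; congr (_ - _ * _).
by apply: eq_bigr => i _; rewrite famF.2 addrAC.
Qed.

(** Differentiating the factor 1 - 2 x_i along the i-th axis contributes
- 2 d^b d_i f, which raises the coefficient 2 b_i + 1 by 2. *)
Lemma Hop_family i : der_family (Hop f i).
Proof.
have s1 : smooth (fun z : 'rV[R]_d.+1 => 1 - 2 * z 0 (sidx i)).
  by apply: smoothB; [exact: smooth_cst|apply: smoothZ; exact: smooth_coord].
split=> [b|b q].
  by apply: smoothB; [apply: smoothM => //; exact: famF.1|apply: smoothZ; exact: famF.1].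
rewrite /Hop.
have -> : (fun z => (1 - 2 * z 0 (sidx i)) * mpder (b + unit_mi (sidx i)) F z
   - (2 * b (sidx i) + 1)%:R * mpder b F z) =
  (fun z => (1 - 2 * z 0 (sidx i)) * mpder (b + unit_mi (sidx i)) F z
   + (- (2 * b (sidx i) + 1)%:R) * mpder b F z).
  by apply/funext => z; rewrite mulNr.
rewrite smooth_pderD; [|by apply: smoothM => //; exact: famF.1|by apply: smoothZ; exact: famF.1].
rewrite smooth_pderZ; last exact: famF.1.
rewrite smooth_pderM //; last exact: famF.1.
rewrite !famF.2; apply/funext => z.
have -> : pder q (fun z : 'rV[R]_d.+1 => 1 - 2 * z 0 (sidx i)) z = - 2 * (sidx i == q)%:R.
  have -> : (fun z : 'rV[R]_d.+1 => 1 - 2 * z 0 (sidx i)) = fun z => 1 + (-2) * z 0 (sidx i).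
    by apply/funext => u; rewrite mulNr.
  rewrite smooth_pderD; [|exact: smooth_cst|by apply: smoothZ; exact: smooth_coord].
  rewrite smooth_pderZ; last exact: smooth_coord.
  rewrite (is_derive_pderE (is_derive_cst _ _ _)) (is_derive_pderE (is_derive_coord _ _ _)).
  by rewrite add0r.
rewrite mindexDE ffunE [b + unit_mi q + _]addrAC; case: (eqVneq (sidx i) q) => [->|_] /=.
  have -> : (2 * (b q + 1) + 1 = 2 + (2 * b q + 1))%N by lia.
  by rewrite natrD; ring.
by rewrite addn0; ring.
Qed.

End Residual.

(** * Cellwise bounds for the PDE residual *)

Section PdeCellBounds.
Context {R : realType} {d w L : nat}.
Variables (T kappa c : R) (f : network R d.+1 w L) (N : nat -> nat) (d0 : (0 < d)%N)
  (T0 : 0 < T) (kappa0 : 0 < kappa) (L0 : (0 < L)%N).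
Implicit Types (z zc : 'rV[R]_d.+1) (b : mindex d.+1) (S : pred 'I_d) (i j : 'I_d)
  (P : mesh R d).
Local Notation F := (net_fun f).
Local Notation OmT := (rect (@st_side R d T)).

Lemma lam_ge0 p : 0 <= lam kappa c p.
Proof. by case: p => /=; [exact: ltW|exact: sqr_ge0]. Qed.

(** A common form of [Bcell], the case [S = predT], and of [Bhat], the case
[S = predC1 i]. *)
Definition Bst_bound P zc S b : R :=
  if (b ord_max == 0%N) && [forall j, S j || (b (sidx j) == 0%N)]
  then \prod_(j | S j) bcell P zc j (b (sidx j)) else 0.

Lemma BcellE P zc b : Bcell P zc b = Bst_bound P zc predT b.
Proof.
rewrite /Bcell /Bst_bound.
have -> : [forall j : 'I_d, predT j || (b (sidx j) == 0%N)] by apply/forallP.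
by rewrite andbT.
Qed.

Lemma BhatE P i zc b : Bhat P i zc b = Bst_bound P zc (predC1 i) b.
Proof.
rewrite /Bhat /Bst_bound.
suff -> : [forall j, predC1 i j || (b (sidx j) == 0%N)] = (b (sidx i) == 0%N) by [].
apply/forallP/idP => [/(_ i)|h j]; first by rewrite /= eqxx.
by case: (eqVneq j i) => [->|ji]; rewrite ?h ?orbT//= ji.
Qed.

Lemma st_sideE z j : OmT z -> 0 < z 0 (sidx j) < 1.
Proof. by move=> /(_ (sidx j)); rewrite st_side_sidx. Qed.

Section Cell.
Variables (P : mesh R d) (zc z : 'rV[R]_d.+1).
Hypotheses (hP : is_mesh T P) (zP : zc \in st_centers P) (Oz : OmT z)
  (bz : box zc (st_rad P) z).

Let rad_ge0 : nonneg_rV (st_rad P).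
Proof. by move=> j; apply: ltW; exact: (st_rad_gt0 hP). Qed.

Lemma Dz_sound b : `|mpder b F z - mpder b F zc| <= Dz f N P zc b.
Proof.
rewrite /Dz; case: (eqVneq b 0) => [->|bn0]; last by apply: ALG_sound.
by rewrite mpder0; apply: net_lipschitz.
Qed.

Lemma Aop_sound p b : `|Aop kappa c f p b z| <= Abound kappa c f N P p zc b.
Proof.
rewrite -[Aop _ _ _ _ _ z](subrK (Aop kappa c f p b zc)) addrC /Abound -[leRHS]addrA.
rewrite (le_trans (ler_normD _ _))// lerD2l /Aop.
set X := mpder _ F z; set Y := \sum_(i < d) _; set X' := mpder _ F zc; set Y' := \sum_(i < d) _.
have -> : X - lam kappa c p * Y - (X' - lam kappa c p * Y') =
  (X - X') - lam kappa c p * (Y - Y') by ring.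
rewrite (le_trans (ler_normB _ _))// lerD//; first exact: Dz_sound.
rewrite normrM ger0_norm ?lam_ge0// ler_wpM2l ?lam_ge0// -sumrB.
by rewrite (le_trans (ler_norm_sum _ _ _))//; apply: ler_sum => i _; exact: Dz_sound.
Qed.

(** The factor 1 - 2 x_i and the derivatives of the network vary together: the
variation of the latter is multiplied by a bound on the former over the cell, and
that of the former by a value at the centre. *)
Lemma Hop_sound i b : `|Hop f i b z| <= Hbound f N P i zc b.
Proof.
rewrite /Hbound -[Hop f i b z](subrK (Hop f i b zc)) addrC -[leRHS]addrA -[leRHS]addrA.
rewrite (le_trans (ler_normD _ _))// lerD2l {1 2}/Hop.
set k := (_ + 1)%:R; set X := mpder _ F z; set X' := mpder _ F zc.
set Y := mpder b F z; set Y' := mpder b F zc.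
set u := z 0 (sidx i); set u' := zc 0 (sidx i); set e := st_rad P 0 (sidx i).
have ue : `|u - u'| <= e by exact: bz.
have -> : (1 - 2 * u) * X - k * Y - ((1 - 2 * u') * X' - k * Y') =
  (1 - 2 * u) * (X - X') + ((- 2 * (u - u')) * X' - k * (Y - Y')) by ring.
rewrite (le_trans (ler_normD _ _))// lerD//.
  rewrite normrM ler_pM//; last exact: Dz_sound.
  have -> : 1 - 2 * u = (1 - 2 * u') - 2 * (u - u') by ring.
  by rewrite (le_trans (ler_normB _ _))// lerD2l normrM normr_nat ler_wpM2l.
rewrite (le_trans (ler_normB _ _))// lerD//.
  by rewrite !normrM normrN normr_nat ler_wpM2r// ler_wpM2l.
by rewrite normrM normr_nat ler_wpM2l//; exact: Dz_sound.
Qed.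

Lemma lo_le j : lo P zc j <= z 0 (sidx j).
Proof.
have /andP[u0 _] := st_sideE j Oz; have := bz (sidx j); rewrite ler_norml => /andP[h h'].
by rewrite /lo ge_max; apply/andP; split; lra.
Qed.

Lemma hi_ge j : z 0 (sidx j) <= hi P zc j.
Proof.
have /andP[_ u1] := st_sideE j Oz; have := bz (sidx j); rewrite ler_norml => /andP[h h'].
by rewrite /hi le_min; apply/andP; split; lra.
Qed.

(** The interval [lo, hi] is the cell clipped to [0, 1].  On it t (1 - t) is
largest at the point closest to 1/2, and |1 - 2 t| at an end point. *)
Lemma s01_deriv_bcell j k : `|s01_deriv k (z 0 (sidx j))| <= bcell P zc j k.
Proof.
have /andP[u0 u1] := st_sideE j Oz; have l := lo_le j; have h := hi_ge j.
set u := z 0 (sidx j) in u0 u1 l h *.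
case: k => [|[|[|k]]] /=.
- rewrite ger0_norm ?mulr_ge0//; [|lra|lra].
  rewrite /s01 minEle maxEle; case: (leP (lo P zc j) 2^-1) => l2.
    case: (leP (hi P zc j) 2^-1) => h2; first by nra.
    have := sqr_ge0 (u - 2^-1); rewrite expr2; nra.
  case: (leP (hi P zc j) (lo P zc j)) => h2; last by nra.
  by have -> : hi P zc j = u by lra.
- rewrite le_max; case: (leP u 2^-1) => u2; apply/orP; [left|right].
    by rewrite ger0_norm ?(le_trans _ (ler_norm _))//; lra.
  rewrite ler0_norm; last by lra.
  by rewrite distrC (le_trans _ (ler_norm _))//; lra.
- by rewrite normrN normr_nat.
- by rewrite normr0.
Qed.

Lemma Bst_sound S b : `|Bst S b z| <= Bst_bound P zc S b.
Proof.
rewrite /Bst /Bst_bound; case: ifP => _; last by rewrite normr0.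
rewrite /bprod normr_prod; apply: ler_prod => j _.
by rewrite normr_ge0 mxE s01_deriv_bcell.
Qed.

(** The product rule on each term of [pde_residualE], every factor being
bounded on the cell. *)
Lemma pde_hessian_sound p q l :
  `|pder l (pder q (pde_residual kappa c f p)) z| <= h_pde kappa c f N P p zc q l.
Proof.
have smA S : smooth (fun z : 'rV[R]_d.+1 => Bst S 0 z) by exact: (Bst_family S).1.
have sH i : smooth (fun z => Bst (predC1 i) 0 z * Hop f i 0 z).
  by apply: smoothM; [exact: smA|exact: (Hop_family f i).1].
have sA : smooth (fun z => Bst predT 0 z * Aop kappa c f p 0 z).
  by apply: smoothM; [exact: smA|exact: (Aop_family kappa c f p).1].
have sS : smooth (fun z => \sum_i Bst (predC1 i) 0 z * Hop f i 0 z).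
  by apply: smooth_sum => i _; exact: sH.
set m := - (2 * lam kappa c p).
have -> : pde_residual kappa c f p = fun z => Bst predT 0 z * Aop kappa c f p 0 z
    + m * \sum_i Bst (predC1 i) 0 z * Hop f i 0 z.
  by rewrite pde_residualE; apply/funext => u; rewrite mulNr.
rewrite smooth_pderD; [|exact: sA|exact: smoothZ].
rewrite (smooth_pderZ _ _ sS) (@smooth_pder_sum R d.+1 q _ _ predT _ (fun i _ => sH i)).
have sHq i : smooth (pder q (fun z => Bst (predC1 i) 0 z * Hop f i 0 z)).
  by apply: smooth_pder; exact: sH.
have sSq : smooth (fun z => \sum_i pder q (fun z => Bst (predC1 i) 0 z * Hop f i 0 z) z).
  by apply: smooth_sum => i _; exact: sHq.
rewrite smooth_pderD; [|exact: smooth_pder|exact: smoothZ].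
rewrite (smooth_pderZ _ _ sSq) (@smooth_pder_sum R d.+1 l _ _ predT _ (fun i _ => sHq i)).
have term S (X : mindex d.+1 -> 'rV[R]_d.+1 -> R) (B : mindex d.+1 -> R) :
    der_family X -> (forall b, `|X b z| <= B b) ->
    `|pder l (pder q (fun z => Bst S 0 z * X 0 z)) z| <=
    Bst_bound P zc S (unit_mi q + unit_mi l) * B 0
    + Bst_bound P zc S (unit_mi q) * B (unit_mi l)
    + Bst_bound P zc S (unit_mi l) * B (unit_mi q)
    + Bst_bound P zc S 0 * B (unit_mi q + unit_mi l).
  move=> fX hX; rewrite (pder2_familyM _ _ (Bst_family S) fX).
  have tM b b' : `|Bst S b z * X b' z| <= Bst_bound P zc S b * B b'.
    by rewrite normrM ler_pM// Bst_sound.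
  do 3 (rewrite (le_trans (ler_normD _ _))// lerD//).
rewrite (le_trans (ler_normD _ _))// /h_pde lerD//.
  by rewrite !BcellE; apply: term; [exact: Aop_family|move=> b; exact: Aop_sound].
rewrite normrM normrN [`|2 * _|]ger0_norm ?mulr_ge0 ?lam_ge0// ler_wpM2l ?mulr_ge0 ?lam_ge0//.
rewrite (le_trans (ler_norm_sum _ _ _))//; apply: ler_sum => i _; rewrite !BhatE.
by apply: term; [exact: Hop_family|move=> b; exact: Hop_sound].
Qed.

End Cell.

Lemma h_pdeC P p zc q l : h_pde kappa c f N P p zc q l = h_pde kappa c f N P p zc l q.
Proof.
have sw (X Y : mindex d.+1 -> R) :
    X (unit_mi q + unit_mi l) * Y 0 + X (unit_mi q) * Y (unit_mi l)
    + X (unit_mi l) * Y (unit_mi q) + X 0 * Y (unit_mi q + unit_mi l) =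
    X (unit_mi l + unit_mi q) * Y 0 + X (unit_mi l) * Y (unit_mi q)
    + X (unit_mi q) * Y (unit_mi l) + X 0 * Y (unit_mi l + unit_mi q).
  by rewrite (addrC (unit_mi l)); congr (_ + _); rewrite addrAC.
exact: (f_equal2 (fun x y => x + 2 * lam kappa c p * y)
  (sw (Bcell P zc) (Abound kappa c f N P p zc))
  (eq_bigr _ (fun i _ => sw (Bhat P i zc) (Hbound f N P i zc)))).
Qed.

Lemma st_center_OmT P zc : is_mesh T P -> zc \in st_centers P -> OmT zc.
Proof. by move=> hP zP; apply: st_open_sub; exact: (cells_center (mesh_st_cells hP) zP). Qed.

(** The coefficient dominates a second derivative at the centre. *)
Lemma h_pde_ge0 P p zc q l : is_mesh T P -> zc \in st_centers P ->
  0 <= h_pde kappa c f N P p zc q l.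
Proof.
move=> hP zP.
suff : `|pder l (pder q (pde_residual kappa c f p)) zc| <= h_pde kappa c f N P p zc q l.
  by move=> h; exact: le_trans (normr_ge0 _) h.
apply: pde_hessian_sound => //; first exact: (st_center_OmT hP zP).
by move=> j; rewrite subrr normr0 ltW// (st_rad_gt0 hP).
Qed.

Lemma bnd_Bst S b : bnd OmT (Bst S b).
Proof.
rewrite BstE; case: ifP => _; last exact: bnd_cst.
apply: bnd_prod => j _; exists (bsup (b (sidx j))) => z Oz.
by rewrite mxE s01_deriv_bsup// st_sideE.
Qed.

Lemma bnd_Aop p b : bnd OmT (Aop kappa c f p b).
Proof.
apply: bndB; first exact: (@bnd_mpder_net R _ _ _ f _ OmT id).
apply: bndM; first exact: bnd_cst.
by apply: bnd_sum => i _; exact: (@bnd_mpder_net R _ _ _ f _ OmT id).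
Qed.

Lemma bnd_slope (Y : Type) (S : Y -> Prop) (zz : Y -> 'rV[R]_d.+1) i :
  (forall t, S t -> OmT (zz t)) -> bnd S (fun t => 1 - 2 * zz t 0 (sidx i)).
Proof.
move=> h; exists 1 => t St; have /andP[a0 a1] := st_sideE i (h t St).
by rewrite ler_norml; apply/andP; split; lra.
Qed.

Lemma bnd_Hop i b : bnd OmT (Hop f i b).
Proof.
apply: bndB; apply: bndM.
- exact: (@bnd_slope _ OmT id).
- exact: (@bnd_mpder_net R _ _ _ f _ OmT id).
- exact: bnd_cst.
- exact: (@bnd_mpder_net R _ _ _ f _ OmT id).
Qed.

Lemma bnd_pde_residual p : bnd OmT (pde_residual kappa c f p).
Proof.
rewrite pde_residualE; apply: bndB; first by apply: bndM; [exact: bnd_Bst|exact: bnd_Aop].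
apply: bndM; first exact: bnd_cst.
by apply: bnd_sum => i _; apply: bndM; [exact: bnd_Bst|exact: bnd_Hop].
Qed.

Lemma smooth_pde_residual p : smooth (pde_residual kappa c f p).
Proof.
rewrite pde_residualE; apply: smoothB.
  by apply: smoothM; [exact: (Bst_family _).1|exact: (Aop_family _ _ _ _).1].
apply: smoothZ; apply: smooth_sum => i _.
by apply: smoothM; [exact: (Bst_family _).1|exact: (Hop_family _ _).1].
Qed.

Lemma bnd_pder_pde_residual p q : bnd OmT (pder q (pde_residual kappa c f p)).
Proof.
have sH i : smooth (fun z => Bst (predC1 i) 0 z * Hop f i 0 z).
  by apply: smoothM; [exact: (Bst_family _).1|exact: (Hop_family f i).1].
have sA : smooth (fun z => Bst predT 0 z * Aop kappa c f p 0 z).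
  by apply: smoothM; [exact: (Bst_family _).1|exact: (Aop_family kappa c f p).1].
have sS : smooth (fun z => \sum_i Bst (predC1 i) 0 z * Hop f i 0 z).
  by apply: smooth_sum => i _; exact: sH.
have -> : pde_residual kappa c f p = fun z => Bst predT 0 z * Aop kappa c f p 0 z
    + (- (2 * lam kappa c p)) * \sum_i Bst (predC1 i) 0 z * Hop f i 0 z.
  by rewrite pde_residualE; apply/funext => u; rewrite mulNr.
rewrite smooth_pderD; [|exact: sA|exact: smoothZ].
rewrite (smooth_pderZ _ _ sS) (@smooth_pder_sum R d.+1 q _ _ predT _ (fun i _ => sH i)).
apply: bndD.
  rewrite (pder_familyM q (Bst_family predT) (Aop_family kappa c f p)).
  by apply: bndD; apply: bndM; (exact: bnd_Bst || exact: bnd_Aop).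
apply: bndM; first exact: bnd_cst.
apply: bnd_sum => i _; rewrite (pder_familyM q (Bst_family (predC1 i)) (Hop_family f i)).
by apply: bndD; apply: bndM; (exact: bnd_Bst || exact: bnd_Hop).
Qed.

Let cellS (p : mesh R d * 'rV[R]_d.+1) := is_mesh T p.1 /\ p.2 \in st_centers p.1.

Let cell_OmT p : cellS p -> OmT p.2.
Proof. by move=> [hP zP]; exact: st_center_OmT hP zP. Qed.

Let bnd_rad (j : 'I_d.+1) : bnd cellS (fun p => st_rad p.1 0 j).
Proof.
exists (1 + T) => -[P z] [/= hP _]; rewrite ger0_norm; last by rewrite ltW// (st_rad_gt0 hP).
by rewrite (le_trans (st_rad_le_h _ _))// (h_P_le T0 hP).
Qed.

Let bnd_Dz b : bnd cellS (fun p => Dz f N p.1 p.2 b).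
Proof.
rewrite /Dz; case: eqP => _; last exact: (@bnd_ALG R _ _ _ f N _ cellS snd).
apply: bnd_sum => j _; apply: bndM; first exact: bnd_rad.
exact: (@bnd_Ebound R _ _ _ f N _ cellS snd).
Qed.

Let bnd_Abound p b : bnd cellS (fun x => Abound kappa c f N x.1 p x.2 b).
Proof.
apply: bndD; first (apply: bndD; last exact: bnd_Dz).
  apply: bnd_norm; apply: bndB; first exact: (@bnd_mpder_net R _ _ _ f _ cellS snd).
  apply: bndM; first exact: bnd_cst.
  by apply: bnd_sum => i _; exact: (@bnd_mpder_net R _ _ _ f _ cellS snd).
apply: bndM; first exact: bnd_cst.
by apply: bnd_sum => i _; exact: bnd_Dz.
Qed.

Let bnd_Hbound i b : bnd cellS (fun x => Hbound f N x.1 i x.2 b).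
Proof.
have bs : bnd cellS (fun x => 1 - 2 * x.2 0 (sidx i)) by exact: bnd_slope.
have b2 : bnd cellS (fun x => 2 * st_rad x.1 0 (sidx i)).
  by apply: bndM; [exact: bnd_cst|exact: bnd_rad].
have bF a : bnd cellS (fun x => mpder a F x.2) by exact: bnd_mpder_net.
apply: bndD; [apply: bndD; [apply: bndD|]|].
- by apply: bnd_norm; apply: bndB; apply: bndM; (exact: bs || exact: bF || exact: bnd_cst).
- by apply: bndM; [apply: bndD => //; exact: bnd_norm|exact: bnd_Dz].
- by apply: bndM => //; exact: bnd_norm.
- by apply: bndM; [exact: bnd_cst|exact: bnd_Dz].
Qed.

Let bnd_bcell j k : bnd cellS (fun x => bcell x.1 x.2 j k).
Proof.
exists 2 => -[P z] hS /=; have /andP[u0 u1] := st_sideE j (cell_OmT hS).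
have e0 : 0 < st_rad P 0 (sidx j) by exact: (st_rad_gt0 hS.1).
have l0 : 0 <= lo P z j <= 1 by rewrite /lo le_max lexx ge_max ler01; move: u1 => /=; lra.
have h0 : 0 <= hi P z j <= 1 by rewrite /hi ge_min lexx le_min ler01; move: u0 => /=; lra.
have slope t : 0 <= t <= 1 -> `|1 - 2 * t| <= 1 :> R.
  by move=> /andP[t0 t1]; rewrite ler_norml; apply/andP; split; lra.
case: k => [|[|[|k]]] /=.
- have : 0 <= Num.min (hi P z j) (Num.max (lo P z j) 2^-1) <= 1.
    rewrite le_min ge_min le_max; move: h0 l0 => /andP[-> ->] /andP[-> _].
    by rewrite orTb.
  by set t := Num.min _ _ => /andP[t0 t1]; rewrite /s01 ler_norml; apply/andP; split; nra.
- rewrite ger0_norm ?le_max ?normr_ge0// ge_max.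
  by rewrite !(le_trans (slope _ _))// ler1n.
- by rewrite normr_nat.
- by rewrite normr0.
Qed.

Let bnd_Bst_bound S b : bnd cellS (fun x => Bst_bound x.1 x.2 S b).
Proof.
rewrite /Bst_bound; case: (_ && _); last exact: bnd_cst.
by apply: bnd_prod => j _; exact: bnd_bcell.
Qed.

Lemma h_pde_bounded p : exists2 M : R, 0 <= M & forall P zc q l, is_mesh T P ->
  zc \in st_centers P -> h_pde kappa c f N P p zc q l <= M.
Proof.
have bb q l : bnd cellS (fun x => h_pde kappa c f N x.1 p x.2 q l).
  have bB b : bnd cellS (fun x => Bcell x.1 x.2 b).
    by apply: bnd_ext (bnd_Bst_bound predT b) => x _; rewrite BcellE.
  have bH i b : bnd cellS (fun x => Bhat x.1 i x.2 b).
    by apply: bnd_ext (bnd_Bst_bound (predC1 i) b) => x _; rewrite BhatE.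
  apply: bndD; last (apply: bndM; first exact: bnd_cst).
    by apply: bndD; [apply: bndD; [apply: bndD|]|]; apply: bndM; (exact: bB || exact: bnd_Abound).
  apply: bnd_sum => i _.
  by apply: bndD; [apply: bndD; [apply: bndD|]|]; apply: bndM; (exact: bH || exact: bnd_Hbound).
have [G hG] := choice (fun ql : 'I_d.+1 * 'I_d.+1 => bb ql.1 ql.2).
exists (\big[Num.max/0]_ql G ql); first exact: bigmax_ge_id.
move=> P zc q l hP zP; rewrite (le_trans (ler_norm _))//.
by rewrite (le_trans (hG (q, l) (P, zc) _))//; exact: le_bigmax.
Qed.

End PdeCellBounds.

(** * Combining the norm bounds *)

Section VectorNorm.
Context {R : realType} {n : nat}.
Local Notation mu := (@lebesgue_tuple R n).
Local Notation rowT := (@row_of_tuple R n).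

Lemma normL2_sum (A : set 'rV[R]_n) p (phi : 'I_p -> 'rV[R]_n -> R) :
  measurable (rowT @^-1` A) -> (mu (rowT @^-1` A) < +oo)%E ->
  (forall j, measurable_fun (rowT @^-1` A) (phi j \o rowT)) ->
  (forall j, exists M : R, forall x, A x -> `|phi j x| <= M) ->
  normL2 A phi = Num.sqrt (\sum_j normL2s A (phi j) ^+ 2).
Proof.
move=> mA fA mphi bphi; rewrite /normL2; congr Num.sqrt.
have int j : mu.-integrable (rowT @^-1` A) (EFin \o ((fun x => phi j x ^+ 2) \o rowT)).
  have [M hM] := bphi j; apply: (@bounded_integrable R n _ _ (M ^+ 2)) => //.
    exact: (measurable_funX 2 (mphi j)).
  move=> x Ax; have h := hM x Ax.
  by rewrite normrX lerXn2r ?nnegrE// (le_trans _ h).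
have sq j : normL2s A (phi j) ^+ 2 = integral_rV A (fun x => phi j x ^+ 2).
  by rewrite sqr_sqrtr// Rintegral_ge0// => t _; exact: sqr_ge0.
under [RHS]eq_bigr do rewrite sq.
rewrite /integral_rV /Rintegral.
rewrite (_ : (fun t => _) = (fun t => \sum_j (phi j (rowT t) ^+ 2)%:E)%E); last first.
  by apply/funext => t; rewrite sumEFin.
rewrite (@integral_sum _ _ _ mu _ mA _ (fun j t => (phi j (rowT t) ^+ 2)%:E) int).
rewrite -sum_fine// => j _; exact: (integrable_fin_num mA (int j)).
Qed.

(** Minkowski's inequality for the vectors (a_j) and (k_j h), with the l^1 norm
of (k_j) in place of its l^2 norm. *)
Lemma sqrt_sum_sandwich p (a U k : 'I_p -> R) (h : R) : (forall j, 0 <= a j) -> (forall j, 0 <= k j) ->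
  0 <= h -> (forall j, a j <= U j <= a j + k j * h) ->
  Num.sqrt (\sum_j a j ^+ 2) <= Num.sqrt (\sum_j U j ^+ 2) <=
  Num.sqrt (\sum_j a j ^+ 2) + (\sum_j k j) * h.
Proof.
move=> a0 k0 h0 aU.
have U0 j : 0 <= U j by have /andP[+ _] := aU j; apply: le_trans.
have s0 : 0 <= \sum_j a j ^+ 2 by apply: sumr_ge0 => j _; exact: sqr_ge0.
have sk0 : 0 <= \sum_j k j by exact: sumr_ge0.
apply/andP; split.
  apply: ler_wsqrtr; apply: ler_sum => j _; have /andP[? _] := aU j.
  by rewrite lerXn2r ?nnegrE.
set s := Num.sqrt (\sum_j a j ^+ 2); set K := \sum_j k j.
have sE : s ^+ 2 = \sum_j a j ^+ 2 by rewrite sqr_sqrtr.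
have r0 : 0 <= s + K * h by rewrite addr_ge0 ?sqrtr_ge0 ?mulr_ge0.
rewrite -[leRHS]ger0_norm// -sqrtr_sqr; apply: ler_wsqrtr.
have as_ j : a j <= s.
  rewrite -[leLHS]ger0_norm// -sqrtr_sqr; apply: ler_wsqrtr.
  by rewrite (bigD1 j)//= lerDl sumr_ge0// => i _; exact: sqr_ge0.
have kK j : k j <= K by rewrite /K (bigD1 j)//= lerDl sumr_ge0.
have step j : U j ^+ 2 <= a j ^+ 2 + k j * (2 * s * h + K * h ^+ 2).
  have /andP[_ uj] := aU j; apply: (@le_trans _ _ ((a j + k j * h) ^+ 2)).
    by rewrite lerXn2r ?nnegrE// addr_ge0 ?mulr_ge0.
  have -> : (a j + k j * h) ^+ 2 = a j ^+ 2 + k j * (2 * a j * h + k j * h ^+ 2) by ring.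
  rewrite lerD2l ler_wpM2l// lerD// ler_wpM2r ?sqr_ge0//.
  by rewrite ler_wpM2l.
rewrite (le_trans (ler_sum _ (fun j _ => step j)))// big_split/= -mulr_suml -/K -sE.
by rewrite le_eqVlt; apply/orP; left; apply/eqP; ring.
Qed.

End VectorNorm.

Section Final.
Context {R : realType} {d w L : nat}.
Variables (T kappa c : R) (f : network R d.+1 w L) (N : nat -> nat) (d0 : (0 < d)%N)
  (L0 : (0 < L)%N) (T0 : 0 < T) (kappa0 : 0 < kappa) (c0 : 0 < c).
Implicit Types (P : mesh R d).
Local Notation Om := (Omega d : set 'rV[R]_d).

(** The hypotheses of [U1_sandwich] hold with constants that do not depend on
the mesh, since the radii of every mesh are at most 1 + T. *)
Lemma pde_sandwich p : exists2 K : R, 0 <= K & forall P, is_mesh T P ->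
  normL2s (OmegaT T) (pde_residual kappa c f p) <= U_pde kappa c f N P p <=
  normL2s (OmegaT T) (pde_residual kappa c f p) + K * h_P P ^+ 2.
Proof.
set phi := pde_residual kappa c f p.
have sm : smooth phi by exact: smooth_pde_residual.
have [M1 hM1] : bnd (rect (st_side T)) phi by exact: bnd_pde_residual.
have bd q : bnd (rect (st_side T)) (pder q phi) by exact: bnd_pder_pde_residual.
have [G hG] := choice bd.
have [M3 M30 hM3] := @h_pde_bounded R d w L T kappa c f N T0 L0 p.
set M := Num.max M1 (Num.max M3 (\big[Num.max/0]_q G q)).
have M0 : 0 <= M by rewrite !le_max M30 orbT.
have H0 : 0 <= 1 + T by rewrite addr_ge0// ltW.
have mphi : measurable_fun (@row_of_tuple R d.+1 @^-1` rect (st_side T)) (phi \o @row_of_tuple R d.+1).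
  apply: (@measurable_funS _ _ _ _ setT) => //.
  have := @measurable_continuous_on R d.+1 setT phi openT; rewrite preimage_setT; apply.
  by move=> x _; exact: smooth_continuous.
rewrite OmegaT_rect.
have hM1' x : rect (st_side T) x -> `|phi x| <= M.
  by move=> Ox; rewrite (le_trans (hM1 x Ox))// le_max lexx.
have hG' z q : st_open T z -> `|pder q phi z| <= M.
  move=> Oz; rewrite (le_trans (hG q z (st_open_sub Oz)))// !le_max.
  by rewrite (le_bigmax _ G q) !orbT.
have [K K0 hK] := @U1_sandwich R d.+1 (st_side T) (@st_side_interval R d T) (st_open T)
  (@st_open_sub R d T) (open_st_open T0) (@measurable_OmegaT R d T)
  (volume_OmegaT_lty T0) phi M (1 + T) mphi hM1'
  (fun x _ => @smooth_continuous R d.+1 phi sm x)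
  (fun z q _ => @smooth_derivable R d.+1 phi q z sm) M0 H0
  (fun z q l _ => @smooth_derivable R d.+1 _ l z (smooth_pder q sm)) hG'.
exists K => // P hP; apply: hK.
- exact: mesh_st_cells.
- by rewrite h_P_ge0 (h_P_le T0 hP).
- by move=> j; exact: st_rad_le_h.
- move=> z q l zP; rewrite (h_pde_ge0 _ _ _ _ _ _ _ _ hP zP)//=.
  by rewrite (le_trans (hM3 P z q l hP zP))// !le_max lexx !orbT.
- by move=> z q l; exact: h_pdeC.
- by move=> zc z q l zP Oz bz; apply: (@pde_hessian_sound R d w L T).
Qed.

Section Problem.
Variables (g h : 'rV[R]_d -> R) (Dg Dh : mindex d -> 'rV[R]_d -> 'rV[R]_d -> R) (r : nat).
Hypothesis r1 : (r <= 1)%N.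

Lemma U_grad_e0_sandwich : data_assumption (r + 2) g Dg ->
  exists2 K : R, 0 <= K & forall P, is_mesh T P ->
    normL2 Om (fun j : 'I_d => pder j (e0 f g)) <= U_grad_e0 f g N Dg P r <=
    normL2 Om (fun j : 'I_d => pder j (e0 f g)) + K * h_Omega P ^+ (r + 1).
Proof.
move=> hg.
have h1 j : exists K : R, 0 <= K /\ forall P, is_mesh T P ->
    normL2s Om (pder j (e0 f g)) <=
    Ubound (centers P) (radx P) r (pder j (e0 f g)) (b_de0 f N Dg P j) (h_de0 f N Dg P j) <=
    normL2s Om (pder j (e0 f g)) + K * h_Omega P ^+ (r + 1).
  by have [K K0 hK] := grad_e0_sandwich T f N L0 r1 j hg; exists K.
have [K hK] := choice h1; exists (\sum_j K j); first by apply: sumr_ge0 => j _; exact: (hK j).1.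
move=> P hP; rewrite normL2_sum.
- apply: sqrt_sum_sandwich.
  + by move=> j; exact: sqrtr_ge0.
  + by move=> j; exact: (hK j).1.
  + by rewrite exprn_ge0// h_Omega_ge0.
  + by move=> j; exact: (hK j).2.
- exact: measurable_Omega.
- exact: volume_Omega_lty.
- move=> j; apply: measurable_continuous_on; first exact: open_Omega.
  by have [] := grad_e0_regular f L0 j hg.
- by move=> j; have [] := grad_e0_regular f L0 j hg.
Qed.

Lemma lambda1_gt0 : 0 < lambda1 d :> R.
Proof. by rewrite mulr_gt0 ?ltr0n// exprn_gt0// pi_gt0. Qed.

Lemma residual_constants_ge0 : [/\ 0 <= alphaH kappa, 0 <= betaH d kappa, 0 <= C1 d kappa,
  0 <= C2 d kappa & [/\ 0 <= alphaW T c, 0 <= etaW T c & 0 <= betaW d T c]].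
Proof.
have l0 := lambda1_gt0; have := ltW kappa0; have := ltW c0; have := ltW T0 => t0 cc0 k0.
have C0 : 0 <= C_Omega d :> R by exact: sqrtr_ge0.
rewrite /alphaH /betaH /C1 /C2 /alphaW /etaW /betaW.
by split; [| | | |split]; repeat (apply: addr_ge0 || apply: mulr_ge0 || apply: sqrtr_ge0 ||
  (rewrite invr_ge0) || (apply: exprn_ge0) || exact: ler01 || exact: ler0n || assumption).
Qed.

End Problem.

Lemma combine2 (a b u1 v1 u2 v2 K1 K2 x y : R) : 0 <= a -> 0 <= b ->
  v1 <= u1 <= v1 + K1 * x -> v2 <= u2 <= v2 + K2 * y ->
  a * v1 + b * v2 <= a * u1 + b * u2 <= a * v1 + b * v2 + (a * K1 * x + b * K2 * y).
Proof.
move=> a0 b0 /andP[l1 r1] /andP[l2 r2]; rewrite lerD ?ler_wpM2l//=.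
have := ler_wpM2l a0 r1; have := ler_wpM2l b0 r2; rewrite !mulrDr !mulrA; lra.
Qed.

Lemma combine3 (a b e u1 v1 u2 v2 u3 v3 K1 K2 K3 x y : R) : 0 <= a -> 0 <= b -> 0 <= e ->
  v1 <= u1 <= v1 + K1 * x -> v2 <= u2 <= v2 + K2 * x -> v3 <= u3 <= v3 + K3 * y ->
  a * v1 + b * v2 + e * v3 <= a * u1 + b * u2 + e * u3 <=
  a * v1 + b * v2 + e * v3 + ((a * K1 + b * K2) * x + e * K3 * y).
Proof.
move=> a0 b0 e0 h1 h2 /andP[l3 r3]; have /andP[l r] := combine2 a0 b0 h1 h2.
rewrite lerD ?ler_wpM2l//=; have := ler_wpM2l e0 r3; rewrite !mulrDr !mulrDl !mulrA; lra.
Qed.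

(** The weights of the norms are nonnegative, so the sandwiches of the
individual terms add up. *)
Lemma residual_bound_sandwich (sigma : problem) (g h : 'rV[R]_d -> R)
    (Dg Dh : mindex d -> 'rV[R]_d -> 'rV[R]_d -> R) (r : nat) : (r <= 1)%N ->
  data_assumption (k_g sigma + r + 1) g Dg ->
  (sigma = sW -> data_assumption (r + 1) h Dh) ->
  exists2 K : R, 0 < K & forall P, is_mesh T P ->
    0 <= residual_bound T kappa c f g h N Dg Dh P sigma r - residual T kappa c f g h sigma
      <= K * (h_Omega P ^+ (r + 1) + h_P P ^+ 2).
Proof.
move=> r1 hg hh.
have [aH bH c1 c2 [aW eW bW]] := residual_constants_ge0.
suff [K1 [K2 [K10 K20 hK]]] : exists K1 K2 : R, [/\ 0 <= K1, 0 <= K2 & forall P, is_mesh T P ->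
    residual T kappa c f g h sigma <= residual_bound T kappa c f g h N Dg Dh P sigma r <=
    residual T kappa c f g h sigma + (K1 * h_Omega P ^+ (r + 1) + K2 * h_P P ^+ 2)].
  exists (1 + K1 + K2); first by rewrite -addrA ltr_wpDr// addr_ge0.
  move=> P /hK; have := h_Omega_ge0 P => h0; have := sqr_ge0 (h_P P) => h2.
  have {h0} : 0 <= h_Omega P ^+ (r + 1) by exact: exprn_ge0.
  set x := h_Omega P ^+ _; set y := h_P P ^+ 2 => x0 /andP[l u]; rewrite subr_ge0 l/= lerBlDl.
  rewrite (le_trans u)// lerD2l mulrDr lerD// ler_wpM2r//; lra.
have grade : (k_g sigma = 1)%N -> data_assumption (r + 2) g Dg.
  by move=> k1; move: hg; rewrite k1 add1n addSnnS.
case: sigma hg hh grade => hg hh grade /=.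
- have [K1 K10 hK1] := e0_sandwich T f N L0 r1 hg; have [K2 K20 hK2] := pde_sandwich Heat.
  exists (alphaH kappa * K1), (betaH d kappa * K2); split; [exact: mulr_ge0|exact: mulr_ge0|].
  by move=> P hP; apply: combine2 => //; [exact: hK1|exact: hK2].
- have [K1 K10 hK1] := U_grad_e0_sandwich r1 (grade erefl).
  have [K2 K20 hK2] := pde_sandwich Heat.
  exists (C1 d kappa * K1), (C2 d kappa * K2); split; [exact: mulr_ge0|exact: mulr_ge0|].
  by move=> P hP; apply: combine2 => //; [exact: hK1|exact: hK2].
- have [K1 K10 hK1] := U_grad_e0_sandwich r1 (grade erefl).
  have [K3 K30 hK3] := ev_sandwich T f N L0 r1 (hh erefl).
  have [K2 K20 hK2] := pde_sandwich Wave.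
  exists (alphaW T c * K1 + etaW T c * K3), (betaW d T c * K2).
  split; [by apply: addr_ge0; exact: mulr_ge0|exact: mulr_ge0|].
  by move=> P hP; apply: combine3 => //; [exact: hK1|exact: hK3|exact: hK2].
Qed.

End Final.

Theorem theorem4p7 (R : realType) (d w L : nat) (T kappa c : R)
    (f : network R d.+1 w L) (N : nat -> nat)
    (sigma : problem) (r : nat)
    (g h : 'rV[R]_d -> R)
    (Dg Dh : mindex d -> 'rV[R]_d -> 'rV[R]_d -> R)
    (hd : (0 < d)%N) (hw : (0 < w)%N) (hL : (0 < L)%N)
    (hT : 0 < T) (hkappa : 0 < kappa) (hc : 0 < c) (hr : (r <= 1)%N)
    (hg : data_assumption (k_g sigma + r + 1) g Dg)
    (hh : sigma = sW -> data_assumption (r + 1) h Dh) :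
  (exists2 K : R, 0 < K &
    forall P : mesh R d, is_mesh T P ->
      0 <= residual_bound T kappa c f g h N Dg Dh P sigma r
           - residual T kappa c f g h sigma
        <= K * (h_Omega P ^+ (r + 1) + h_P P ^+ 2)) /\
  (forall P : nat -> mesh R d, (forall i, is_mesh T (P i)) ->
    (fun i => h_Omega (P i)) @ \oo --> (0 : R) ->
    (fun i => h_P (P i)) @ \oo --> (0 : R) ->
    (fun i => residual_bound T kappa c f g h N Dg Dh (P i) sigma r) @ \oo
      --> residual T kappa c f g h sigma).
Proof.
have [K K0 hK] := residual_bound_sandwich f N hd hL hT hkappa hc hr hg hh.
split; first by exists K.
move=> P hP hO hPt; set rho := residual _ _ _ _ _ _ _.
have up : (fun i => rho + K * (h_Omega (P i) ^+ (r + 1) + h_P (P i) ^+ 2)) @ \oo --> rho.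
  have E : rho = rho + K * (0 ^+ (r + 1) + 0 ^+ 2) by rewrite addn1 !expr0n addr0 mulr0 addr0.
  rewrite [X in _ --> X]E; apply: cvgD; first exact: cvg_cst.
  apply: cvgM; first exact: cvg_cst.
  by apply: cvgD; [exact: (continuous_cvg _ (@exprn_continuous R _ 0) hO)
                  |exact: (continuous_cvg _ (@exprn_continuous R _ 0) hPt)].
apply: (squeeze_cvgr _ (cvg_cst rho) up).
by apply: nearW => i; have := hK _ (hP i); rewrite -/rho subr_ge0 lerBlDl.
Qed.
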